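(* Work in $\mathsf{ZF}$. (1) If there is a non-principal ultrafilter $U$ over $\omega$ but the Countable Choice fails, then there is a first-order structure $M$ such that $\mathsf{LT1}(M,U)$ holds but $\mathsf{LT2}(M,U)$ fails. (2) $\mathsf{LT}$ is equivalent to the following statement: for every first-order structure $M$ and every ultrafilter $U$ (over any set $I$), if $\mathsf{LT1}(M,U)$ holds then $\mathsf{LT2}(M,U)$ holds as well.
   Context: Base theory is $\mathsf{ZF}$. For an ultrafilter $U$ over a set $I$ and a first-order structure $M$ with language $\mathcal L$, the ultrapower ${}^IM/U$ has universe the classes $[f]$ of $f\in{}^IM$ under $f\simeq g\iff\{i: f(i)=g(i)\}\in U$, with relations/functions/constants interpreted coordinatewise modulo $U$. $\mathsf{LT1}(M,U)$: $M$ is elementarily equivalent to ${}^IM/U$. $\mathsf{LT2}(M,U)$: for every $\mathcal L$-formula $\varphi(v_0,\dots,v_n)$ and $f_0,\dots,f_n\in{}^IM$, ${}^IM/U\models\varphi([f_0],\dots,[f_n])$ iff $\{i\in I: M\models\varphi(f_0(i),\dots,f_n(i))\}\in U$. $\mathsf{LT}$ denotes Łoś's fundamental theorem of ultraproducts: for every ultrafilter $U$ over a set $I$ and every family $\{M_i\mid i\in I\}$ of structures in a common language with $\prod_{i\in I}M_i\neq\emptyset$, and every formula $\varphi$ and $f_0,\dots,f_n\in\prod_i M_i$, $\prod_i M_i/U\models\varphi([f_0],\dots,[f_n])$ iff $\{i: M_i\models\varphi(f_0(i),\dots,f_n(i))\}\in U$ (equivalently, in $\mathsf{ZF}$, $\mathsf{LT1}(M,U)$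 holds for all $M,U$). The Countable Choice $\mathsf{AC}_\omega$: every family $\{A_n\mid n<\omega\}$ of non-empty sets has a choice function. *)

(* Defs.v *)
(** First-order model theory carried out inside an arbitrary model [V] of ZF.

    Rocq itself may be extended by choice axioms, so a claim "provable in ZF"
    is rendered, following the completeness theorem, as "true in every model of
    ZF".  Ordered pairs, functions, ultrafilters, languages, formulas,
    structures, satisfaction, ... are all elements of [V] (so that natural
    numbers and formulas may be nonstandard), and every predicate below
    quantifies over elements of [V] only: each is the literal reading in [V] of
    a first-order formula of the language of set theory.  Operations are given
    by their graphs, so no description operator is needed. *)


Record membership_structure := MembershipStructure {
  carrier :> Type;
  mem : carrier -> carrier -> Prop
}.

Arguments mem {_} _ _.
Notation "x ∈ y" := (mem x y) (at level 70, no associativity).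

(** * The axioms of ZF *)

(** Formulas of the language of set theory, with de Bruijn indices.  They are
    only used for the two axiom schemas. *)
Inductive set_formula : Type :=
| SMem (i j : nat)
| SEq (i j : nat)
| SBot
| SAnd (p q : set_formula)
| SOr (p q : set_formula)
| SImp (p q : set_formula)
| SAll (p : set_formula)
| SEx (p : set_formula).

Definition scons {T : Type} (x : T) (r : nat -> T) (n : nat) : T :=
  match n with 0 => x | S m => r m end.

Fixpoint holds {V : membership_structure} (p : set_formula) (r : nat -> V)
  : Prop :=
  match p with
  | SMem i j => r i ∈ r j
  | SEq i j => r i = r j
  | SBot => False
  | SAnd p q => holds p r /\ holds q r
  | SOr p q => holds p r \/ holds q r
  | SImp p q => holds p r -> holds q r
  | SAll p => forall x : V, holds p (scons x r)
  | SEx p => exists x : V, holds p (scons x r)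
  end.

Definition subset {V : membership_structure} (a b : V) : Prop :=
  forall x, x ∈ a -> x ∈ b.

Definition is_empty {V : membership_structure} (e : V) : Prop :=
  forall x, ~ x ∈ e.

Definition nonempty {V : membership_structure} (a : V) : Prop :=
  exists x, x ∈ a.

(** [b = a ∪ {x}] *)
Definition is_adjoin {V : membership_structure} (a x b : V) : Prop :=
  forall y, y ∈ b <-> y ∈ a \/ y = x.

Definition is_succ {V : membership_structure} (n m : V) : Prop :=
  is_adjoin n n m.

Definition inductive_set {V : membership_structure} (w : V) : Prop :=
  (exists e, is_empty e /\ e ∈ w) /\
  (forall n, n ∈ w -> exists m, is_succ n m /\ m ∈ w).

(** [z = {x, y}] *)
Definition is_upair {V : membership_structure} (x y z : V) : Prop :=
  forall u, u ∈ z <-> u = x \/ u = y.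

Record ZF (V : membership_structure) : Prop := {
  ZF_extensionality : forall a b : V, (forall x, x ∈ a <-> x ∈ b) -> a = b;
  ZF_foundation : forall a : V,
    nonempty a -> exists x, x ∈ a /\ forall y, y ∈ x -> ~ y ∈ a;
  ZF_pairing : forall x y : V, exists z, is_upair x y z;
  ZF_union : forall a : V,
    exists b, forall x, x ∈ b <-> exists y, x ∈ y /\ y ∈ a;
  ZF_power_set : forall a : V, exists b, forall x, x ∈ b <-> subset x a;
  ZF_infinity : exists w : V, inductive_set w;
  ZF_separation : forall (p : set_formula) (r : nat -> V) (a : V),
    exists b, forall x, x ∈ b <-> x ∈ a /\ holds p (scons x r);
  ZF_replacement : forall (p : set_formula) (r : nat -> V) (a : V),
    (forall x, x ∈ a -> exists! y, holds p (scons x (scons y r))) ->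
    exists b, forall y,
      y ∈ b <-> exists x, x ∈ a /\ holds p (scons x (scons y r))
}.

(** * Pairs, functions, natural numbers, tuples *)

(** Kuratowski pairs: [p = {{x}, {x, y}}] *)
Definition is_opair {V : membership_structure} (x y p : V) : Prop :=
  exists s t, is_upair x x s /\ is_upair x y t /\ is_upair s t p.

(** For a function [f], [⟨x, y⟩ ∈ f] says [f(x) = y]. *)
Definition opair_mem {V : membership_structure} (x y r : V) : Prop :=
  exists p, is_opair x y p /\ p ∈ r.

Notation "⟨ x , y ⟩ ∈ r" := (opair_mem x y r)
  (at level 70, x at level 60, y at level 60, r at next level).

Definition is_otriple {V : membership_structure} (x y z p : V) : Prop :=
  exists q, is_opair y z q /\ is_opair x q p.

Definition is_function {V : membership_structure} (f a : V) : Prop :=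
  (forall p, p ∈ f -> exists x y, x ∈ a /\ is_opair x y p) /\
  (forall x, x ∈ a -> exists! y, ⟨x, y⟩ ∈ f).

Definition maps {V : membership_structure} (f a b : V) : Prop :=
  is_function f a /\ forall x y, ⟨x, y⟩ ∈ f -> y ∈ b.

(** [x] is the set of all functions from [a] to [b]. *)
Definition is_exponential {V : membership_structure} (a b x : V) : Prop :=
  forall f, f ∈ x <-> maps f a b.

Definition is_omega {V : membership_structure} (w : V) : Prop :=
  inductive_set w /\ forall w', inductive_set w' -> subset w w'.

(** An [n]-tuple is a function with domain the von Neumann numeral
    [n = {0, ..., n - 1}].  For a functional relation [P], the following says
    [r = (P(s_0), ..., P(s_(n-1)))]. *)
Definition is_image_tuple {V : membership_structure} (n s : V)
  (P : V -> V -> Prop) (r : V) : Prop :=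
  is_function r n /\
  forall k y, ⟨k, y⟩ ∈ r <-> exists x, ⟨k, x⟩ ∈ s /\ P x y.

Fixpoint is_numeral {V : membership_structure} (k : nat) (x : V) : Prop :=
  match k with
  | 0 => is_empty x
  | S k => exists y, is_numeral k y /\ is_succ y x
  end.

(** [c = ⟨k, x⟩]; used to code syntax *)
Definition is_tagged {V : membership_structure} (k : nat) (x c : V) : Prop :=
  exists e, is_numeral k e /\ is_opair e x c.

(** * Countable choice *)

Definition AC_omega (V : membership_structure) : Prop :=
  forall w A : V, is_omega w -> is_function A w ->
    (forall n a, ⟨n, a⟩ ∈ A -> nonempty a) ->
    exists c, is_function c w /\
      forall n a x, ⟨n, a⟩ ∈ A -> ⟨n, x⟩ ∈ c -> x ∈ a.

(** * Ultrafilters *)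

Definition is_ultrafilter {V : membership_structure} (I U : V) : Prop :=
  (forall X, X ∈ U -> subset X I) /\
  I ∈ U /\
  (forall X, is_empty X -> ~ X ∈ U) /\
  (forall X Y, X ∈ U -> subset X Y -> subset Y I -> Y ∈ U) /\
  (forall X Y Z, X ∈ U -> Y ∈ U ->
    (forall i, i ∈ Z <-> i ∈ X /\ i ∈ Y) -> Z ∈ U) /\
  (forall X Y, subset X I -> (forall i, i ∈ Y <-> i ∈ I /\ ~ i ∈ X) ->
    X ∈ U \/ Y ∈ U).

Definition is_principal {V : membership_structure} (I U : V) : Prop :=
  exists i, i ∈ I /\ forall X, X ∈ U <-> subset X I /\ i ∈ X.

(** [{i ∈ I : P i} ∈ U] *)
Definition large {V : membership_structure} (I U : V) (P : V -> Prop) : Prop :=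
  exists X, X ∈ U /\ forall i, i ∈ X <-> i ∈ I /\ P i.

(** * Languages and structures *)

(** A language is a pair [⟨ar_rel, ar_fun⟩] of functions, sending relation
    symbols to their positive arity and function symbols to their arity.
    Constants are the function symbols of arity 0. *)
Definition rel_symbol {V : membership_structure} (L R n : V) : Prop :=
  exists ar_rel ar_fun, is_opair ar_rel ar_fun L /\ ⟨R, n⟩ ∈ ar_rel.

Definition fun_symbol {V : membership_structure} (L F n : V) : Prop :=
  exists ar_rel ar_fun, is_opair ar_rel ar_fun L /\ ⟨F, n⟩ ∈ ar_fun.

Definition is_language {V : membership_structure} (L : V) : Prop :=
  exists ar_rel ar_fun rels funs w,
    is_omega w /\ is_opair ar_rel ar_fun L /\
    maps ar_rel rels w /\ maps ar_fun funs w /\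
    (forall R n, ⟨R, n⟩ ∈ ar_rel -> nonempty n).

(** A structure is a triple [⟨A, int_rel, int_fun⟩]: a nonempty universe, and
    the interpretations of the relation and of the function symbols. *)
Definition is_structure {V : membership_structure} (L M : V) : Prop :=
  exists A int_rel int_fun rels funs,
    is_otriple A int_rel int_fun M /\
    nonempty A /\
    (forall R, R ∈ rels <-> exists n, rel_symbol L R n) /\
    (forall F, F ∈ funs <-> exists n, fun_symbol L F n) /\
    is_function int_rel rels /\
    is_function int_fun funs /\
    (forall R n r, rel_symbol L R n -> ⟨R, r⟩ ∈ int_rel ->
      forall s, s ∈ r -> maps s n A) /\
    (forall F n f, fun_symbol L F n -> ⟨F, f⟩ ∈ int_fun ->
      exists An, is_exponential n A An /\ maps f An A).

Definition universe {V : membership_structure} (M A : V) : Prop :=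
  exists int_rel int_fun, is_otriple A int_rel int_fun M.

(** [R^M(s)] *)
Definition rel_holds {V : membership_structure} (M R s : V) : Prop :=
  exists A int_rel int_fun r,
    is_otriple A int_rel int_fun M /\ ⟨R, r⟩ ∈ int_rel /\ s ∈ r.

(** [F^M(s) = y] *)
Definition fun_value {V : membership_structure} (M F s y : V) : Prop :=
  exists A int_rel int_fun f,
    is_otriple A int_rel int_fun M /\ ⟨F, f⟩ ∈ int_fun /\ ⟨s, y⟩ ∈ f.

(** * Syntax

    Variables [v_k] are indexed by [k ∈ ω]; [D ⊆ ω] always stands for a set of
    (indices of) variables. *)

Definition is_var {V : membership_structure} (k t : V) : Prop :=
  is_tagged 0 k t.

(** [t] codes [F(s_0, ..., s_(n-1))]. *)
Definition is_app {V : membership_structure} (F s t : V) : Prop :=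
  exists p, is_opair F s p /\ is_tagged 1 p t.

(** [p] codes [t = u]. *)
Definition is_equality {V : membership_structure} (t u p : V) : Prop :=
  exists q, is_opair t u q /\ is_tagged 2 q p.

(** [p] codes [R(s_0, ..., s_(n-1))]. *)
Definition is_atom {V : membership_structure} (R s p : V) : Prop :=
  exists q, is_opair R s q /\ is_tagged 3 q p.

Definition is_negation {V : membership_structure} (p q : V) : Prop :=
  is_tagged 4 p q.

Definition is_conjunction {V : membership_structure} (p1 p2 q : V) : Prop :=
  exists c, is_opair p1 p2 c /\ is_tagged 5 c q.

(** [q] codes [∃ v_k, p]. *)
Definition is_existential {V : membership_structure} (k p q : V) : Prop :=
  exists c, is_opair k p c /\ is_tagged 6 c q.

Definition closed_under_terms {V : membership_structure} (L D T : V) : Prop :=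
  (forall k t, k ∈ D -> is_var k t -> t ∈ T) /\
  (forall F n s t, fun_symbol L F n -> maps s n T -> is_app F s t -> t ∈ T).

(** [t] is an [L]-term whose variables are indexed in [D]: terms form the least
    set closed under the formation rules. *)
Definition is_term {V : membership_structure} (L D t : V) : Prop :=
  forall T, closed_under_terms L D T -> t ∈ T.

Definition is_term_tuple {V : membership_structure} (L D n s : V) : Prop :=
  is_function s n /\ forall k t, ⟨k, t⟩ ∈ s -> is_term L D t.

(** The formation rules for the set of all pairs [⟨D, p⟩] such that [D ⊆ ω]
    and the free variables of the formula [p] are indexed in [D].  Without the
    restriction [D ⊆ ω] no set would satisfy them. *)
Definition closed_under_formulas {V : membership_structure} (L Phi : V)
  : Prop :=
  forall w D, is_omega w -> subset D w ->
    (forall t u p, is_term L D t -> is_term L D u -> is_equality t u p ->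
      ⟨D, p⟩ ∈ Phi) /\
    (forall R n s p, rel_symbol L R n -> is_term_tuple L D n s ->
      is_atom R s p -> ⟨D, p⟩ ∈ Phi) /\
    (forall p q, ⟨D, p⟩ ∈ Phi -> is_negation p q -> ⟨D, q⟩ ∈ Phi) /\
    (forall p1 p2 q, ⟨D, p1⟩ ∈ Phi -> ⟨D, p2⟩ ∈ Phi ->
      is_conjunction p1 p2 q -> ⟨D, q⟩ ∈ Phi) /\
    (forall k D' p q, k ∈ w -> is_adjoin D k D' -> ⟨D', p⟩ ∈ Phi ->
      is_existential k p q -> ⟨D, q⟩ ∈ Phi).

Definition is_formula {V : membership_structure} (L D p : V) : Prop :=
  forall Phi, closed_under_formulas L Phi -> ⟨D, p⟩ ∈ Phi.

Definition is_sentence {V : membership_structure} (L p : V) : Prop :=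
  exists e, is_empty e /\ is_formula L e p.

(** * Semantics *)

(** [e] evaluates in [M] the terms with variables in [D], under the assignment
    [a : D -> A]. *)
Definition is_evaluation {V : membership_structure} (L M D a e : V) : Prop :=
  exists A T,
    universe M A /\ (forall t, t ∈ T <-> is_term L D t) /\ maps e T A /\
    (forall k t x, is_var k t -> ⟨k, x⟩ ∈ a -> ⟨t, x⟩ ∈ e) /\
    (forall F n s t r y, fun_symbol L F n -> maps s n T -> is_app F s t ->
      is_image_tuple n s (fun u x => ⟨u, x⟩ ∈ e) r -> fun_value M F r y ->
      ⟨t, y⟩ ∈ e).

Definition term_value {V : membership_structure} (L M D a t x : V) : Prop :=
  exists e, is_evaluation L M D a e /\ ⟨t, x⟩ ∈ e.

(** [S] is a set of pairs [⟨p, a⟩] obeying Tarski's clauses, for all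
    assignments [a : D -> A] and formulas [p] with free variables in [D]. *)
Definition is_truth_set {V : membership_structure} (L M S : V) : Prop :=
  forall w A D a,
    is_omega w -> universe M A -> subset D w -> maps a D A ->
    (forall t u p, is_term L D t -> is_term L D u -> is_equality t u p ->
      (⟨p, a⟩ ∈ S <->
       exists x, term_value L M D a t x /\ term_value L M D a u x)) /\
    (forall R n s p, rel_symbol L R n -> is_term_tuple L D n s ->
      is_atom R s p ->
      (⟨p, a⟩ ∈ S <->
       exists r, is_image_tuple n s (term_value L M D a) r /\
                 rel_holds M R r)) /\
    (forall p q, is_formula L D p -> is_negation p q ->
      (⟨q, a⟩ ∈ S <-> ~ ⟨p, a⟩ ∈ S)) /\
    (forall p1 p2 q, is_formula L D p1 -> is_formula L D p2 ->
      is_conjunction p1 p2 q ->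
      (⟨q, a⟩ ∈ S <-> ⟨p1, a⟩ ∈ S /\ ⟨p2, a⟩ ∈ S)) /\
    (forall k D' p q, k ∈ w -> is_adjoin D k D' -> is_formula L D' p ->
      is_existential k p q ->
      (⟨q, a⟩ ∈ S <->
       exists b, maps b D' A /\
         (forall j x, j <> k -> (⟨j, x⟩ ∈ b <-> ⟨j, x⟩ ∈ a)) /\
         ⟨p, b⟩ ∈ S)).

(** [M ⊨ p[a]], where the domain of the assignment [a] contains the (indices
    of the) free variables of [p]; for [p(v_0, ..., v_n)], [a] is an
    [(n+1)]-tuple. *)
Definition satisfies {V : membership_structure} (L M p a : V) : Prop :=
  exists S, is_truth_set L M S /\ ⟨p, a⟩ ∈ S.

Definition elementarily_equivalent {V : membership_structure} (L M N : V)
  : Prop :=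
  forall p e, is_sentence L p -> is_empty e ->
    (satisfies L M p e <-> satisfies L N p e).

(** * Ultraproducts and ultrapowers *)

(** [Ms] is a family [{M_i | i ∈ I}] of [L]-structures. *)
Definition is_family {V : membership_structure} (L I Ms : V) : Prop :=
  is_function Ms I /\ forall i M, ⟨i, M⟩ ∈ Ms -> is_structure L M.

Definition is_constant_family {V : membership_structure} (I M Ms : V) : Prop :=
  is_function Ms I /\ forall i N, ⟨i, N⟩ ∈ Ms -> N = M.

Definition in_product {V : membership_structure} (I Ms f : V) : Prop :=
  is_function f I /\
  forall i M A x, ⟨i, M⟩ ∈ Ms -> universe M A -> ⟨i, x⟩ ∈ f -> x ∈ A.

(** [c = [f]] *)
Definition is_class {V : membership_structure} (I U Ms f c : V) : Prop :=
  forall g, g ∈ c <->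
    in_product I Ms g /\
    large I U (fun i => exists x, ⟨i, x⟩ ∈ f /\ ⟨i, x⟩ ∈ g).

Definition is_product_tuple {V : membership_structure} (I Ms n s : V) : Prop :=
  is_function s n /\ forall k f, ⟨k, f⟩ ∈ s -> in_product I Ms f.

(** [q = ([s_0], ..., [s_(n-1)])] *)
Definition is_class_tuple {V : membership_structure} (I U Ms n s q : V)
  : Prop :=
  is_image_tuple n s (is_class I U Ms) q.

(** [r = (s_0(i), ..., s_(n-1)(i))] *)
Definition is_tuple_at {V : membership_structure} (i n s r : V) : Prop :=
  is_image_tuple n s (fun f x => ⟨i, x⟩ ∈ f) r.

Definition is_ultraproduct {V : membership_structure} (L I U Ms N : V) : Prop :=
  is_structure L N /\
  (forall A, universe N A ->
    forall c, c ∈ A <-> exists f, in_product I Ms f /\ is_class I U Ms f c) /\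
  (forall R n s q, rel_symbol L R n -> is_product_tuple I Ms n s ->
    is_class_tuple I U Ms n s q ->
    (rel_holds N R q <->
     large I U (fun i => exists M r,
       ⟨i, M⟩ ∈ Ms /\ is_tuple_at i n s r /\ rel_holds M R r))) /\
  (forall F n s q g c, fun_symbol L F n -> is_product_tuple I Ms n s ->
    is_class_tuple I U Ms n s q -> in_product I Ms g -> is_class I U Ms g c ->
    (fun_value N F q c <->
     large I U (fun i => exists M r y,
       ⟨i, M⟩ ∈ Ms /\ is_tuple_at i n s r /\ fun_value M F r y /\
       ⟨i, y⟩ ∈ g))).

Definition is_ultrapower {V : membership_structure} (L I U M N : V) : Prop :=
  exists Ms, is_constant_family I M Ms /\ is_ultraproduct L I U Ms N.

(** * Łoś's theorem *)

(** In [LT1], [LT2] and [LT], [N] denotes the ultraproduct: there is exactly one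
    such [N], the product being nonempty. *)
Definition LT1 {V : membership_structure} (L M I U : V) : Prop :=
  forall N, is_ultrapower L I U M N -> elementarily_equivalent L M N.

(** For every formula [p(v_0, ..., v_n)] and [s = (f_0, ..., f_n)], where
    [m = n + 1 = {0, ..., n}]. *)
Definition Los_equivalence {V : membership_structure} (L I U Ms N : V) : Prop :=
  forall w n m p s q, is_omega w -> n ∈ w -> is_succ n m ->
    is_formula L m p -> is_product_tuple I Ms m s ->
    is_class_tuple I U Ms m s q ->
    (satisfies L N p q <->
     large I U (fun i => exists M r,
       ⟨i, M⟩ ∈ Ms /\ is_tuple_at i m s r /\ satisfies L M p r)).

Definition LT2 {V : membership_structure} (L M I U : V) : Prop :=
  forall Ms N, is_constant_family I M Ms -> is_ultraproduct L I U Ms N ->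
    Los_equivalence L I U Ms N.

Definition LT (V : membership_structure) : Prop :=
  forall L I U Ms N : V, is_language L -> is_ultrafilter I U ->
    is_family L I Ms -> (exists f, in_product I Ms f) ->
    is_ultraproduct L I U Ms N -> Los_equivalence L I U Ms N.

(* Main.v *)
(** An ultrafilter [U] over [I] satisfies Łoś's theorem as soon as every family
    of nonempty sets [F_i] (i ∈ I) has a choice function on a set of [U]: choice
    is only needed to pick witnesses for an existential quantifier.

    Conversely let [F] be a family without such a choice function.  Consider an
    equivalence relation with infinitely many classes attached to each [i ∈ I],
    having infinitely many marked points and infinitely many unmarked points
    indexed by [F_i], and with infinitely many further classes, having marked
    points only.  In the ultrapower the class of [i ↦ (a marked point over i)]
    has no unmarked point, since a witness would choose from [F] on a set of
    [U]; so [LT2] fails.  But both the structure and its ultrapower have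
    infinitely many classes with, and infinitely many classes without, unmarked
    points, all of them infinite, and a back-and-forth argument shows that they
    are elementarily equivalent; so [LT1] holds.

    This gives (2) at once, and (1) because countable choice reduces to choosing
    from the finite products [A_0 × ... × A_(n-1)] for unboundedly many [n], and
    the sets of a nonprincipal ultrafilter over [ω] are unbounded. *)

From Stdlib Require Import Classical ClassicalEpsilon FunctionalExtensionality PeanoNat.
Require Import Defs.

(* The schemas of [ZF] speak of formulas, so every class that is separated, replaced or used in an
   induction has to be recognised as the interpretation of a formula with parameters. The predicate
   [dfn] expresses this, and operations introduced by the description [the] stay within its reach.

   The obstacle is that [LT1] must hold for the counterexample although choice is missing. In the
   ultrapower, a sequence of classes that all have unmarked points may yield a class that has none.
   Infinitely many classes without unmarked points are therefore present in the structure from the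
   start, so that further ones cannot be detected by a sentence. All infinitude comes from the two
   [omega] components of a point, one counting classes and one counting points inside a class. They
   can be changed coordinatewise by explicit operations, and so the ultrapower inherits the
   infinitude without any choice.

   Formulas and numbers of the model may be nonstandard. Hence the back-and-forth argument is an
   induction on formulas inside [V], and finite means bounded by an element of [omega]. *)
Existing Class ZF.

(** Set-theoretic operations are sealed, because the conversion test would
    otherwise unfold them to [epsilon] terms of exponential size. *)
Lemma seal {A : Type} (x : A) : {y : A | y = x}.
Proof. now exists x. Qed.

Tactic Notation "unseal" reference(c) :=
  unfold c; rewrite (proj2_sig (seal _)); cbv beta.

(** * Renaming of variables in formulas of set theory *)

Fixpoint rename (f : nat -> nat) (p : set_formula) : set_formula :=
  let up g n := match n with 0 => 0 | S m => S (g m) end in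
  match p with
  | SMem i j => SMem (f i) (f j)
  | SEq i j => SEq (f i) (f j)
  | SBot => SBot
  | SAnd p q => SAnd (rename f p) (rename f q)
  | SOr p q => SOr (rename f p) (rename f q)
  | SImp p q => SImp (rename f p) (rename f q)
  | SAll p => SAll (rename (up f) p)
  | SEx p => SEx (rename (up f) p)
  end.

Lemma holds_rename {V : membership_structure} (p : set_formula) :
  forall (f : nat -> nat) (r r' : nat -> V),
  (forall n, r' n = r (f n)) -> (holds (rename f p) r <-> holds p r').
Proof.
  assert (up : forall f (r r' : nat -> V) (x : V), (forall n, r' n = r (f n)) ->
    forall n, scons x r' n =
      scons x r (match n with 0 => 0 | S m => S (f m) end)).
  { intros f r r' x H [|n]; simpl; auto. }
  induction p; intros f r r' H; simpl; try rewrite !H;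
    try (rewrite (IHp1 f r r' H), (IHp2 f r r' H)); try tauto.
  - split; intros K x; apply (IHp _ _ _ (up f r r' x H)), K.
  - split; intros [x K]; exists x; apply (IHp _ _ _ (up f r r' x H)), K.
Qed.

(** * Definable relations *)

Section Definability.
Context {V : membership_structure}.
Notation env := (nat -> V).

Definition look (e : nat -> nat + V) (r : env) (n : nat) : V :=
  match e n with inl i => r i | inr v => v end.

(** [P] is the interpretation of a set-theoretic formula with parameters; [e]
    tells which variables of the formula are the variables of [P] and which
    ones are parameters. *)
Definition dfn (P : env -> Prop) : Prop :=
  exists p e, forall r, holds p (look e r) <-> P r.

(** The language of set theory has no function symbols, so a function is definable through its
    graph; variable 0 holds the value. *)
Definition dterm (f : env -> V) : Prop :=
  dfn (fun r => r 0 = f (fun n => r (S n))).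

Lemma dfn_ext (P Q : env -> Prop) :
  (forall r, P r <-> Q r) -> dfn P -> dfn Q.
Proof. intros H (p & e & K). exists p, e. intro r. now rewrite K. Qed.

Lemma dfn_mem_var i j : dfn (fun r => r i ∈ r j).
Proof. exists (SMem i j), (fun n => inl n). intro r. reflexivity. Qed.

Lemma dfn_eq_var i j : dfn (fun r => r i = r j).
Proof. exists (SEq i j), (fun n => inl n). intro r. reflexivity. Qed.

Lemma dfn_False : dfn (fun _ => False).
Proof. exists SBot, (fun n => inl n). intro r. reflexivity. Qed.

(** The two formulas come with different assignments of parameters. Sending the variables of one to
    even and those of the other to odd positions lets a single interleaved assignment serve both. *)
Lemma dfn_binary (c : set_formula -> set_formula -> set_formula)
  (o : Prop -> Prop -> Prop) (P Q : env -> Prop) :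
  (forall p q (r : env), holds (c p q) r = o (holds p r) (holds q r)) ->
  (forall A A' B B', (A <-> A') -> (B <-> B') -> (o A B <-> o A' B')) ->
  dfn P -> dfn Q -> dfn (fun r => o (P r) (Q r)).
Proof.
  intros Hc Ho (p & e & Hp) (q & e' & Hq).
  exists (c (rename (fun n => 2 * n) p) (rename (fun n => S (2 * n)) q)).
  exists (fun n => if Nat.even n then e (Nat.div2 n) else e' (Nat.div2 n)).
  intro r. rewrite Hc. apply Ho.
  - rewrite <- Hp. apply holds_rename. intro n. unfold look.
    now rewrite Nat.even_mul, Nat.div2_double.
  - rewrite <- Hq. apply holds_rename. intro n. unfold look.
    rewrite Nat.even_succ, Nat.odd_mul, Nat.div2_succ_double. reflexivity.
Qed.

Lemma dfn_and P Q : dfn P -> dfn Q -> dfn (fun r => P r /\ Q r).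
Proof. apply (dfn_binary SAnd and); [reflexivity | tauto]. Qed.

Lemma dfn_or P Q : dfn P -> dfn Q -> dfn (fun r => P r \/ Q r).
Proof. apply (dfn_binary SOr or); [reflexivity | tauto]. Qed.

Lemma dfn_imp P Q : dfn P -> dfn Q -> dfn (fun r => P r -> Q r).
Proof.
  apply (dfn_binary SImp (fun A B => A -> B)); [reflexivity | tauto].
Qed.

Lemma dfn_not P : dfn P -> dfn (fun r => ~ P r).
Proof. intro H. apply dfn_imp; auto using dfn_False. Qed.

Lemma dfn_iff P Q : dfn P -> dfn Q -> dfn (fun r => P r <-> Q r).
Proof. intros. apply dfn_and; apply dfn_imp; auto. Qed.

(** Several formula variables may stand for the variable to be quantified, whereas a quantifier
    binds only index 0. All of them are renamed to 0, and the others are shifted past the binder. *)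
Lemma dfn_binder (Q : V -> env -> Prop) :
  dfn (fun r => Q (r 0) (fun n => r (S n))) ->
  exists p e, forall x r, holds p (scons x (look e r)) <-> Q x r.
Proof.
  intros (p & e & H).
  exists (rename (fun n => match e n with inl 0 => 0 | _ => S n end) p).
  exists (fun n => match e n with
           | inl 0 => inl 0 | inl (S i) => inl i | inr v => inr v end).
  intros x r. rewrite <- (H (scons x r)). apply holds_rename.
  intro n. unfold look. destruct (e n) as [[|i]|v] eqn:E; simpl; now rewrite ?E.
Qed.

Lemma dfn_ex (Q : V -> env -> Prop) :
  dfn (fun r => Q (r 0) (fun n => r (S n))) -> dfn (fun r => exists x, Q x r).
Proof.
  intro H. destruct (dfn_binder Q H) as (p & e & K). exists (SEx p), e.
  intro r. simpl. split; intros [x Hx]; exists x; now apply K.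
Qed.

Lemma dfn_all (Q : V -> env -> Prop) :
  dfn (fun r => Q (r 0) (fun n => r (S n))) -> dfn (fun r => forall x, Q x r).
Proof.
  intro H. destruct (dfn_binder Q H) as (p & e & K). exists (SAll p), e.
  intro r. simpl. split; intros Hx x; now apply K.
Qed.

Lemma dfn_look (s : nat -> nat + V) P :
  dfn P -> dfn (fun r => P (look s r)).
Proof.
  intros (p & e & H). exists p.
  exists (fun n => match e n with inl i => s i | inr v => inr v end).
  intro r. rewrite <- H. replace (look _ _) with (look e (look s r)); [tauto|].
  apply functional_extensionality. intro n.
  unfold look. now destruct (e n).
Qed.

Lemma dfn_ren (k : nat -> nat) P : dfn P -> dfn (fun r => P (fun n => r (k n))).
Proof. apply (dfn_look (fun n => inl (k n))). Qed.

Lemma dterm_ren (k : nat -> nat) f :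
  dterm f -> dterm (fun r => f (fun n => r (k n))).
Proof.
  intro H.
  exact (dfn_ren (fun n => match n with 0 => 0 | S m => S (k m) end) _ H).
Qed.

Lemma dterm_var i : dterm (fun r => r i).
Proof. apply dfn_eq_var. Qed.

Lemma dterm_const (c : V) : dterm (fun _ => c).
Proof.
  exact (dfn_look (fun n => match n with 0 => inl 0 | _ => inr c end) _
    (dfn_eq_var 0 1)).
Qed.

Lemma dfn_subst (P : V -> env -> Prop) f :
  dfn (fun r => P (r 0) (fun n => r (S n))) -> dterm f ->
  dfn (fun r => P (f r) r).
Proof.
  intros HP Hf. apply dfn_ext with (fun r => exists x, x = f r /\ P x r).
  - intro r. split; [intros (x & -> & H); exact H | eauto].
  - apply (dfn_ex (fun x r => x = f r /\ P x r)). now apply dfn_and.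
Qed.

Lemma dfn_eq f g : dterm f -> dterm g -> dfn (fun r => f r = g r).
Proof.
  intros Hf Hg. apply (dfn_subst (fun x r => x = g r)); auto.
Qed.

(** This lemma and its analogues below reduce a notion applied to terms to the same notion applied
    to variables, the form in which [dfn_hyp] finds it among the hypotheses. *)
Lemma dfn_pred1 (P : V -> Prop) f :
  dfn (fun r => P (r 0)) -> dterm f -> dfn (fun r => P (f r)).
Proof. apply (dfn_subst (fun x _ => P x)). Qed.

Lemma dfn_pred2 (P : V -> V -> Prop) f g :
  dfn (fun r => P (r 0) (r 1)) -> dterm f -> dterm g ->
  dfn (fun r => P (f r) (g r)).
Proof.
  intros HP Hf Hg. apply (dfn_subst (fun x r => P x (g r))); auto.
  apply (dfn_subst (fun y r => P (r 0) y)).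
  - exact (dfn_ren (fun n => match n with 0 => 1 | _ => 0 end) _ HP).
  - now apply (dterm_ren S).
Qed.

Lemma dfn_mem f g : dterm f -> dterm g -> dfn (fun r => f r ∈ g r).
Proof. apply dfn_pred2, dfn_mem_var. Qed.

Lemma dterm_fun1 (F : V -> V) f :
  dterm (fun r => F (r 0)) -> dterm f -> dterm (fun r => F (f r)).
Proof.
  intros HF Hf. apply (dfn_pred2 (fun x y => x = F y) (fun r => r 0)
    (fun r => f (fun n => r (S n)))); auto using dterm_var.
  now apply (dterm_ren S).
Qed.

Lemma dfn_pred3 (P : V -> V -> V -> Prop) f g h :
  dfn (fun r => P (r 0) (r 1) (r 2)) -> dterm f -> dterm g -> dterm h ->
  dfn (fun r => P (f r) (g r) (h r)).
Proof.
  intros HP Hf Hg Hh. apply (dfn_subst (fun x r => P x (g r) (h r))); auto.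
  apply (dfn_subst (fun y r => P (r 0) y (h (fun n => r (S n))))).
  2: now apply (dterm_ren S).
  apply (dfn_subst (fun z r => P (r 1) (r 0) z)).
  - refine (dfn_ren (fun n => match n with 0 => 2 | 1 => 1 | _ => 0 end) _ HP).
  - now apply (dterm_ren (fun n => S (S n))).
Qed.

Lemma dterm_fun2 (F : V -> V -> V) f g :
  dterm (fun r => F (r 0) (r 1)) -> dterm f -> dterm g ->
  dterm (fun r => F (f r) (g r)).
Proof.
  intros HF Hf Hg.
  apply (dfn_pred3 (fun x y z => x = F y z) (fun r => r 0)
    (fun r => f (fun n => r (S n))) (fun r => g (fun n => r (S n))));
    auto using dterm_var.
  all: now apply (dterm_ren S).
Qed.

End Definability.

(** [dfn] solves definability goals by recursion on the syntax; [dfn_hook] is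
    extended below with the definability of the notions being introduced. *)
Ltac dfn_hook := fail.
Ltac dfn_step :=
  cbv beta;
  match goal with
  | |- dfn (fun r => _ /\ _) => apply dfn_and
  | |- dfn (fun r => _ \/ _) => apply dfn_or
  | |- dfn (fun r => _ <-> _) => apply dfn_iff
  | |- dfn (fun r => ~ _) => apply dfn_not
  | |- dfn (fun r => False) => apply dfn_False
  | |- dfn (fun r => exists x, @?Q r x) => apply (dfn_ex (fun x r => Q r x))
  | |- dfn (fun r => exists! x, _) => unfold unique
  (* The type of the bound variable keeps this case apart from implication. *)
  | |- dfn (fun r => forall x : carrier _, @?Q r x) =>
      apply (dfn_all (fun x r => Q r x))
  | |- dfn (fun r => @?A r -> @?B r) => apply (dfn_imp A B)
  | |- dfn (fun r => @?f r = @?g r) => apply (dfn_eq f g)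
  | |- dfn (fun r => @?f r ∈ @?g r) => apply (dfn_mem f g)
  | |- dterm (fun r => r ?i) => apply dterm_var
  | |- dterm (fun r => ?c) => apply dterm_const
  (* Under a binder the outer variables are shifted, so an abstract term or predicate of the
     environment reappears composed with a renaming. *)
  | |- dterm (fun r => ?f (fun n => r (@?k n))) =>
      apply (dterm_ren k f)
  | |- dfn (fun r => ?f (fun n => r (@?k n))) =>
      apply (dfn_ren k f)
  end.
Ltac dfn_hyp :=
  match goal with
  | H : dfn (fun r => ?P (r 0)) |- dfn (fun r => ?P _) => apply (dfn_pred1 P)
  | H : dfn (fun r => ?P (r 0) (r 1)) |- dfn (fun r => ?P _ _) =>
      apply (dfn_pred2 P)
  | H : dterm (fun r => ?F (r 0)) |- dterm (fun r => ?F _) =>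
      apply (dterm_fun1 F)
  | H : dterm (fun r => ?F (r 0) (r 1)) |- dterm (fun r => ?F _ _) =>
      apply (dterm_fun2 F)
  end.
Ltac dfn :=
  intros; repeat first [assumption | dfn_step | dfn_hyp | dfn_hook].

(** * Definite descriptions, and comprehension for definable classes *)

Section DefiniteDescription.
Context {V : membership_structure} {hV : ZF V}.
Notation env := (nat -> V).

Lemma carrier_inhabited : inhabited V.
Proof. destruct (ZF_infinity V hV) as [w _]. exact (inhabits w). Qed.

(** The fallback value is definable, so that [the] preserves definability. *)
Definition the : (V -> Prop) -> V :=
  proj1_sig (seal (fun (P : V -> Prop) =>
    epsilon carrier_inhabited (fun y =>
    ((exists! z, P z) /\ P y) \/ (~ (exists! z, P z) /\ is_empty y)))).

Lemma ext (a b : V) : (forall x, x ∈ a <-> x ∈ b) -> a = b.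
Proof. apply (ZF_extensionality V hV). Qed.

Lemma separation (P : V -> Prop) :
  dfn (fun r => P (r 0)) ->
  forall a, exists b, forall x, x ∈ b <-> x ∈ a /\ P x.
Proof.
  intros H a.
  destruct (dfn_binder (fun x (_ : env) => P x) H) as (p & e & K).
  destruct (ZF_separation V hV p (look e (fun _ => a)) a) as [b Hb].
  exists b. intro x. now rewrite Hb, K.
Qed.

Lemma replacement (F : V -> V) :
  dterm (fun r => F (r 0)) ->
  forall a, exists b, forall y, y ∈ b <-> exists x, x ∈ a /\ y = F x.
Proof.
  intros HF a.
  destruct HF as (p & d & L).
  (* The graph formula of a [dterm] has its value in variable 0, while the axiom of replacement puts
     the argument there and the value in variable 1. Parameters move behind both. *)
  set (f := fun n => match d n with inl 0 => 1 | inl _ => 0 | inr _ => S (S n) end).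
  set (c := fun n => match d n with inr v => v | _ => a end).
  assert (M : forall x y, holds (rename f p) (scons x (scons y c)) <-> y = F x).
  { intros x y. rewrite <- (L (scons y (fun _ => x))). apply holds_rename.
    intro n. unfold look, f, c, scons.
    destruct (d n) as [[|i]|v] eqn:E; simpl; rewrite ?E; auto. }
  destruct (ZF_replacement V hV (rename f p) c a) as [b Hb].
  - intros x _. exists (F x). split; [now apply M | intros y Hy; symmetry; now apply M].
  - exists b. intro y. rewrite Hb. split; intros (x & Hx & E); exists x; split; auto;
      now apply M.
Qed.

Lemma is_empty_exists : exists e : V, is_empty e.
Proof. destruct (ZF_infinity V hV) as [w [(e & He & _) _]]. now exists e. Qed.

Lemma the_spec P : (exists! y, P y) -> P (the P).
Proof.
  intro H. unseal the.
  match goal with |- P (epsilon ?i ?Q) => destruct (epsilon_spec i Q) as [K|K] end.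
  - destruct H as [y Hy]. exists y. left. split; [now exists y | apply Hy].
  - apply K.
  - tauto.
Qed.

Lemma the_eq (P : V -> Prop) y : P y -> (forall z, P z -> z = y) -> the P = y.
Proof.
  intros H K. apply K, the_spec. exists y. split; auto. intros z Hz. symmetry; auto.
Qed.

Lemma in_the (P : V -> Prop) :
  (exists y, forall x, x ∈ y <-> P x) ->
  forall x, x ∈ the (fun b => forall x, x ∈ b <-> P x) <-> P x.
Proof.
  intros [y H]. apply (the_spec (fun b => forall x, x ∈ b <-> P x)).
  exists y. split; auto. intros z Hz. apply ext. intro x. now rewrite Hz, H.
Qed.

(** The right-hand side no longer mentions [epsilon] and is built from [P] by first-order means;
    this is what makes descriptions definable in [dterm_the]. *)
Lemma the_graph P y :
  y = the P <-> ((exists! z, P z) /\ P y) \/ (~ (exists! z, P z) /\ is_empty y).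
Proof.
  destruct (classic (exists! z, P z)) as [H|H].
  - pose proof (the_spec P H) as K. split.
    + intros ->. auto.
    + intros [[_ L]|[L _]]; [|tauto]. destruct H as (z & _ & U).
      now rewrite <- (U y L), <- (U _ K).
  - unseal the. match goal with |- context [epsilon ?i ?Q] =>
      pose proof (epsilon_spec i Q) as S; set (t := epsilon i Q) in * end.
    destruct S as [S|S]; [|tauto|].
    + destruct is_empty_exists as [e He]. exists e. auto.
    + split; [intros ->; auto | intros [L|[_ L]]; [tauto|]].
      apply ext. intro x. destruct S as [_ S]. specialize (S x). specialize (L x).
      tauto.
Qed.

Lemma dfn_is_empty f : dterm f -> dfn (fun r : env => is_empty (f r)).
Proof. intro. unfold is_empty. dfn. Qed.

Lemma dterm_the (Q : V -> env -> Prop) :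
  dfn (fun r => Q (r 0) (fun n => r (S n))) ->
  dterm (fun r => the (fun y => Q y r)).
Proof.
  intro H. unfold dterm.
  apply dfn_ext with (fun r : env =>
    ((exists! z, Q z (fun n => r (S n))) /\ Q (r 0) (fun n => r (S n))) \/
    (~ (exists! z, Q z (fun n => r (S n))) /\ is_empty (r 0))).
  - intro r. symmetry. apply the_graph.
  - assert (K : dfn (fun r => Q (r 0) (fun n => r (S (S n))))).
    { exact (dfn_ren (fun n => match n with 0 => 0 | S m => S (S m) end) _ H). }
    assert (L : dfn (fun r => Q (r 0) (fun n => r (S (S (S n)))))).
    { exact (dfn_ren (fun n => match n with 0 => 0 | S m => S (S (S m)) end) _ H). }
    assert (E : dfn (fun r : env => exists! z, Q z (fun n => r (S n)))).
    { apply dfn_ex. apply dfn_and; [exact K|].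
      apply (dfn_all (fun x r => Q x (fun n => r (S (S n))) -> r 0 = x)).
      apply dfn_imp; [exact L | apply dfn_eq_var]. }
    apply dfn_or; apply dfn_and; auto using dfn_not, dfn_is_empty, dterm_var.
Qed.
End DefiniteDescription.

Ltac dfn_hook_the :=
  match goal with
  | |- dterm (fun r => the (fun y => @?Q r y)) =>
      apply (dterm_the (fun y r => Q r y))
  | |- dfn (fun r => is_empty _) => apply dfn_is_empty
  end.
Ltac dfn_hook ::= dfn_hook_the.

(** * Elementary set operations *)

Section SetOperations.
Context {V : membership_structure} {hV : ZF V}.
Notation env := (nat -> V).

Definition emp : V :=
  proj1_sig (seal (the is_empty)).

(** Lemmas with the suffix [E] mostly trade the relational notions of the statement for equations or
    memberships in terms of the sealed operations, with which the proofs compute. *)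
Lemma is_emptyE (x : V) : is_empty x <-> x = emp.
Proof.
  assert (E : is_empty emp).
  { unseal emp. apply (the_spec is_empty). destruct is_empty_exists as [e He].
    exists e. split; auto.
    intros z Hz. apply ext. intro y. specialize (He y). specialize (Hz y). tauto. }
  split; [|now intros ->]. intro H. apply ext. intro y. specialize (H y).
  specialize (E y). tauto.
Qed.

Lemma in_emp (x : V) : ~ x ∈ emp.
Proof. now apply is_emptyE. Qed.

Definition upair : V -> V -> V :=
  proj1_sig (seal (fun (x y : V) =>
    the (fun b => forall u, u ∈ b <-> u = x \/ u = y))).

Lemma in_upair (x y u : V) : u ∈ upair x y <-> u = x \/ u = y.
Proof.
  unseal upair. apply (in_the (fun u => u = x \/ u = y)), (ZF_pairing V hV).
Qed.

Lemma is_upairE x y z : is_upair x y z <-> z = upair x y.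
Proof.
  split.
  - intro H. apply ext. intro u. rewrite in_upair. apply H.
  - intros -> u. apply in_upair.
Qed.

Lemma dterm_upair f g : dterm f -> dterm g -> dterm (fun r : env => upair (f r) (g r)).
Proof. unseal upair. dfn. Qed.

Definition opair : V -> V -> V :=
  proj1_sig (seal (fun (x y : V) =>
    upair (upair x x) (upair x y))).

Lemma opair_def x y : opair x y = upair (upair x x) (upair x y).
Proof. now unseal opair. Qed.

Lemma is_opairE x y p : is_opair x y p <-> p = opair x y.
Proof.
  split.
  - intros (s & t & H1 & H2 & H3). rewrite is_upairE in *. subst.
    now rewrite opair_def.
  - intros ->. exists (upair x x), (upair x y). now rewrite !is_upairE, opair_def.
Qed.

Lemma upair_inj (x y x' y' : V) :
  upair x y = upair x' y' -> x = x' /\ y = y' \/ x = y' /\ y = x'.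
Proof.
  intro H.
  assert (K : forall u, u = x \/ u = y <-> u = x' \/ u = y').
  { intro u. rewrite <- !in_upair. now rewrite H. }
  pose proof (proj1 (K x) (or_introl eq_refl)).
  pose proof (proj1 (K y) (or_intror eq_refl)).
  pose proof (proj2 (K x') (or_introl eq_refl)).
  pose proof (proj2 (K y') (or_intror eq_refl)).
  clear K H. intuition congruence.
Qed.

Lemma opair_inj (x y x' y' : V) : opair x y = opair x' y' <-> x = x' /\ y = y'.
Proof.
  split; [|now intros [-> ->]]. rewrite !opair_def. intro H. apply upair_inj in H.
  destruct H as [[H K]|[H K]]; apply upair_inj in H; apply upair_inj in K;
    intuition congruence.
Qed.

Lemma dterm_opair f g : dterm f -> dterm g -> dterm (fun r : env => opair (f r) (g r)).
Proof. intros. unseal opair. auto using dterm_upair. Qed.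

Lemma opair_memE (x y r : V) : ⟨x, y⟩ ∈ r <-> opair x y ∈ r.
Proof.
  split.
  - intros (p & H & K). apply is_opairE in H. now subst.
  - intro H. exists (opair x y). split; auto. now apply is_opairE.
Qed.

Lemma dfn_opair_mem f g h : dterm f -> dterm g -> dterm h ->
  dfn (fun r : env => ⟨f r, g r⟩ ∈ h r).
Proof.
  intros. apply dfn_ext with (fun r => opair (f r) (g r) ∈ h r).
  - intro r. now rewrite opair_memE.
  - apply dfn_mem; auto using dterm_opair.
Qed.

Lemma dfn_is_opair f g h : dterm f -> dterm g -> dterm h ->
  dfn (fun r : env => is_opair (f r) (g r) (h r)).
Proof.
  intros. apply dfn_ext with (fun r => h r = opair (f r) (g r)).
  - intro r. now rewrite is_opairE.
  - apply dfn_eq; auto using dterm_opair.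
Qed.

Definition sep : V -> (V -> Prop) -> V :=
  proj1_sig (seal (fun (a : V) (P : V -> Prop) =>
    the (fun b => forall x, x ∈ b <-> x ∈ a /\ P x))).

Lemma in_sep a P x : dfn (fun r => P (r 0)) -> (x ∈ sep a P <-> x ∈ a /\ P x).
Proof.
  intro H. unseal sep. now apply (in_the (fun x => x ∈ a /\ P x)), separation.
Qed.

Definition rep : V -> (V -> V) -> V :=
  proj1_sig (seal (fun (a : V) (F : V -> V) =>
    the (fun b => forall y, y ∈ b <-> exists x, x ∈ a /\ y = F x))).

Lemma in_rep a F y : dterm (fun r => F (r 0)) ->
  (y ∈ rep a F <-> exists x, x ∈ a /\ y = F x).
Proof.
  intro H. unseal rep.
  now apply (in_the (fun y => exists x, x ∈ a /\ y = F x)), replacement.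
Qed.

Definition Un : V -> V :=
  proj1_sig (seal (fun (a : V) =>
    the (fun b => forall x, x ∈ b <-> exists y, x ∈ y /\ y ∈ a))).

Lemma in_Un a x : x ∈ Un a <-> exists y, x ∈ y /\ y ∈ a.
Proof.
  unseal Un. apply (in_the (fun x => exists y, x ∈ y /\ y ∈ a)), (ZF_union V hV).
Qed.

Lemma dterm_Un f : dterm f -> dterm (fun r : env => Un (f r)).
Proof. unseal Un. dfn. Qed.

Definition pow : V -> V :=
  proj1_sig (seal (fun (a : V) =>
    the (fun b => forall x, x ∈ b <-> subset x a))).

Lemma in_pow a x : x ∈ pow a <-> subset x a.
Proof.
  unseal pow. apply (in_the (fun x => subset x a)), (ZF_power_set V hV).
Qed.

Lemma dfn_subset f g : dterm f -> dterm g -> dfn (fun r : env => subset (f r) (g r)).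
Proof. unfold subset. dfn. Qed.

Lemma dterm_pow f : dterm f -> dterm (fun r : env => pow (f r)).
Proof. unseal pow. unfold subset. dfn. Qed.

Definition union : V -> V -> V :=
  proj1_sig (seal (fun (a b : V) =>
    Un (upair a b))).

Lemma in_union a b x : x ∈ union a b <-> x ∈ a \/ x ∈ b.
Proof.
  unseal union. rewrite in_Un. setoid_rewrite in_upair. split.
  - intros (y & H & [->| ->]); auto.
  - intros [H|H]; [exists a | exists b]; auto.
Qed.

Lemma dterm_union f g : dterm f -> dterm g -> dterm (fun r : env => union (f r) (g r)).
Proof. intros. unseal union. auto using dterm_Un, dterm_upair. Qed.

Definition adj : V -> V -> V :=
  proj1_sig (seal (fun (a x : V) =>
    union a (upair x x))).

Lemma in_adj a x y : y ∈ adj a x <-> y ∈ a \/ y = x.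
Proof. unseal adj. rewrite in_union, in_upair. tauto. Qed.

Lemma is_adjoinE a x b : is_adjoin a x b <-> b = adj a x.
Proof.
  split.
  - intro H. apply ext. intro u. rewrite in_adj. apply H.
  - intros -> u. apply in_adj.
Qed.

Lemma dterm_adj f g : dterm f -> dterm g -> dterm (fun r : env => adj (f r) (g r)).
Proof. intros. unseal adj. auto using dterm_union, dterm_upair. Qed.

Definition succ : V -> V :=
  proj1_sig (seal (fun (n : V) =>
    adj n n)).

Lemma is_succE n m : is_succ n m <-> m = succ n.
Proof. unseal succ. apply is_adjoinE. Qed.

Lemma in_succ n x : x ∈ succ n <-> x ∈ n \/ x = n.
Proof. unseal succ. apply in_adj. Qed.

Lemma dterm_succ f : dterm f -> dterm (fun r : env => succ (f r)).
Proof. intros. unseal succ. auto using dterm_adj. Qed.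

Definition prod : V -> V -> V :=
  proj1_sig (seal (fun (a b : V) =>
    sep (pow (pow (union a b)))
    (fun p => exists x y, x ∈ a /\ y ∈ b /\ p = opair x y))).
End SetOperations.

Ltac dfn_hook_sets := first
  [ simple apply dterm_upair | simple apply dterm_opair | simple apply dfn_opair_mem
  | simple apply dfn_is_opair | simple apply dterm_Un | simple apply dfn_subset
  | simple apply dterm_pow | simple apply dterm_union | simple apply dterm_adj
  | simple apply dterm_succ ].
Ltac dfn_hook ::= first [dfn_hook_the | dfn_hook_sets].

Section ProductsAndComprehension.
Context {V : membership_structure} {hV : ZF V}.
Notation env := (nat -> V).

Lemma in_prod (a b p : V) :
  p ∈ prod a b <-> exists x y, x ∈ a /\ y ∈ b /\ p = opair x y.
Proof.
  unseal prod. rewrite in_sep by dfn. split; [tauto|].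
  intros (x & y & Hx & Hy & ->). split; [|eauto].
  apply in_pow. intros u Hu. apply in_pow. intros v Hv. apply in_union.
  rewrite opair_def in Hu. apply in_upair in Hu.
  destruct Hu as [->| ->]; apply in_upair in Hv;
    destruct Hv as [->| ->]; auto.
Qed.

Lemma opair_in_prod (a b x y : V) : opair x y ∈ prod a b <-> x ∈ a /\ y ∈ b.
Proof.
  rewrite in_prod. split.
  - intros (x' & y' & ? & ? & E). apply opair_inj in E. destruct E; now subst.
  - intros []. eauto.
Qed.

Lemma dterm_prod f g : dterm f -> dterm g -> dterm (fun r : env => prod (f r) (g r)).
Proof. unseal prod. unseal sep. dfn. Qed.

Lemma dterm_sep (f : env -> V) (P : V -> env -> Prop) :
  dterm f -> dfn (fun r => P (r 0) (fun n => r (S n))) ->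
  dterm (fun r => sep (f r) (fun x => P x r)).
Proof.
  intros Hf HP. unseal sep. dfn.
  exact (dfn_ren (fun n => match n with 0 => 0 | S m => S (S m) end) _ HP).
Qed.

Lemma dterm_rep (f : env -> V) (F : V -> env -> V) :
  dterm f -> dterm (fun r => F (r 0) (fun n => r (S n))) ->
  dterm (fun r => rep (f r) (fun x => F x r)).
Proof.
  intros Hf HF. unseal rep. dfn.
  exact (dterm_ren (fun n => match n with 0 => 0 | S m => S (S (S m)) end) _ HF).
Qed.
End ProductsAndComprehension.

Ltac dfn_hook_comprehension :=
  match goal with
  | |- dterm (fun r => sep _ (fun x => @?P r x)) =>
      apply (dterm_sep _ (fun x r => P r x))
  | |- dterm (fun r => rep _ (fun x => @?F r x)) =>
      apply (dterm_rep _ (fun x r => F r x))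
  | |- _ => simple apply dterm_prod
  end.
Ltac dfn_hook ::= first [dfn_hook_the | dfn_hook_sets | dfn_hook_comprehension].

(** * Functions and natural numbers *)

Section Functions.
Context {V : membership_structure} {hV : ZF V}.
Notation env := (nat -> V).

Definition ap : V -> V -> V :=
  proj1_sig (seal (fun (f x : V) =>
    the (fun y => opair x y ∈ f))).

Lemma dterm_ap f g : dterm f -> dterm g -> dterm (fun r : env => ap (f r) (g r)).
Proof. unseal ap. dfn. Qed.

Lemma fn_mem f a x y : is_function f a -> (opair x y ∈ f <-> x ∈ a /\ y = ap f x).
Proof.
  intros [H K].
  assert (L : forall x, x ∈ a -> opair x (ap f x) ∈ f /\ forall y, opair x y ∈ f -> y =
    ap f x).
  { intros u Hu. destruct (K u Hu) as (z & Hz & U). setoid_rewrite opair_memE in U.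
    apply opair_memE in Hz. assert (E : ap f u = z).
    { unseal ap. apply the_eq; auto. intros t Ht. symmetry. auto. }
    rewrite E. split; auto. intros t Ht. symmetry. auto. }
  split.
  - intro Hp. destruct (H _ Hp) as (x' & y' & Hx & E). apply is_opairE in E.
    apply opair_inj in E. destruct E. subst. split; auto. now apply L.
  - intros [Hx ->]. now apply L.
Qed.

Lemma fn_elem f a p : is_function f a -> (p ∈ f <-> exists x, x ∈ a /\ p = opair x (ap
  f x)).
Proof.
  intro H. split.
  - intro Hp. destruct (proj1 H _ Hp) as (x & y & Hx & E). apply is_opairE in E. subst.
    apply (fn_mem _ _ _ _ H) in Hp. destruct Hp. subst. eauto.
  - intros (x & Hx & ->). now apply (fn_mem _ _ _ _ H).
Qed.

Lemma fn_pair_mem f a x y : is_function f a -> (⟨x, y⟩ ∈ f <-> x ∈ a /\ y = ap f x).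
Proof. intro H. rewrite opair_memE. now apply fn_mem. Qed.

Lemma fn_ext f g a : is_function f a -> is_function g a ->
  (forall x, x ∈ a -> ap f x = ap g x) -> f = g.
Proof.
  intros Hf Hg H. apply ext. intro p. rewrite (fn_elem f a), (fn_elem g a); auto.
  split; intros (x & Hx & ->); exists x; rewrite H; auto.
Qed.

Lemma mapsE f a b : maps f a b <-> is_function f a /\ forall x, x ∈ a -> ap f x ∈ b.
Proof.
  unfold maps. split; intros [H K]; split; auto.
  - intros x Hx. apply (K x). now apply (fn_pair_mem f a).
  - intros x y Hp. apply (fn_pair_mem f a) in Hp; auto. destruct Hp. subst. auto.
Qed.

Definition lam : V -> (V -> V) -> V :=
  proj1_sig (seal (fun (a : V) (F : V -> V) =>
    rep a (fun x => opair x (F x)))).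

Lemma lam_fn (a : V) F : dterm (fun r : env => F (r 0)) -> is_function (lam a F) a.
Proof.
  intro HF. unseal lam. split.
  - intros p Hp. rewrite in_rep in Hp by dfn. destruct Hp as (x & Hx & ->).
    exists x, (F x). now rewrite is_opairE.
  - intros x Hx. exists (F x). split.
    + rewrite opair_memE, in_rep by dfn. eauto.
    + intros y Hy. rewrite opair_memE, in_rep in Hy by dfn.
      destruct Hy as (x' & _ & E). apply opair_inj in E. destruct E. now subst.
Qed.

Lemma ap_lam a F x : dterm (fun r : env => F (r 0)) -> x ∈ a -> ap (lam a F) x = F x.
Proof.
  intros HF Hx. symmetry. apply (fn_mem (lam a F) a); [now apply lam_fn|].
  unseal lam. rewrite in_rep by dfn. eauto.
Qed.

Lemma lam_maps a b F : dterm (fun r : env => F (r 0)) -> (forall x, x ∈ a -> F x ∈ b) ->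
  maps (lam a F) a b.
Proof.
  intros HF H. apply mapsE. split; [now apply lam_fn|]. intros x Hx.
  rewrite ap_lam; auto.
Qed.

Lemma dterm_lam (f : env -> V) (F : V -> env -> V) :
  dterm f -> dterm (fun r => F (r 0) (fun n => r (S n))) ->
  dterm (fun r => lam (f r) (fun x => F x r)).
Proof. intros Hf HF. unseal lam. apply dterm_rep; dfn. Qed.

Lemma lam_ext a F G : dterm (fun r : env => F (r 0)) -> dterm (fun r : env => G (r 0))
  ->
  (forall x, x ∈ a -> F x = G x) -> lam a F = lam a G.
Proof.
  intros HF HG H. apply (fn_ext _ _ a); auto using lam_fn. intros.
  now rewrite !ap_lam; auto.
Qed.

Lemma dfn_is_function f g : dterm f -> dterm g -> dfn (fun r : env => is_function (f r)
  (g r)).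
Proof. unfold is_function. dfn. Qed.
End Functions.

Ltac dfn_hook_functions := first
  [ simple apply dterm_ap | simple apply dfn_is_function
  | match goal with |- dterm (fun r => lam _ (fun x => @?F r x)) =>
      apply (dterm_lam _ (fun x r => F r x)) end
  | match goal with |- dfn (fun r => maps _ _ _) => unfold maps end ].
Ltac dfn_hook ::= first
  [dfn_hook_the | dfn_hook_sets | dfn_hook_comprehension | dfn_hook_functions].

(** * Natural numbers, recursion and fixed points *)

Section Omega.
Context {V : membership_structure} {hV : ZF V}.
Notation env := (nat -> V).

Definition Exp : V -> V -> V :=
  proj1_sig (seal (fun (a b : V) =>
    sep (pow (prod a b)) (fun f => maps f a b))).

Lemma in_Exp a b f : f ∈ Exp a b <-> maps f a b.
Proof.
  unseal Exp. rewrite in_sep by dfn. split; [tauto|]. intro H. split; auto.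
  apply in_pow. intros p Hp. apply mapsE in H. destruct H as [H K].
  apply (fn_elem f a) in Hp; auto. destruct Hp as (x & Hx & ->).
  apply opair_in_prod. auto.
Qed.

Lemma is_exponentialE a b x : is_exponential a b x <-> x = Exp a b.
Proof.
  unfold is_exponential. split.
  - intro H. apply ext. intro f. now rewrite H, in_Exp.
  - intros -> f. apply in_Exp.
Qed.

(** Tuples of term values, of classes and of coordinates are all given by [is_image_tuple]; when the
    relation is functional along [s], the tuple becomes an explicit [lam]. *)
Lemma is_image_tupleE (P : V -> V -> Prop) (F : V -> V) n s r :
  is_function s n -> dterm (fun r : env => F (r 0)) ->
  (forall k y, k ∈ n -> (P (ap s k) y <-> y = F k)) ->
  (is_image_tuple n s P r <-> r = lam n F).
Proof.
  intros Hs HF H. unfold is_image_tuple. setoid_rewrite (fun x y => fn_pair_mem s n x y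
    Hs).
  split.
  - intros [Hr K]. apply (fn_ext _ _ n); auto using lam_fn. intros k Hk.
    rewrite ap_lam; auto.
    symmetry. apply (fn_pair_mem r n k _ Hr). apply K. exists (ap s k). split; auto.
    now apply H.
  - intros ->. split; [now apply lam_fn|]. intros k y.
    rewrite (fn_pair_mem _ n) by now apply lam_fn. split.
    + intros [Hk ->]. rewrite ap_lam by auto. exists (ap s k). split; auto. now apply H.
    + intros (x & [Hk ->] & Hy). rewrite ap_lam by auto. split; auto. now apply H.
Qed.

Fixpoint num (k : nat) : V := match k with 0 => emp | S k => succ (num k) end.

Lemma is_numeralE k x : is_numeral k x <-> x = num k.
Proof.
  revert x. induction k as [|k IH]; intro x; simpl; [apply is_emptyE|].
  setoid_rewrite IH. setoid_rewrite is_succE.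
  split; [intros (y & -> & ->) | intros ->]; eauto.
Qed.

Definition tag : nat -> V -> V :=
  proj1_sig (seal (fun (k : nat) (x : V) =>
    opair (num k) x)).

Lemma tag_def k x : tag k x = opair (num k) x.
Proof. now unseal tag. Qed.

Lemma is_taggedE k x c : is_tagged k x c <-> c = tag k x.
Proof.
  unfold is_tagged; unseal tag. setoid_rewrite is_numeralE. setoid_rewrite is_opairE.
  split; [intros (y & -> & ->) | intros ->]; eauto.
Qed.

Lemma dterm_tag k f : dterm f -> dterm (fun r : env => tag k (f r)).
Proof. unseal tag. dfn. Qed.

Lemma no_2_cycle (x y : V) : x ∈ y -> ~ y ∈ x.
Proof.
  intros H K. destruct (ZF_foundation V hV (upair x y)) as (z & Hz & L).
  { exists x. apply in_upair. auto. }
  apply in_upair in Hz. destruct Hz as [->| ->].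
  - apply (L y); auto. apply in_upair. auto.
  - apply (L x); auto. apply in_upair. auto.
Qed.

Lemma not_in_self (x : V) : ~ x ∈ x.
Proof. intro H. now apply (no_2_cycle x x). Qed.

Lemma succ_inj (x y : V) : succ x = succ y -> x = y.
Proof.
  intro H. assert (Hx : x ∈ succ y) by (rewrite <- H; apply in_succ; auto).
  assert (Hy : y ∈ succ x) by (rewrite H; apply in_succ; auto).
  apply in_succ in Hx, Hy. destruct Hx, Hy; auto. now destruct (no_2_cycle x y).
Qed.

Lemma succ_neq_emp (x : V) : succ x <> emp.
Proof. intro H. apply (in_emp x). rewrite <- H. apply in_succ. auto. Qed.

Lemma num_inj j k : num j = num k -> j = k.
Proof.
  revert k. induction j as [|j IH]; intros [|k] H; simpl in *; auto.
  - symmetry in H. now apply succ_neq_emp in H.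
  - now apply succ_neq_emp in H.
  - f_equal. apply IH. now apply succ_inj.
Qed.

Lemma tag_inj j k x y : tag j x = tag k y -> j = k /\ x = y.
Proof. unseal tag. rewrite opair_inj. intros []. split; auto using num_inj. Qed.

Lemma inductive_setE (w : V) :
  inductive_set w <-> emp ∈ w /\ forall n, n ∈ w -> succ n ∈ w.
Proof.
  unfold inductive_set. setoid_rewrite is_emptyE. setoid_rewrite is_succE. split.
  - intros [(e & -> & He) H]. split; auto. intros n Hn.
    now destruct (H n Hn) as (m & -> & Hm).
  - intros [He H]. split; eauto.
Qed.

Definition omega : V :=
  proj1_sig (seal (the is_omega)).

Lemma is_omegaE (w : V) : is_omega w <-> w = omega.
Proof.
  assert (U : forall w w' : V, is_omega w -> is_omega w' -> w = w').
  { intros u v [H1 H2] [K1 K2]. apply ext. intro x. split; [apply H2 | apply K2]; auto.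
    }
  assert (H : is_omega omega).
  { unseal omega. apply (the_spec is_omega).
    destruct (ZF_infinity V hV) as [a Ha].
    assert (K : is_omega (sep a (fun n => forall w, inductive_set w -> n ∈ w))).
    { assert (D : dfn (fun r : env => forall w, inductive_set w -> r 0 ∈ w)).
      { unfold inductive_set, is_succ, is_adjoin. dfn. }
      split.
      - rewrite inductive_setE in *. rewrite in_sep by dfn. destruct Ha as [H1 H2].
        split.
        + split; auto. intros b Hb. now apply inductive_setE in Hb.
        + intros n Hn. rewrite in_sep in * by dfn. destruct Hn as [Hn Kn]. split; auto.
          intros b Hb. specialize (Kn b Hb). apply inductive_setE in Hb. now apply Hb.
      - intros b Hb n Hn. rewrite in_sep in Hn by dfn. now apply Hn. }
    eexists. split; [exact K|]. intros b Hb. now apply U. }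
  split; [|now intros ->]. intro K. now apply U.
Qed.

Lemma omega_emp : emp ∈ omega.
Proof. destruct (proj2 (is_omegaE omega) eq_refl) as [H _].
now apply (proj1 (inductive_setE omega) H). Qed.

Lemma omega_succ n : n ∈ omega -> succ n ∈ omega.
Proof. destruct (proj2 (is_omegaE omega) eq_refl) as [H _].
now apply (proj1 (inductive_setE omega) H). Qed.

Lemma omega_num k : num k ∈ omega.
Proof. induction k; simpl; auto using omega_emp, omega_succ. Qed.

Lemma omega_ind (P : V -> Prop) :
  dfn (fun r => P (r 0)) -> P emp -> (forall n, n ∈ omega -> P n -> P (succ n)) ->
  forall n, n ∈ omega -> P n.
Proof.
  intros D H0 HS n Hn.
  destruct (proj2 (is_omegaE omega) eq_refl) as [_ H].
  assert (K : n ∈ sep omega P).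
  { apply H; auto. apply inductive_setE. split.
    - rewrite in_sep by dfn. auto using omega_emp.
    - intros m Hm. rewrite in_sep in * by dfn. destruct Hm. auto using omega_succ. }
  rewrite in_sep in K by dfn. now apply K.
Qed.

Lemma omega_elem n k : n ∈ omega -> k ∈ n -> k ∈ omega.
Proof.
  intros Hn. revert k. revert n Hn. apply (omega_ind (fun n => forall k, k ∈ n -> k ∈
    omega)).
  - dfn.
  - intros k Hk. now apply in_emp in Hk.
  - intros n Hn IH k Hk. apply in_succ in Hk. destruct Hk as [Hk| ->]; auto.
Qed.

Lemma omega_trans n k j : n ∈ omega -> k ∈ n -> j ∈ k -> j ∈ n.
Proof.
  intros Hn. revert k j. revert n Hn.
  apply (omega_ind (fun n => forall k j, k ∈ n -> j ∈ k -> j ∈ n)).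
  - dfn.
  - intros k j Hk. now apply in_emp in Hk.
  - intros n Hn IH k j Hk Hj. apply in_succ. apply in_succ in Hk.
    destruct Hk as [Hk| ->]; eauto.
Qed.

Lemma omega_succ_mem n k : n ∈ omega -> k ∈ n -> succ k ∈ n \/ succ k = n.
Proof.
  intros Hn. revert k. revert n Hn.
  apply (omega_ind (fun n => forall k, k ∈ n -> succ k ∈ n \/ succ k = n)).
  - dfn.
  - intros k Hk. now apply in_emp in Hk.
  - intros n Hn IH k Hk. rewrite in_succ in *. destruct Hk as [Hk| ->]; auto.
Qed.

Lemma omega_trichotomy n m : n ∈ omega -> m ∈ omega -> n ∈ m \/ n = m \/ m ∈ n.
Proof.
  intros Hn. revert m. revert n Hn.
  apply (omega_ind (fun n => forall m, m ∈ omega -> n ∈ m \/ n = m \/ m ∈ n)).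
  - dfn.
  - apply omega_ind; [dfn | auto |]. intros m Hm [H|[<-|H]].
    + left. apply in_succ. auto.
    + left. apply in_succ. auto.
    + now apply in_emp in H.
  - intros n Hn IH m Hm. rewrite in_succ. destruct (IH m Hm) as [H|[<-|H]]; auto.
    destruct (omega_succ_mem m n); auto.
Qed.

Lemma omega_total n m : n ∈ omega -> m ∈ omega -> subset n m \/ subset m n.
Proof.
  intros Hn Hm. destruct (omega_trichotomy n m Hn Hm) as [H|[->|H]].
  - left. intros x Hx. eapply omega_trans; eauto.
  - left. intros x Hx. auto.
  - right. intros x Hx. eapply omega_trans; eauto.
Qed.

(** Collection of bounds over an initial segment of [omega]: the internal form
    of the finite pigeonhole principle. *)
Lemma omega_bound (Q : V -> V -> Prop) n :
  dfn (fun r => Q (r 0) (r 1)) ->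
  (forall k m m', m ∈ omega -> m' ∈ omega -> subset m m' -> Q k m -> Q k m') ->
  n ∈ omega -> (forall k, k ∈ n -> exists m, m ∈ omega /\ Q k m) ->
  exists m, m ∈ omega /\ forall k, k ∈ n -> Q k m.
Proof.
  intros D mono Hn. revert n Hn.
  apply (omega_ind (fun n => (forall k, k ∈ n -> exists m, m ∈ omega /\ Q k m) ->
    exists m, m ∈ omega /\ forall k, k ∈ n -> Q k m)).
  - dfn.
  - intros _. exists emp. split; [apply omega_emp|]. intros k Hk.
    now apply in_emp in Hk.
  - intros n Hn IH H. destruct IH as (m & Hm & K).
    { intros k Hk. apply H. apply in_succ. auto. }
    destruct (H n) as (m' & Hm' & K'); [apply in_succ; auto|].
    destruct (omega_total m m' Hm Hm') as [L|L].
    + exists m'. split; auto. intros k Hk. apply in_succ in Hk.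
      destruct Hk as [Hk| ->]; eauto.
    + exists m. split; auto. intros k Hk. apply in_succ in Hk.
      destruct Hk as [Hk| ->]; eauto.
Qed.

Section Iteration.
Variable X : V.
Variable G : V -> V.
Hypothesis HG : dterm (fun r : env => G (r 0)).

(** A finite approximation to the recursion, defined on the numbers up to and including [n]; [iter]
    reads its last value. *)
Definition iterates (f n : V) : Prop :=
  is_function f (succ n) /\ ap f emp = X /\
  forall k, k ∈ n -> ap f (succ k) = G (ap f k).

Lemma iterates_exists n : n ∈ omega -> exists f, iterates f n.
Proof.
  revert n. apply omega_ind.
  - unfold iterates. dfn.
  - exists (lam (succ emp) (fun _ => X)). split; [apply lam_fn; dfn|]. split.
    + apply (ap_lam (succ emp) (fun _ => X)); [dfn | apply in_succ; auto].
    + intros k Hk. now apply in_emp in Hk.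
  - intros n Hn (f & Hf & H0 & HS).
    (* A definition by cases is written as a description, so that [dfn] can prove it definable;
       [upd], [pr] and [large_choice] use the same device. *)
    set (F := fun k => the (fun y =>
      (k = succ n /\ y = G (ap f n)) \/ (k <> succ n /\ y = ap f k))).
    assert (D : dterm (fun r => F (r 0))) by (unfold F; dfn).
    assert (F1 : F (succ n) = G (ap f n)).
    { apply the_eq; [auto|]. intros z [[_ E]|[E _]]; tauto. }
    assert (F2 : forall k, k <> succ n -> F k = ap f k).
    { intros k Hk. apply the_eq; [auto|]. intros z [[E _]|[_ E]]; tauto. }
    assert (N : forall k, k ∈ succ n -> k <> succ n).
    { intros k Hk E. subst. now apply not_in_self in Hk. }
    exists (lam (succ (succ n)) F). split; [now apply lam_fn|]. split.
    + rewrite ap_lam; auto.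
      * rewrite F2; auto. intro E. symmetry in E. now apply succ_neq_emp in E.
      * clear -Hn. revert n Hn. apply omega_ind; [dfn | apply in_succ; rewrite in_succ;
          auto |].
        intros n Hn H. apply in_succ. now left.
    + intros k Hk. rewrite !ap_lam; auto.
      * rewrite (F2 k) by auto. apply in_succ in Hk. destruct Hk as [Hk| ->]; auto.
        rewrite F2; auto. intro E. apply succ_inj in E. subst.
        now apply not_in_self in Hk.
      * apply in_succ. auto.
      * apply in_succ in Hk. rewrite !in_succ. destruct Hk as [Hk| ->]; auto.
        destruct (omega_succ_mem n k Hn Hk); auto.
Qed.

Lemma iterates_unique n f m g : n ∈ omega -> m ∈ omega -> iterates f n -> iterates g m
  ->
  forall k, k ∈ omega -> k ∈ succ n -> k ∈ succ m -> ap f k = ap g k.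
Proof.
  intros Hn Hm (Hf & F0 & FS) (Hg & G0 & GS).
  apply (omega_ind (fun k => k ∈ succ n -> k ∈ succ m -> ap f k = ap g k)).
  - dfn.
  - intros _ _. congruence.
  - intros k Hk IH H1 H2.
    assert (L : forall n, n ∈ omega -> succ k ∈ succ n -> k ∈ n).
    { intros p Hp H. apply in_succ in H. destruct H as [H| <-].
      - apply (omega_trans p (succ k)); auto. apply in_succ. auto.
      - apply in_succ. auto. }
    rewrite FS, GS by auto. f_equal. apply IH; apply in_succ; auto.
Qed.

Definition iter : V -> V :=
  proj1_sig (seal (fun (n : V) =>
    ap (the (fun f => iterates f n)) n)).

Lemma dfn_iterates f n : dterm f -> dterm n -> dfn (fun r : env => iterates (f r) (n
  r)).
Proof. unfold iterates. dfn. Qed.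

Lemma dterm_iter f : dterm f -> dterm (fun r : env => iter (f r)).
Proof.
  unseal iter. dfn. apply dfn_iterates; dfn.
Qed.

Lemma iter_eq n f k : n ∈ omega -> iterates f n -> k ∈ omega -> k ∈ succ n ->
  ap f k = iter k.
Proof.
  intros Hn Hf Hk Hkn. unseal iter.
  destruct (iterates_exists k Hk) as [g Hg].
  assert (E : the (fun f => iterates f k) = g).
  { assert (U : forall g', iterates g' k -> g' = g).
    { intros g' Hg'. apply (fn_ext _ _ (succ k)); [apply Hg' | apply Hg |].
      intros j Hj. apply (iterates_unique k g' k g); auto.
      apply (omega_elem (succ k)); auto using omega_succ. }
    apply the_eq; auto. }
  rewrite E. apply (iterates_unique n f k g); auto. apply in_succ. auto.
Qed.

Lemma iter_emp : iter emp = X.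
Proof.
  destruct (iterates_exists emp omega_emp) as [g Hg].
  transitivity (ap g emp); [|exact (proj1 (proj2 Hg))]. symmetry.
  apply (iter_eq emp g emp omega_emp Hg omega_emp). apply in_succ. auto.
Qed.

Lemma iter_succ n : n ∈ omega -> iter (succ n) = G (iter n).
Proof.
  intro Hn. destruct (iterates_exists (succ n) (omega_succ n Hn)) as [g Hg].
  assert (K : forall k, k ∈ omega -> k ∈ succ (succ n) -> iter k = ap g k).
  { intros k Hk Hkn. symmetry. apply (iter_eq (succ n)); auto using omega_succ. }
  rewrite !K; auto using omega_succ.
  - apply Hg. apply in_succ. auto.
  - rewrite !in_succ. auto.
  - apply in_succ. auto.
Qed.
End Iteration.

(** The witness is the [ω]-th stage of the cumulative hierarchy over [X]. *)
Lemma hereditary_closure (X : V) : exists H, subset X H /\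
  (forall x y, x ∈ H -> y ∈ H -> opair x y ∈ H) /\
  (forall n s, n ∈ omega -> subset n H -> maps s n H -> s ∈ H).
Proof.
  (* Keeping [a] itself makes the stages increase even if [X] is not transitive. *)
  set (G := fun a => union a (pow a)).
  assert (HG : dterm (fun r : env => G (r 0))) by (unfold G; dfn).
  assert (HI : dterm (fun r : env => iter X G (r 0))) by (apply dterm_iter; dfn).
  assert (S1 : forall n x, n ∈ omega -> x ∈ iter X G n -> x ∈ iter X G (succ n)).
  { intros n x Hn Hx. rewrite iter_succ by auto. unfold G. apply in_union. auto. }
  assert (S2 : forall n x, n ∈ omega -> subset x (iter X G n) -> x ∈ iter X G (succ n)).
  { intros n x Hn Hx. rewrite iter_succ by auto. unfold G. apply in_union. right.
    now apply in_pow. }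
  assert (mono : forall m, m ∈ omega -> forall n, n ∈ m -> subset (iter X G n) (iter X
    G m)).
  { apply (omega_ind (fun m => forall n, n ∈ m -> subset (iter X G n) (iter X G m))).
    - dfn.
    - intros n Hn. now apply in_emp in Hn.
    - intros m Hm IH n Hn x Hx. apply S1; auto. apply in_succ in Hn.
      destruct Hn as [Hn| ->]; auto. now apply (IH n). }
  assert (mono2 : forall m n, m ∈ omega -> n ∈ omega -> subset n m ->
    subset (iter X G n) (iter X G m)).
  { intros m n Hm Hn L. destruct (omega_trichotomy n m Hn Hm) as [H|[->|H]]; auto.
    - intros x Hx. auto.
    - apply L in H. now apply not_in_self in H. }
  set (H := Un (rep omega (iter X G))).
  assert (inH : forall x, x ∈ H <-> exists n, n ∈ omega /\ x ∈ iter X G n).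
  { intro x. unfold H. rewrite in_Un. setoid_rewrite in_rep; [|dfn]. split.
    - intros (y & Hx & n & Hn & ->). eauto.
    - intros (n & Hn & Hx). eauto 6. }
  assert (P : forall x y, x ∈ H -> y ∈ H -> upair x y ∈ H).
  { intros x y Hx Hy. apply inH in Hx, Hy.
    destruct Hx as (n & Hn & Hx), Hy as (m & Hm & Hy).
    apply inH. destruct (omega_total n m Hn Hm) as [L|L].
    - exists (succ m). split; auto using omega_succ. apply S2; auto. intros u Hu.
      apply in_upair in Hu. destruct Hu as [->| ->]; auto. now apply (mono2 m n).
    - exists (succ n). split; auto using omega_succ. apply S2; auto. intros u Hu.
      apply in_upair in Hu. destruct Hu as [->| ->]; auto. now apply (mono2 n m). }
  exists H. split; [|split].
  - intros x Hx. apply inH. exists emp. split; auto using omega_emp.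
    now rewrite iter_emp.
  - intros x y Hx Hy. rewrite opair_def. auto.
  - intros n s Hn Hsub Hs. apply mapsE in Hs. destruct Hs as [Hs Hv].
    (* The entries of [s] may appear at different stages. As the length is an element of [omega],
       one stage contains them all, and [s] itself appears at the next. *)
    destruct (omega_bound (fun k m => opair k (ap s k) ∈ iter X G m) n) as (m & Hm & K).
    + dfn.
    + intros k m m' Hm Hm' L. now apply mono2.
    + auto.
    + intros k Hk. apply inH. rewrite opair_def. auto.
    + apply inH. exists (succ m). split; auto using omega_succ. apply S2; auto.
      intros p Hp. apply (fn_elem s n) in Hp; auto. destruct Hp as (k & Hk & ->). auto.
Qed.

(** Knaster-Tarski inside [B]: the elements common to all closed sets form a closed set. Those of
    its elements that [Gam] derives from it form a closed set again, hence exhaust it. *)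
Lemma fixpoint (B : V) (Gam : V -> V -> Prop) :
  dfn (fun r : env => Gam (r 0) (r 1)) ->
  (forall W W' x, subset W W' -> Gam W x -> Gam W' x) ->
  exists W, forall x, x ∈ W <-> x ∈ B /\ Gam W x.
Proof.
  intros D mono.
  set (P := fun x => forall W, (forall y, y ∈ B -> Gam W y -> y ∈ W) -> x ∈ W).
  assert (DP : dfn (fun r : env => P (r 0))) by (unfold P; dfn).
  assert (I : forall x : V, x ∈ sep B P <-> x ∈ B /\ P x) by (intros; now apply in_sep).
  assert (K : forall x, x ∈ B -> Gam (sep B P) x -> x ∈ sep B P).
  { intros x Hx Hg. apply I. split; auto. intros W HW. apply HW; auto.
    apply (mono (sep B P)); auto. intros y Hy. apply I in Hy. now apply Hy. }
  exists (sep B P). intro x. split; [|intros []; auto].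
  intro Hx. pose proof (proj1 (I _) Hx) as [HB HP]. split; auto.
  assert (L : x ∈ sep (sep B P) (Gam (sep B P))).
  { apply HP. intros y Hy Hg. rewrite in_sep in * by dfn. assert (y ∈ sep B P).
    { apply K; auto. apply (mono (sep (sep B P) (Gam (sep B P)))); auto.
      intros z Hz. rewrite in_sep in Hz by dfn. apply Hz. }
    split; auto. apply (mono (sep (sep B P) (Gam (sep B P)))); auto.
    intros z Hz. rewrite in_sep in Hz by dfn. apply Hz. }
  rewrite in_sep in L by dfn. apply L.
Qed.
End Omega.

(** * Terms and formulas *)

Section SyntaxCodes.
Context {V : membership_structure} {hV : ZF V}.
Notation env := (nat -> V).

Lemma is_otripleE (x y z p : V) : is_otriple x y z p <-> p = opair x (opair y z).
Proof.
  unfold is_otriple. setoid_rewrite is_opairE.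
  split; [intros (q & -> & ->) | intros ->]; eauto.
Qed.

Definition tVar (k : V) : V := tag 0 k.

Definition tApp (F s : V) : V := tag 1 (opair F s).

Definition pEq (t u : V) : V := tag 2 (opair t u).

Definition pAtom (R s : V) : V := tag 3 (opair R s).

Definition pNot (p : V) : V := tag 4 p.

Definition pAnd (p q : V) : V := tag 5 (opair p q).

Definition pEx (k p : V) : V := tag 6 (opair k p).

Lemma is_varE k t : is_var k t <-> t = tVar k.
Proof. apply is_taggedE. Qed.

Lemma is_negationE p q : is_negation p q <-> q = pNot p.
Proof. apply is_taggedE. Qed.

Lemma is_tagged_pair j (x y c : V) :
  (exists q, is_opair x y q /\ is_tagged j q c) <-> c = tag j (opair x y).
Proof.
  setoid_rewrite is_opairE. setoid_rewrite is_taggedE.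
  split; [intros (q & -> & ->) | intros ->]; eauto.
Qed.

Lemma is_appE F s t : is_app F s t <-> t = tApp F s.
Proof. apply is_tagged_pair. Qed.

Lemma is_equalityE t u p : is_equality t u p <-> p = pEq t u.
Proof. apply is_tagged_pair. Qed.

Lemma is_atomE R s p : is_atom R s p <-> p = pAtom R s.
Proof. apply is_tagged_pair. Qed.

Lemma is_conjunctionE p q r : is_conjunction p q r <-> r = pAnd p q.
Proof. apply is_tagged_pair. Qed.

Lemma is_existentialE k p q : is_existential k p q <-> q = pEx k p.
Proof. apply is_tagged_pair. Qed.

Lemma dterm_tVar f : dterm f -> dterm (fun r : env => tVar (f r)).
Proof. apply dterm_tag. Qed.

Lemma dterm_pNot f : dterm f -> dterm (fun r : env => pNot (f r)).
Proof. apply dterm_tag. Qed.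

Lemma dfn_is_tagged k f g : dterm f -> dterm g -> dfn (fun r : env => is_tagged k (f r)
  (g r)).
Proof.
  intros. apply dfn_ext with (fun r => g r = tag k (f r)).
  - intro r. now rewrite is_taggedE.
  - apply dfn_eq; auto using dterm_tag.
Qed.

Lemma dfn_is_omega f : dterm f -> dfn (fun r : env => is_omega (f r)).
Proof.
  intros. apply dfn_ext with (fun r => f r = omega).
  - intro r. now rewrite is_omegaE.
  - dfn.
Qed.

Lemma dfn_is_adjoin f g h : dterm f -> dterm g -> dterm h ->
  dfn (fun r : env => is_adjoin (f r) (g r) (h r)).
Proof. intros. unfold is_adjoin. dfn. Qed.

Lemma dfn_is_otriple f g h k : dterm f -> dterm g -> dterm h -> dterm k ->
  dfn (fun r : env => is_otriple (f r) (g r) (h r) (k r)).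
Proof. intros. unfold is_otriple. dfn. Qed.

Lemma dfn_rel_symbol f g h : dterm f -> dterm g -> dterm h ->
  dfn (fun r : env => rel_symbol (f r) (g r) (h r)).
Proof. intros. unfold rel_symbol. dfn. Qed.

Lemma dfn_fun_symbol f g h : dterm f -> dterm g -> dterm h ->
  dfn (fun r : env => fun_symbol (f r) (g r) (h r)).
Proof. intros. unfold fun_symbol. dfn. Qed.
End SyntaxCodes.

Ltac dfn_hook_codes := first
  [ simple apply dterm_tag | simple apply dterm_tVar | simple apply dterm_pNot
  | match goal with
    | |- dterm (fun r => tApp _ _) => unfold tApp
    | |- dterm (fun r => pEq _ _) => unfold pEq
    | |- dterm (fun r => pAtom _ _) => unfold pAtom
    | |- dterm (fun r => pAnd _ _) => unfold pAnd
    | |- dterm (fun r => pEx _ _) => unfold pEx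
    | |- dfn (fun r => is_var _ _) => unfold is_var
    | |- dfn (fun r => is_negation _ _) => unfold is_negation
    | |- dfn (fun r => is_app _ _ _) => unfold is_app
    | |- dfn (fun r => is_equality _ _ _) => unfold is_equality
    | |- dfn (fun r => is_atom _ _ _) => unfold is_atom
    | |- dfn (fun r => is_conjunction _ _ _) => unfold is_conjunction
    | |- dfn (fun r => is_existential _ _ _) => unfold is_existential
    end
  | simple apply dfn_is_tagged | simple apply dfn_is_omega | simple apply dfn_is_adjoin
  | simple apply dfn_is_otriple | simple apply dfn_rel_symbol
  | simple apply dfn_fun_symbol ].
Ltac dfn_hook ::= first
  [ dfn_hook_the | dfn_hook_sets | dfn_hook_comprehension | dfn_hook_functions
  | dfn_hook_codes ].

Section DefinabilityOfSyntax.
Context {V : membership_structure} {hV : ZF V}.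
Notation env := (nat -> V).

Lemma dfn_universe f g : dterm f -> dterm g -> dfn (fun r : env => universe (f r) (g
  r)).
Proof. intros. unfold universe. dfn. Qed.

Lemma dfn_rel_holds f g h : dterm f -> dterm g -> dterm h ->
  dfn (fun r : env => rel_holds (f r) (g r) (h r)).
Proof. intros. unfold rel_holds. dfn. Qed.

Lemma dfn_fun_value f g h k : dterm f -> dterm g -> dterm h -> dterm k ->
  dfn (fun r : env => fun_value (f r) (g r) (h r) (k r)).
Proof. intros. unfold fun_value. dfn. Qed.

Lemma dfn_is_term f g h : dterm f -> dterm g -> dterm h ->
  dfn (fun r : env => is_term (f r) (g r) (h r)).
Proof. intros. unfold is_term, closed_under_terms. dfn. Qed.

Lemma dfn_is_term_tuple f g h k : dterm f -> dterm g -> dterm h -> dterm k ->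
  dfn (fun r : env => is_term_tuple (f r) (g r) (h r) (k r)).
Proof. intros. unfold is_term_tuple. dfn. now apply dfn_is_term; dfn. Qed.

Lemma dfn_is_formula f g h : dterm f -> dterm g -> dterm h ->
  dfn (fun r : env => is_formula (f r) (g r) (h r)).
Proof.
  intros. unfold is_formula, closed_under_formulas.
  dfn; first [apply dfn_is_term | apply dfn_is_term_tuple]; dfn.
Qed.
End DefinabilityOfSyntax.

Ltac dfn_hook_syntax := first
  [ simple apply dfn_universe | simple apply dfn_rel_holds | simple apply dfn_fun_value
  | simple apply dfn_is_term | simple apply dfn_is_term_tuple
  | simple apply dfn_is_formula ].
Ltac dfn_hook ::= first
  [ dfn_hook_the | dfn_hook_sets | dfn_hook_comprehension | dfn_hook_functions
  | dfn_hook_codes | dfn_hook_syntax ].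

Section Syntax.
Context {V : membership_structure} {hV : ZF V}.
Notation env := (nat -> V).
Context {L : V} (hL : is_language L).

Lemma language_symbols : exists S,
  (forall F n, fun_symbol L F n -> F ∈ S /\ n ∈ omega) /\
  (forall R n, rel_symbol L R n -> R ∈ S /\ n ∈ omega /\ nonempty n).
Proof.
  destruct hL as (ar & af & rs & fs & w & Hw & EL & Hr & Hf & Hn).
  apply is_omegaE in Hw. subst w. apply is_opairE in EL. subst L.
  apply mapsE in Hr, Hf. destruct Hr as [Hr Hr'], Hf as [Hf Hf'].
  exists (union rs fs). split.
  - intros F n (a & b & E & H). apply is_opairE in E. apply opair_inj in E. destruct E.
    subst a b.
    apply (fn_pair_mem af fs) in H; auto. destruct H as [H ->]. rewrite in_union. auto.
  - intros F n (a & b & E & H). apply is_opairE in E. apply opair_inj in E. destruct E.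
    subst a b.
    split; [|split; [|eauto]]; apply (fn_pair_mem ar rs) in H; auto; destruct H as [H
      ->];
      rewrite ?in_union; auto.
Qed.

Lemma fun_symbol_omega F n : fun_symbol L F n -> n ∈ omega.
Proof. destruct language_symbols as (S & H & _). intro K. now apply (H F). Qed.

Lemma rel_symbol_omega R n : rel_symbol L R n -> n ∈ omega.
Proof. destruct language_symbols as (S & _ & H). intro K. now apply (H R). Qed.

Lemma fun_symbol_unique F n m : fun_symbol L F n -> fun_symbol L F m -> n = m.
Proof.
  destruct hL as (ar & af & rs & fs & w & Hw & EL & Hr & Hf & Hn).
  apply is_opairE in EL. subst L. destruct Hf as [Hf _].
  intros (a & b & E & H) (a' & b' & E' & H'). apply is_opairE in E, E'.
  apply opair_inj in E, E'. destruct E, E'. subst a b a' b'.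
  apply (fn_pair_mem af fs) in H, H'; auto. now destruct H as [_ ->], H' as [_ ->].
Qed.

Lemma rel_symbol_unique F n m : rel_symbol L F n -> rel_symbol L F m -> n = m.
Proof.
  destruct hL as (ar & af & rs & fs & w & Hw & EL & Hr & Hf & Hn).
  apply is_opairE in EL. subst L. destruct Hr as [Hr _].
  intros (a & b & E & H) (a' & b' & E' & H'). apply is_opairE in E, E'.
  apply opair_inj in E, E'. destruct E, E'. subst a b a' b'.
  apply (fn_pair_mem ar rs) in H, H'; auto. now destruct H as [_ ->], H' as [_ ->].
Qed.

(** Terms and formulas are defined as members of all closed sets, which says something only if a
    closed set exists. Such an [H] contains all codes, and inductions take place by separation
    inside it. *)
Definition syntax_bound (H : V) : Prop :=
  subset omega H /\ (forall F n, fun_symbol L F n -> F ∈ H) /\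
  (forall R n, rel_symbol L R n -> R ∈ H) /\
  (forall x y, x ∈ H -> y ∈ H -> opair x y ∈ H) /\
  (forall n s, n ∈ omega -> maps s n H -> s ∈ H).

Lemma syntax_bound_exists : exists H, syntax_bound H.
Proof.
  destruct language_symbols as (S & HF & HR).
  destruct (hereditary_closure (union S omega)) as (H & H1 & H2 & H3).
  assert (W : subset omega H) by (intros n Hn; apply H1, in_union; auto).
  exists H. split; [|split; [|split; [|split]]]; auto.
  - intros F n K. apply H1, in_union. left. now apply (HF F n).
  - intros F n K. apply H1, in_union. left. now apply (HR F n).
  - intros n s Hn. apply (H3 n s Hn). intros k Hk. apply W. eapply omega_elem; eauto.
Qed.

Lemma syntax_bound_tag H k x : syntax_bound H -> x ∈ H -> tag k x ∈ H.
Proof. intros (H1 & _ & _ & H2 & _) Hx. rewrite tag_def. apply H2; auto.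
apply H1, omega_num. Qed.

Lemma term_var D k : k ∈ D -> is_term L D (tVar k).
Proof. intros Hk T [H _]. apply (H k); auto. now apply is_varE. Qed.

Lemma is_term_tupleE D n s :
  is_term_tuple L D n s <-> is_function s n /\ forall k, k ∈ n -> is_term L D (ap s k).
Proof.
  unfold is_term_tuple. split; intros [H K]; split; auto.
  - intros k Hk. apply (K k). now apply (fn_pair_mem s n).
  - intros k t Hp. apply (fn_pair_mem s n) in Hp; auto. destruct Hp. subst. auto.
Qed.

Lemma term_app D F n s : fun_symbol L F n -> is_term_tuple L D n s ->
  is_term L D (tApp F s).
Proof.
  intros HF Hs T HT. destruct HT as [HT1 HT2]. apply (HT2 F n s); auto.
  - apply is_term_tupleE in Hs. destruct Hs. apply mapsE. split; auto.
    intros k Hk. now apply H0.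
  - now apply is_appE.
Qed.

Section TermInduction.
Context (D : V) (hD : subset D omega).

Lemma term_bound H t : syntax_bound H -> is_term L D t -> t ∈ H.
Proof.
  intros HH Ht. apply Ht. split.
  - intros k u Hk Hu. apply is_varE in Hu. subst. apply syntax_bound_tag; auto.
    apply HH; auto.
  - intros F n s u HF Hs Hu. apply is_appE in Hu. subst. apply syntax_bound_tag; auto.
    destruct HH as (? & B & ? & C & E). apply C; eauto using fun_symbol_omega.
Qed.

(** The closed set consists of the elements of [H] that are terms and satisfy [P]; carrying
    [is_term] along supplies the premise [is_term_tuple] of the application case. *)
Lemma term_ind (P : V -> Prop) :
  dfn (fun r => P (r 0)) ->
  (forall k, k ∈ D -> P (tVar k)) ->
  (forall F n s, fun_symbol L F n -> is_term_tuple L D n s ->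
    (forall k, k ∈ n -> P (ap s k)) -> P (tApp F s)) ->
  forall t, is_term L D t -> P t.
Proof.
  intros DP H1 H2 t Ht. destruct syntax_bound_exists as [H HH].
  assert (K : t ∈ sep H (fun t => is_term L D t /\ P t)).
  { apply Ht. split.
    - intros k u Hk Hu. apply is_varE in Hu. subst. rewrite in_sep by dfn.
      split; [apply term_bound; auto|split]; auto; apply term_var; auto.
    - intros F n s u HF Hs Hu. apply is_appE in Hu. subst.
      apply mapsE in Hs. destruct Hs as [Hs Ks].
      assert (T : is_term_tuple L D n s).
      { apply is_term_tupleE. split; auto. intros k Hk. specialize (Ks k Hk).
        rewrite in_sep in Ks by dfn. apply Ks. }
      rewrite in_sep by dfn. split; [apply term_bound|split]; eauto using term_app.
      apply (H2 F n s); auto. intros k Hk. specialize (Ks k Hk).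
      rewrite in_sep in Ks by dfn.
      apply Ks. }
  rewrite in_sep in K by dfn. apply K.
Qed.

Lemma term_set_exists : exists T, forall t, t ∈ T <-> is_term L D t.
Proof.
  destruct syntax_bound_exists as [H HH]. exists (sep H (is_term L D)).
  intro t. rewrite in_sep by dfn. split; [tauto|]. split; auto using term_bound.
Qed.
End TermInduction.

Lemma formula_eq D t u : subset D omega -> is_term L D t -> is_term L D u ->
  is_formula L D (pEq t u).
Proof.
  intros hD Ht Hu Phi HP. destruct (HP omega D) as (H & _); auto.
  { now apply is_omegaE. } apply (H t u); auto. now apply is_equalityE.
Qed.

Lemma formula_atom D R n s : subset D omega -> rel_symbol L R n -> is_term_tuple L D n
  s ->
  is_formula L D (pAtom R s).
Proof.
  intros hD Ht Hu Phi HP. destruct (HP omega D) as (_ & H & _); auto.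
  { now apply is_omegaE. } apply (H R n s); auto. now apply is_atomE.
Qed.

Lemma formula_not D p : subset D omega -> is_formula L D p -> is_formula L D (pNot p).
Proof.
  intros hD Ht Phi HP. destruct (HP omega D) as (_ & _ & H & _); auto.
  { now apply is_omegaE. } apply (H p); [now apply Ht|]. now apply is_negationE.
Qed.

Lemma formula_and D p q : subset D omega -> is_formula L D p -> is_formula L D q ->
  is_formula L D (pAnd p q).
Proof.
  intros hD Ht Hu Phi HP. destruct (HP omega D) as (_ & _ & _ & H & _); auto.
  { now apply is_omegaE. } apply (H p q); [now apply Ht|now apply Hu|].
    now apply is_conjunctionE.
Qed.

Lemma formula_ex D k p : subset D omega -> k ∈ omega -> is_formula L (adj D k) p ->
  is_formula L D (pEx k p).
Proof.
  intros hD Hk Ht Phi HP. destruct (HP omega D) as (_ & _ & _ & _ & H); auto.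
  { now apply is_omegaE. } apply (H k (adj D k) p); auto; [now apply is_adjoinE |].
  now apply is_existentialE.
Qed.

Section FormulaInduction.
Variable P : V -> V -> Prop.
Hypothesis DP : dfn (fun r => P (r 0) (r 1)).
Hypothesis Heq : forall D t u, subset D omega -> is_term L D t -> is_term L D u ->
  P D (pEq t u).
Hypothesis Hatom : forall D R n s, subset D omega -> rel_symbol L R n ->
  is_term_tuple L D n s -> P D (pAtom R s).
Hypothesis Hnot : forall D p, subset D omega -> is_formula L D p -> P D p -> P D (pNot
  p).
Hypothesis Hand : forall D p q, subset D omega -> is_formula L D p -> is_formula L D q
  ->
  P D p -> P D q -> P D (pAnd p q).
Hypothesis Hex : forall D k p, subset D omega -> k ∈ omega -> is_formula L (adj D k) p
  ->
  P (adj D k) p -> P D (pEx k p).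

(** [P] depends on [D] because an existential formula has its body over a larger set of variables.
    One closed set of pairs inside [prod (pow omega) H] gives the bounds and the induction together;
    [formula_bound] extracts the bounds with a trivial [P]. *)
Lemma formula_bound_ind H D p : syntax_bound H -> is_formula L D p ->
  subset D omega /\ p ∈ H /\ P D p.
Proof.
  intros HH Hp.
  set (Q := fun w => exists D p, w = opair D p /\ is_formula L D p /\ P D p).
  assert (DQ : dfn (fun r => Q (r 0))) by (unfold Q; dfn).
  set (Phi := sep (prod (pow omega) H) Q).
  assert (E : forall D p, ⟨D, p⟩ ∈ Phi <->
    subset D omega /\ p ∈ H /\ is_formula L D p /\ P D p).
  { intros D' p'. rewrite opair_memE. unfold Phi. rewrite in_sep by dfn.
    rewrite opair_in_prod, in_pow. split.
    - intros [[H1 H2] (D1 & p1 & E1 & H3 & H4)]. apply opair_inj in E1. destruct E1.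
      subst. auto.
    - intros (H1 & H2 & H3 & H4). split; auto. exists D', p'. auto. }
  assert (K : ⟨D, p⟩ ∈ Phi).
  { apply Hp. intros w D' Hw HD'. apply is_omegaE in Hw. subst w.
    pose proof HH as (B1 & B2 & B3 & B4 & B5).
    split; [|split; [|split; [|split]]]; setoid_rewrite E.
    - intros t u q Ht Hu Hq. apply is_equalityE in Hq. subst q.
      refine (conj HD' (conj _ (conj (formula_eq _ _ _ HD' Ht Hu) (Heq _ _ _ HD' Ht
        Hu)))).
      apply (syntax_bound_tag H 2 _ HH), B4; apply (term_bound D'); auto.
    - intros R n s q HR Hs Hq. apply is_atomE in Hq. subst q.
      refine (conj HD' (conj _ (conj (formula_atom _ _ _ _ HD' HR Hs) (Hatom _ _ _ _
        HD' HR Hs)))).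
      apply is_term_tupleE in Hs. destruct Hs as [Hs1 Hs2].
      apply (syntax_bound_tag H 3 _ HH), B4; [now apply (B3 R n)|].
      apply (B5 n); [now apply (rel_symbol_omega R)|]. apply mapsE. split; auto.
      intros k Hk. apply (term_bound D'); auto.
    - intros q q' (_ & H1 & H2 & H3) Hq. apply is_negationE in Hq. subst q'.
      refine (conj HD' (conj _ (conj (formula_not _ _ HD' H2) (Hnot _ _ HD' H2 H3)))).
      apply (syntax_bound_tag H 4 _ HH H1).
    - intros q1 q2 q' (_ & H1 & H2 & H3) (_ & K1 & K2 & K3) Hq.
      apply is_conjunctionE in Hq. subst q'.
      refine (conj HD' (conj _ (conj (formula_and _ _ _ HD' H2 K2) (Hand _ _ _ HD' H2
        K2 H3 K3)))).
      apply (syntax_bound_tag H 5 _ HH), B4; auto.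
    - intros k D'' q q' Hk HD'' (_ & H1 & H2 & H3) Hq. apply is_existentialE in Hq.
      apply is_adjoinE in HD''. subst q' D''.
      refine (conj HD' (conj _ (conj (formula_ex _ _ _ HD' Hk H2) (Hex _ _ _ HD' Hk H2
        H3)))).
      apply (syntax_bound_tag H 6 _ HH), B4; auto. }
  apply E in K. tauto.
Qed.

Lemma formula_ind D p : is_formula L D p -> P D p.
Proof.
  intro Hp. destruct syntax_bound_exists as [H HH].
  now apply (formula_bound_ind H D p HH).
Qed.
End FormulaInduction.

Lemma formula_bound H D p : syntax_bound H -> is_formula L D p ->
  subset D omega /\ p ∈ H.
Proof.
  intros HH Hp. destruct (formula_bound_ind (fun _ _ => True)) with H D p as (? & ? &
    ?); auto.
  apply (dfn_ext (fun r => r 0 = r 0)); [tauto | dfn].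
Qed.
End Syntax.

(** * Satisfaction *)

Section DefinabilityOfSemantics.
Context {V : membership_structure} {hV : ZF V}.
Notation env := (nat -> V).

Definition uni : V -> V :=
  proj1_sig (seal (fun (M : V) =>
    the (universe M))).

Definition fval : V -> V -> V -> V :=
  proj1_sig (seal (fun (M F s : V) =>
    the (fun_value M F s))).

Definition tv : V -> V -> V -> V -> V -> V :=
  proj1_sig (seal (fun (L M D a t : V) =>
    the (term_value L M D a t))).

Definition upd : V -> V -> V -> V -> V :=
  proj1_sig (seal (fun (D a k x : V) =>
    lam (adj D k) (fun j => the (fun y => (j = k /\ y = x) \/ (j <> k /\ y = ap a
      j))))).

Lemma uni_def M : uni M = the (universe M).
Proof. now unseal uni. Qed.

Lemma fval_def M F s : fval M F s = the (fun_value M F s).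
Proof. now unseal fval. Qed.

Lemma tv_def L M D a t : tv L M D a t = the (term_value L M D a t).
Proof. now unseal tv. Qed.

Lemma upd_def D a k x : upd D a k x =
  lam (adj D k) (fun j => the (fun y => (j = k /\ y = x) \/ (j <> k /\ y = ap a j))).
Proof. now unseal upd. Qed.

Lemma dfn_is_evaluation f g h k l : dterm f -> dterm g -> dterm h -> dterm k -> dterm l
  ->
  dfn (fun r : env => is_evaluation (f r) (g r) (h r) (k r) (l r)).
Proof. intros. unfold is_evaluation, is_image_tuple. dfn. Qed.

Lemma dfn_term_value f g h k l m : dterm f -> dterm g -> dterm h -> dterm k -> dterm l
  ->
  dterm m -> dfn (fun r : env => term_value (f r) (g r) (h r) (k r) (l r) (m r)).
Proof. intros. unfold term_value. dfn. apply dfn_is_evaluation; dfn. Qed.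

Lemma dterm_uni f : dterm f -> dterm (fun r : env => uni (f r)).
Proof. unseal uni. intros. apply (dterm_the (fun y r => universe (f r) y)). dfn. Qed.

Lemma dterm_fval f g h : dterm f -> dterm g -> dterm h ->
  dterm (fun r : env => fval (f r) (g r) (h r)).
Proof. unseal fval. intros. apply (dterm_the (fun y r => fun_value (f r) (g r) (h r)
  y)). dfn. Qed.

Lemma dterm_tv f g h k l : dterm f -> dterm g -> dterm h -> dterm k -> dterm l ->
  dterm (fun r : env => tv (f r) (g r) (h r) (k r) (l r)).
Proof.
  unseal tv. intros. apply (dterm_the (fun y r => term_value (f r) (g r) (h r) (k r) (l
    r) y)).
  apply dfn_term_value; dfn.
Qed.

Lemma dterm_upd f g h k : dterm f -> dterm g -> dterm h -> dterm k ->
  dterm (fun r : env => upd (f r) (g r) (h r) (k r)).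
Proof. unseal upd. dfn. Qed.

Lemma dfn_is_truth_set f g h : dterm f -> dterm g -> dterm h ->
  dfn (fun r : env => is_truth_set (f r) (g r) (h r)).
Proof. intros. unfold is_truth_set, is_image_tuple. dfn; apply dfn_term_value; dfn. Qed.

Lemma dfn_satisfies f g h k : dterm f -> dterm g -> dterm h -> dterm k ->
  dfn (fun r : env => satisfies (f r) (g r) (h r) (k r)).
Proof. intros. unfold satisfies. dfn. apply dfn_is_truth_set; dfn. Qed.
End DefinabilityOfSemantics.

Ltac dfn_hook_semantics := first
  [ simple apply dfn_is_evaluation | simple apply dfn_term_value | simple apply
    dterm_uni
  | simple apply dterm_fval | simple apply dterm_tv | simple apply dterm_upd
  | simple apply dfn_is_truth_set | simple apply dfn_satisfies ].
Ltac dfn_hook ::= first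
  [ dfn_hook_the | dfn_hook_sets | dfn_hook_comprehension | dfn_hook_functions
  | dfn_hook_codes | dfn_hook_syntax | dfn_hook_semantics ].

(** Inversion of equalities between codes: distinct tags are contradictory, equal tags give equal
    components. *)
Ltac codes := repeat match goal with
  | H : ?x = ?y |- _ =>
      apply tag_inj in H; let E := fresh in destruct H as [H E]; try discriminate H;
        clear H
  | H : opair _ _ = opair _ _ |- _ =>
      apply opair_inj in H; let E := fresh in destruct H as [H E]
  end; subst.

Section Semantics.
Context {V : membership_structure} {hV : ZF V}.
Notation env := (nat -> V).

(** An assignment thus determines its set of variables, so a truth set may consist of pairs of a
    formula and an assignment without recording [D]. *)
Lemma fn_dom_unique (f a b : V) : is_function f a -> is_function f b -> a = b.
Proof.
  intros Ha Hb. apply ext. intro x. split; intro Hx.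
  - assert (H : opair x (ap f x) ∈ f) by now apply (fn_mem f a).
    now apply (fn_mem f b) in H.
  - assert (H : opair x (ap f x) ∈ f) by now apply (fn_mem f b).
    now apply (fn_mem f a) in H.
Qed.

Lemma ap_upd_same (D a k x : V) : ap (upd D a k x) k = x.
Proof.
  rewrite upd_def, ap_lam.
  - apply the_eq; [auto|]. intros z [[_ E]|[E _]]; tauto.
  - dfn.
  - apply in_adj. auto.
Qed.

Lemma ap_upd_other D a k x j : j ∈ D -> j <> k -> ap (upd D a k x) j = ap a j.
Proof.
  intros Hj N. rewrite upd_def, ap_lam.
  - apply the_eq; [auto|]. intros z [[E _]|[_ E]]; tauto.
  - dfn.
  - apply in_adj. auto.
Qed.

Lemma upd_maps D a k x A : maps a D A -> x ∈ A -> maps (upd D a k x) (adj D k) A.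
Proof.
  intros Ha Hx. apply mapsE in Ha. destruct Ha as [Ha Ka]. apply mapsE. split.
  - rewrite upd_def. apply lam_fn. dfn.
  - intros j Hj. destruct (classic (j = k)) as [->|N].
    + now rewrite ap_upd_same.
    + apply in_adj in Hj. destruct Hj; [|tauto]. rewrite ap_upd_other; auto.
Qed.

(** Turns the quantifier over variants of an assignment, as it stands in the existential clause of
    [is_truth_set], into a quantifier over points of the universe. *)
Lemma upd_char D a k A b : maps a D A ->
  (maps b (adj D k) A /\ (forall j x, j <> k -> (⟨j, x⟩ ∈ b <-> ⟨j, x⟩ ∈ a))) <->
  exists x, x ∈ A /\ b = upd D a k x.
Proof.
  intros Ha. pose proof Ha as Ha'. apply mapsE in Ha'. destruct Ha' as [Hf Hv]. split.
  - intros [Hb H]. apply mapsE in Hb. destruct Hb as [Hb Kb]. exists (ap b k). split.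
    + apply Kb. apply in_adj. auto.
    + assert (Hu : maps (upd D a k (ap b k)) (adj D k) A).
      { apply upd_maps; auto. apply Kb, in_adj. auto. }
      apply mapsE in Hu. destruct Hu as [Hu _].
      apply (fn_ext _ _ (adj D k)); auto. intros j Hj.
      destruct (classic (j = k)) as [->|N].
      * now rewrite ap_upd_same.
      * apply in_adj in Hj. destruct Hj as [Hj|]; [|tauto].
        rewrite ap_upd_other by auto.
        assert (K : ⟨j, ap a j⟩ ∈ b) by (apply H; auto; now apply (fn_pair_mem a D)).
        apply (fn_pair_mem b _ _ _ Hb) in K. now destruct K.
  - intros (x & Hx & ->). pose proof (upd_maps D a k x A Ha Hx) as Hu. split; auto.
    apply mapsE in Hu. destruct Hu as [Hu _]. intros j y N.
    rewrite (fn_pair_mem _ _ _ _ Hu), (fn_pair_mem _ _ _ _ Hf), in_adj. split.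
    + intros [[Hj|]  ->]; [|tauto]. split; auto. now rewrite ap_upd_other.
    + intros [Hj ->]. split; auto. now rewrite ap_upd_other.
Qed.

Context {L : V} (hL : is_language L).

Section Structure.
Context {M : V} (hM : is_structure L M).

Lemma universeE A : universe M A <-> A = uni M.
Proof.
  destruct hM as (A0 & ir & jf & rs & fs & HM & _).
  assert (U : forall B, universe M B <-> B = A0).
  { intro B. apply is_otripleE in HM. unfold universe. setoid_rewrite is_otripleE.
    split.
    - intros (i & j & E). rewrite HM in E. codes. reflexivity.
    - intros ->. eauto. }
  assert (E : uni M = A0).
  { rewrite uni_def. apply the_eq; [now apply U|]. intros z Hz. now apply U. }
  now rewrite U, E.
Qed.

Lemma uni_nonempty : exists x, x ∈ uni M.
Proof.
  pose proof hM as (A0 & ir & jf & rs & fs & HM & HA & _).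
  assert (E : A0 = uni M) by (apply universeE; exists ir, jf; auto).
  rewrite <- E. exact HA.
Qed.

Lemma fun_valueE F n s : fun_symbol L F n -> maps s n (uni M) ->
  fval M F s ∈ uni M /\ forall y, fun_value M F s y <-> y = fval M F s.
Proof.
  pose proof hM as (A0 & ir & jf & rs & fs & HM & HA & Hrs & Hfs & Hir & Hjf & Hr & Hf).
  assert (E : A0 = uni M) by (apply universeE; exists ir, jf; auto). rewrite <- E.
  intros HF Hs.
  assert (Fs : F ∈ fs) by (apply Hfs; eauto).
  destruct (Hf F n (ap jf F) HF) as (An & HAn & Hmap).
  { now apply (fn_pair_mem jf fs). }
  apply is_exponentialE in HAn. subst An. apply mapsE in Hmap. destruct Hmap as [Hm Kv].
  assert (Hs' : s ∈ Exp n A0) by now apply in_Exp.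
  assert (K : forall y, fun_value M F s y <-> y = ap (ap jf F) s).
  { intro y. split.
    - intros (A & i & j & r & HM' & Hi & Hy). apply is_otripleE in HM, HM'.
      rewrite HM in HM'. codes. apply (fn_pair_mem j fs) in Hi; auto.
      destruct Hi as [_ ->].
      apply (fn_pair_mem _ _ _ _ Hm) in Hy. now destruct Hy.
    - intros ->. exists A0, ir, jf, (ap jf F). split; auto. split.
      + now apply (fn_pair_mem jf fs).
      + now apply (fn_pair_mem _ _ _ _ Hm). }
  assert (E' : fval M F s = ap (ap jf F) s).
  { rewrite fval_def. apply the_eq; [now apply K|]. intros z Hz. now apply K. }
  rewrite E'. split; auto.
Qed.

Section Evaluation.
Context {D a : V} (hD : subset D omega) (ha : maps a D (uni M)).

Lemma evaluation_unique e e' t : is_evaluation L M D a e -> is_evaluation L M D a e' ->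
  is_term L D t -> ap e t = ap e' t.
Proof.
  intros (A & T & HA & HT & He & Hv & Hap) (A' & T' & HA' & HT' & He' & Hv' & Hap').
  assert (T' = T) by (apply ext; intro x; now rewrite HT, HT'). subst T'.
  apply universeE in HA, HA'. subst A A'. apply mapsE in He, He', ha.
  destruct He as [He Ve], He' as [He' Ve'], ha as [Ha Va]. revert t.
  apply term_ind; auto.
  - dfn.
  - intros k Hk.
    assert (P : ⟨k, ap a k⟩ ∈ a) by now apply (fn_pair_mem a D).
    pose proof (proj2 (is_varE k (tVar k)) eq_refl) as Q.
    specialize (Hv _ _ _ Q P). specialize (Hv' _ _ _ Q P).
    apply (fn_pair_mem e T) in Hv; auto. apply (fn_pair_mem e' T) in Hv'; auto.
    destruct Hv, Hv'. congruence.
  - intros F n s HF Hs IH. apply is_term_tupleE in Hs. destruct Hs as [Hs Hst].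
    assert (Ms : maps s n T) by (apply mapsE; split; auto; intros k Hk; apply HT; auto).
    set (r := lam n (fun k => ap e (ap s k))).
    assert (Mr : maps r n (uni M)).
    { apply lam_maps; [dfn|]. intros k Hk. apply Ve, HT. auto. }
    destruct (fun_valueE F n r HF Mr) as [Vr Er].
    assert (R1 : is_image_tuple n s (fun u x => ⟨u, x⟩ ∈ e) r).
    { apply (is_image_tupleE _ (fun k => ap e (ap s k)) n s); auto; [dfn|].
      intros k y Hk.
      rewrite (fn_pair_mem e T) by auto. split; [tauto|]. split; auto. apply HT. auto. }
    assert (R2 : is_image_tuple n s (fun u x => ⟨u, x⟩ ∈ e') r).
    { apply (is_image_tupleE _ (fun k => ap e (ap s k)) n s); auto; [dfn|].
      intros k y Hk.
      rewrite (fn_pair_mem e' T), IH by auto. split; [tauto|]. split; auto. apply HT.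
      auto. }
    pose proof (proj2 (is_appE F s (tApp F s)) eq_refl) as Q.
    pose proof (proj2 (Er _) eq_refl) as Y.
    specialize (Hap F n s _ r _ HF Ms Q R1 Y).
    specialize (Hap' F n s _ r _ HF Ms Q R2 Y).
    apply (fn_pair_mem e T) in Hap; auto. apply (fn_pair_mem e' T) in Hap'; auto.
    destruct Hap, Hap'. congruence.
Qed.

(** The graph of the evaluation is a fixed point of the evaluation rules. It is single-valued by
    induction on terms, because a code determines the rule that formed it and, by
    [fun_symbol_unique], the arity of its symbol. *)
Lemma evaluation_exists : exists e, is_evaluation L M D a e.
Proof.
  destruct (term_set_exists hL D hD) as [T HT].
  pose proof ha as ha'. apply mapsE in ha'. destruct ha' as [Ha Va].
  destruct (fixpoint (prod T (uni M)) (fun W w =>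
    (exists k, k ∈ D /\ w = opair (tVar k) (ap a k)) \/
    (exists F n s r, fun_symbol L F n /\ is_term_tuple L D n s /\ maps r n (uni M) /\
      (forall k, k ∈ n -> opair (ap s k) (ap r k) ∈ W) /\
      w = opair (tApp F s) (fval M F r)))) as [W HW].
  { dfn. }
  { intros W W' x HWW [H|(F & n & s & r & H1 & H2 & H3 & H4 & H5)]; [auto|].
    right. exists F, n, s, r. split; [|split; [|split; [|split]]]; auto. }
  assert (Wvar : forall k y, k ∈ D -> (opair (tVar k) y ∈ W <-> y = ap a k)).
  { intros k y Hk. rewrite HW. split.
    - intros [_ [(k' & _ & E)|(F & n & s & r & _ & _ & _ & _ & E)]].
      + codes. reflexivity.
      + codes.
    - intros ->. split; [|eauto]. apply opair_in_prod. split; auto. apply HT.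
      now apply term_var. }
  assert (key : forall t, is_term L D t -> exists x, x ∈ uni M /\ forall y, opair t y ∈
    W <-> y = x).
  { apply term_ind; auto.
    - dfn.
    - intros k Hk. exists (ap a k). split; auto.
    - intros F n s HF Hs IH. pose proof Hs as Hs'. apply is_term_tupleE in Hs.
      destruct Hs as [Hs Hst].
      set (G := fun k => the (fun y => opair (ap s k) y ∈ W)).
      assert (DG : dterm (fun r : env => G (r 0))) by (unfold G; dfn).
      assert (HG : forall k, k ∈ n -> G k ∈ uni M /\ forall y, opair (ap s k) y ∈ W <->
        y = G k).
      { intros k Hk. destruct (IH k Hk) as (x & Hx & K).
        assert (E : G k = x) by (apply the_eq; [now apply K|]; intros z Hz; now apply
          K).
        rewrite E. auto. }
      set (r := lam n G).
      assert (Mr : maps r n (uni M)) by (apply lam_maps; auto; intros k Hk; now apply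
        HG).
      destruct (fun_valueE F n r HF Mr) as [Vr _].
      exists (fval M F r). split; auto. intro y. rewrite HW. split.
      + intros [_ [(k' & _ & E)|(F' & n' & s' & r' & H1 & H2 & H3 & H4 & E)]].
        * codes.
        * codes. assert (n' = n) by (apply (fun_symbol_unique hL F'); auto). subst n'.
          f_equal. apply mapsE in H3, Mr. destruct H3 as [H3 _], Mr as [Mr _].
          apply (fn_ext _ _ n); auto. intros k Hk. unfold r. rewrite ap_lam by auto.
          apply HG; auto.
      + intros ->. split.
        * apply opair_in_prod. split; auto. apply HT. now apply (term_app _ _ n).
        * right. exists F, n, s, r. split; [|split; [|split; [|split]]]; auto.
          intros k Hk. unfold r. rewrite ap_lam by auto. apply HG; auto. }
  assert (WT : is_function W T).
  { split.
    - intros p Hp. apply HW in Hp. destruct Hp as [Hp _]. apply in_prod in Hp.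
      destruct Hp as (x & y & Hx & _ & E). exists x, y. now rewrite is_opairE.
    - intros t Ht. apply HT in Ht. destruct (key t Ht) as (x & Hx & K). exists x.
      split; [now apply opair_memE, K|]. intros y Hy. apply opair_memE in Hy.
      symmetry. now apply K. }
  exists W. exists (uni M), T. split; [now apply universeE|]. split; [auto|].
  assert (WM : maps W T (uni M)).
  { apply mapsE. split; auto. intros t Ht. pose proof Ht as Ht'. apply HT in Ht.
    destruct (key t Ht) as (x & Hx & K).
    assert (E : opair t (ap W t) ∈ W) by now apply (fn_mem W T).
    apply K in E. now rewrite E. }
  split; [auto|]. split.
  - intros k t x Hk Hx. apply is_varE in Hk. subst t.
    apply (fn_pair_mem a D) in Hx; auto.
    destruct Hx as [Hk ->]. rewrite opair_memE. now apply Wvar.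
  - intros F n s t r y HF Hs Ht Hr Hy. apply is_appE in Ht. subst t.
    apply mapsE in Hs. destruct Hs as [Hs Vs].
    apply (is_image_tupleE _ (fun k => ap W (ap s k)) n s) in Hr; auto; [|dfn|].
    2:{ intros k z Hk. rewrite (fn_pair_mem W T) by auto. split; [tauto|]. auto. }
    apply mapsE in WM. destruct WM as [_ WM].
    assert (Mr : maps r n (uni M)).
    { subst r. apply lam_maps; [dfn|]. auto. }
    destruct (fun_valueE F n r HF Mr) as [Vr Er]. apply Er in Hy. subst y.
    rewrite opair_memE. apply HW. split.
    + apply opair_in_prod. split; auto. apply HT. apply (term_app _ _ n); auto.
      apply is_term_tupleE. split; auto. intros k Hk. now apply HT, Vs.
    + right. exists F, n, s, r. split; [|split; [|split; [|split]]]; auto.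
      * apply is_term_tupleE. split; auto. intros k Hk. now apply HT, Vs.
      * intros k Hk. subst r. rewrite ap_lam; [|dfn|auto]. apply (fn_mem W T); auto.
Qed.

Lemma tv_evaluation : exists e T, (forall t, t ∈ T <-> is_term L D t) /\ maps e T (uni
  M) /\
  is_evaluation L M D a e /\
  forall t, is_term L D t -> ap e t = tv L M D a t /\
    forall x, term_value L M D a t x <-> x = tv L M D a t.
Proof.
  destruct evaluation_exists as [e He].
  pose proof He as (A & T & HA & HT & HeT & _). apply universeE in HA. subst A.
  exists e, T. split; auto. split; auto. split; auto. intros t Ht.
  assert (K : forall x, term_value L M D a t x <-> x = ap e t).
  { intro x. split.
    - intros (e' & He' & Hx). rewrite (evaluation_unique e e'); auto.
      destruct He' as (A' & T' & _ & _ & [H _] & _).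
      apply (fn_pair_mem e' T') in Hx; auto. now destruct Hx.
    - intros ->. exists e. split; auto. destruct HeT as [H _].
      apply (fn_pair_mem e T); auto. split; auto. now apply HT. }
  assert (E : tv L M D a t = ap e t).
  { rewrite tv_def. apply the_eq; [now apply K|]. intros z Hz. now apply K. }
  rewrite E. auto.
Qed.

Lemma term_valueE t x : is_term L D t -> (term_value L M D a t x <-> x = tv L M D a t).
Proof. destruct tv_evaluation as (e & T & _ & _ & _ & H). intro Ht. now apply H. Qed.

Lemma tv_in t : is_term L D t -> tv L M D a t ∈ uni M.
Proof.
  destruct tv_evaluation as (e & T & HT & Me & He & H). intro Ht.
  destruct (H t Ht) as [<- _]. apply mapsE in Me. apply Me. now apply HT.
Qed.

Lemma tv_var k : k ∈ D -> tv L M D a (tVar k) = ap a k.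
Proof.
  destruct tv_evaluation as (e & T & HT & Me & He & H). intro Hk.
  destruct (H (tVar k)) as [<- _]; [now apply term_var|]. destruct Me as [Me _].
  destruct He as (A' & T' & _ & _ & _ & Hv & _).
  assert (K : ⟨tVar k, ap a k⟩ ∈ e).
  { apply (Hv k); [now apply is_varE|]. apply mapsE in ha. now apply (fn_pair_mem a D).
    }
  apply (fn_pair_mem e T) in K; auto. now destruct K.
Qed.

Lemma tv_app F n s : fun_symbol L F n -> is_term_tuple L D n s ->
  tv L M D a (tApp F s) = fval M F (lam n (fun k => tv L M D a (ap s k))).
Proof.
  destruct tv_evaluation as (e & T & HT & Me & He & H). intros HF Hs.
  destruct (H (tApp F s)) as [<- _]; [now apply (term_app _ _ n)|].
  apply is_term_tupleE in Hs. destruct Hs as [Hs Hst].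
  set (r := lam n (fun k => tv L M D a (ap s k))).
  assert (Mr : maps r n (uni M)).
  { apply lam_maps; [dfn|]. intros k Hk. apply tv_in. auto. }
  destruct (fun_valueE F n r HF Mr) as [Vr Er].
  destruct He as (A' & T' & _ & HT' & _ & _ & Hap). destruct Me as [Me _].
  assert (K : ⟨tApp F s, fval M F r⟩ ∈ e).
  { apply (Hap F n s _ r); auto.
    - apply mapsE. split; auto. intros k Hk. apply HT'. auto.
    - now apply is_appE.
    - apply (is_image_tupleE _ (fun k => tv L M D a (ap s k)) n s); auto; [dfn|].
      intros k y Hk. rewrite (fn_pair_mem e T) by auto.
      destruct (H (ap s k)) as [-> _]; auto.
      split; [tauto|]. split; auto. apply HT. auto.
    - now apply Er. }
  apply (fn_pair_mem e T) in K; auto. now destruct K.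
Qed.
End Evaluation.
End Structure.
End Semantics.

(** * Existence and uniqueness of truth *)

Section Truth.
Context {V : membership_structure} {hV : ZF V}.
Notation env := (nat -> V).
Context {L : V} (hL : is_language L) {M : V} (hM : is_structure L M).

(** The clauses of [is_truth_set] in terms of operations. They are imposed on a predicate rather
    than a set, so that [satisfies], which quantifies over truth sets, can itself be an instance. *)
Definition tarski (Tr : V -> V -> Prop) : Prop :=
  forall D a, subset D omega -> maps a D (uni M) ->
  (forall t u, is_term L D t -> is_term L D u ->
    (Tr (pEq t u) a <-> tv L M D a t = tv L M D a u)) /\
  (forall R n s, rel_symbol L R n -> is_term_tuple L D n s ->
    (Tr (pAtom R s) a <-> rel_holds M R (lam n (fun k => tv L M D a (ap s k))))) /\
  (forall p, is_formula L D p -> (Tr (pNot p) a <-> ~ Tr p a)) /\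
  (forall p q, is_formula L D p -> is_formula L D q ->
    (Tr (pAnd p q) a <-> Tr p a /\ Tr q a)) /\
  (forall k p, k ∈ omega -> is_formula L (adj D k) p ->
    (Tr (pEx k p) a <-> exists x, x ∈ uni M /\ Tr p (upd D a k x))).

Lemma is_truth_setE S : is_truth_set L M S <-> tarski (fun p a => opair p a ∈ S).
Proof.
  assert (E1 : forall D a t u, subset D omega -> maps a D (uni M) ->
    is_term L D t -> is_term L D u ->
    ((exists x, term_value L M D a t x /\ term_value L M D a u x) <->
     tv L M D a t = tv L M D a u)).
  { intros D a t u HD Ha Ht Hu. pose proof (term_valueE hL hM HD Ha) as K. split.
    - intros (x & H1 & H2). apply K in H1, H2; auto. congruence.
    - intro E. exists (tv L M D a t). rewrite !K; auto. }
  assert (E2 : forall D a R n s, subset D omega -> maps a D (uni M) ->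
    is_term_tuple L D n s ->
    ((exists r, is_image_tuple n s (term_value L M D a) r /\ rel_holds M R r) <->
     rel_holds M R (lam n (fun k => tv L M D a (ap s k))))).
  { intros D a R n s HD Ha Hs. apply is_term_tupleE in Hs. destruct Hs as [Hs Hst].
    assert (K : forall r, is_image_tuple n s (term_value L M D a) r <->
      r = lam n (fun k => tv L M D a (ap s k))).
    { intro r. apply (is_image_tupleE _ (fun k => tv L M D a (ap s k)) n s); auto;
        [dfn|].
      intros k y Hk. apply term_valueE; auto. }
    setoid_rewrite K. split; [intros (r & -> & H) | intro H]; eauto. }
  assert (E3 : forall D a k p, maps a D (uni M) ->
    ((exists b, maps b (adj D k) (uni M) /\
      (forall j x, j <> k -> (⟨j, x⟩ ∈ b <-> ⟨j, x⟩ ∈ a)) /\ ⟨p, b⟩ ∈ S) <->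
     exists x, x ∈ uni M /\ opair p (upd D a k x) ∈ S)).
  { intros D a k p Ha. pose proof (fun b => upd_char D a k (uni M) b Ha) as K. split.
    - intros (b & H1 & H2 & H3). apply opair_memE in H3.
      destruct (proj1 (K b) (conj H1 H2)) as (x & Hx & ->). eauto.
    - intros (x & Hx & H3). destruct (proj2 (K (upd D a k x))) as [H1 H2]; [eauto|].
      exists (upd D a k x). rewrite opair_memE. auto. }
  split.
  - intros H D a HD Ha.
    destruct (H omega (uni M) D a) as (H1 & H2 & H3 & H4 & H5); auto.
    { now apply is_omegaE. } { now apply (universeE hM). }
    split; [|split; [|split; [|split]]].
    + intros t u Ht Hu. rewrite <- opair_memE, (H1 t u), E1 by (auto; now apply
        is_equalityE).
      tauto.
    + intros R n s HR Hs.
      rewrite <- opair_memE, (H2 R n s), E2 by (auto; now apply is_atomE). tauto.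
    + intros p Hp. rewrite <- !opair_memE. apply H3; auto. now apply is_negationE.
    + intros p q Hp Hq. rewrite <- !opair_memE. apply H4; auto.
      now apply is_conjunctionE.
    + intros k p Hk Hp. rewrite <- opair_memE, (H5 k (adj D k) p), E3; auto; [tauto| |].
      * now apply is_adjoinE.
      * now apply is_existentialE.
  - intros H w A D a Hw HA HD Ha. apply is_omegaE in Hw. apply (universeE hM) in HA.
    subst w A.
    destruct (H D a) as (H1 & H2 & H3 & H4 & H5); auto.
    split; [|split; [|split; [|split]]].
    + intros t u p Ht Hu Hp. apply is_equalityE in Hp. subst p.
      rewrite opair_memE, H1, E1 by auto. tauto.
    + intros R n s p HR Hs Hp. apply is_atomE in Hp. subst p.
      rewrite opair_memE, (H2 R n), E2 by auto. tauto.
    + intros p q Hp Hq. apply is_negationE in Hq. subst q. rewrite !opair_memE.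
      exact (H3 p Hp).
    + intros p1 p2 q Hp1 Hp2 Hq. apply is_conjunctionE in Hq. subst q.
      rewrite !opair_memE. exact (H4 p1 p2 Hp1 Hp2).
    + intros k D' p q Hk HD' Hp Hq. apply is_adjoinE in HD'.
      apply is_existentialE in Hq.
      subst D' q. rewrite opair_memE, H5, E3 by auto. tauto.
Qed.

Lemma tarski_unique (T1 T2 : V -> V -> Prop) :
  dfn (fun r : env => T1 (r 0) (r 1)) -> dfn (fun r : env => T2 (r 0) (r 1)) ->
  tarski T1 -> tarski T2 ->
  forall D p, is_formula L D p -> forall a, maps a D (uni M) -> (T1 p a <-> T2 p a).
Proof.
  intros D1 D2 H1 H2.
  apply (formula_ind hL (fun D p => forall a, maps a D (uni M) -> (T1 p a <-> T2 p a))).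
  - dfn.
  - intros D t u HD Ht Hu a Ha.
    destruct (H1 D a HD Ha) as (K1 & _). destruct (H2 D a HD Ha) as (K2 & _).
    now rewrite K1, K2.
  - intros D R n s HD HR Hs a Ha.
    destruct (H1 D a HD Ha) as (_ & K1 & _). destruct (H2 D a HD Ha) as (_ & K2 & _).
    now rewrite (K1 R n), (K2 R n).
  - intros D p HD Hp IH a Ha.
    destruct (H1 D a HD Ha) as (_ & _ & K1 & _).
    destruct (H2 D a HD Ha) as (_ & _ & K2 & _).
    now rewrite K1, K2, IH.
  - intros D p q HD Hp Hq IHp IHq a Ha.
    destruct (H1 D a HD Ha) as (_ & _ & _ & K1 & _).
    destruct (H2 D a HD Ha) as (_ & _ & _ & K2 & _).
    now rewrite K1, K2, IHp, IHq.
  - intros D k p HD Hk Hp IH a Ha.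
    destruct (H1 D a HD Ha) as (_ & _ & _ & _ & K1).
    destruct (H2 D a HD Ha) as (_ & _ & _ & _ & K2).
    rewrite K1, K2 by auto.
    split; intros (x & Hx & K); exists x; (split; [auto|]); apply (IH (upd D a k x));
      auto using upd_maps.
Qed.

Section Existence.
Variable H : V.
Hypothesis HH : syntax_bound (L := L) H.
Variable W : V.

(** Truth is not monotone in the truth of the subformulas.  The truth set is
    therefore read off a fixed point that verifies and refutes formulas
    simultaneously, with verdicts [num 1] and [num 0]. *)
Definition verdict (b : nat) (p a : V) : Prop := opair (num b) (opair p a) ∈ W.
Notation T p a := (verdict 1 p a).
Notation F p a := (verdict 0 p a).

Definition verified (W D p a : V) : Prop :=
  (exists t u, p = pEq t u /\ tv L M D a t = tv L M D a u) \/
  (exists R n s, p = pAtom R s /\ rel_symbol L R n /\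
    rel_holds M R (lam n (fun k => tv L M D a (ap s k)))) \/
  (exists q, p = pNot q /\ opair (num 0) (opair q a) ∈ W) \/
  (exists q q', p = pAnd q q' /\ opair (num 1) (opair q a) ∈ W /\
    opair (num 1) (opair q' a) ∈ W) \/
  (exists k q, p = pEx k q /\ exists x, x ∈ uni M /\
    opair (num 1) (opair q (upd D a k x)) ∈ W).

(** Refutation is expressed by the dual condition on subformulas instead of by negation, so that [W]
    occurs only positively and the operator is monotone. *)
Definition refuted (W D p a : V) : Prop :=
  (exists t u, p = pEq t u /\ tv L M D a t <> tv L M D a u) \/
  (exists R n s, p = pAtom R s /\ rel_symbol L R n /\
    ~ rel_holds M R (lam n (fun k => tv L M D a (ap s k)))) \/
  (exists q, p = pNot q /\ opair (num 1) (opair q a) ∈ W) \/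
  (exists q q', p = pAnd q q' /\ (opair (num 0) (opair q a) ∈ W \/
    opair (num 0) (opair q' a) ∈ W)) \/
  (exists k q, p = pEx k q /\ forall x, x ∈ uni M ->
    opair (num 0) (opair q (upd D a k x)) ∈ W).

Definition verdict_rule (W w : V) : Prop := exists D p a,
  subset D omega /\ maps a D (uni M) /\
  (w = opair (num 1) (opair p a) /\ verified W D p a \/
   w = opair (num 0) (opair p a) /\ refuted W D p a).

Hypothesis HW : forall w, w ∈ W <->
  w ∈ prod (upair (num 0) (num 1)) (prod H (pow (prod omega (uni M)))) /\ verdict_rule
    W w.

Lemma verdict_rules D p a : subset D omega -> maps a D (uni M) -> is_formula L D p ->
  (T p a <-> verified W D p a) /\ (F p a <-> refuted W D p a).
Proof.
  intros HD Ha Hp.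
  assert (B : forall j, num j ∈ upair (num 0) (num 1) ->
    opair (num j) (opair p a) ∈ prod (upair (num 0) (num 1)) (prod H (pow (prod omega
      (uni M))))).
  { intros j Hj. rewrite !opair_in_prod. split; auto. split.
    - now apply (formula_bound hL H D p HH).
    - apply in_pow. intros c Hc. apply mapsE in Ha. destruct Ha as [Ha Va].
      apply (fn_elem a D) in Hc; auto. destruct Hc as (x & Hx & ->).
      apply opair_in_prod. auto. }
  unfold verdict. rewrite (HW (opair (num 1) _)), (HW (opair (num 0) _)).
  assert (N : num 1 <> num 0 :> V) by (intro E; now apply num_inj in E).
  assert (N' : num 0 <> num 1 :> V) by (intro E; now apply num_inj in E).
  split; split.
  - intros (_ & D' & p' & a' & HD' & Ha' & [[E K]|[E K]]); apply opair_inj in E;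
      destruct E as [E1 E2]; [|tauto].
    apply opair_inj in E2. destruct E2. subst p' a'.
    destruct Ha as [Ha _], Ha' as [Ha' _]. now rewrite (fn_dom_unique a D D').
  - intro K. split; [apply B, in_upair; auto|]. exists D, p, a. auto.
  - intros (_ & D' & p' & a' & HD' & Ha' & [[E K]|[E K]]); apply opair_inj in E;
      destruct E as [E1 E2]; [tauto|].
    apply opair_inj in E2. destruct E2. subst p' a'.
    destruct Ha as [Ha _], Ha' as [Ha' _]. now rewrite (fn_dom_unique a D D').
  - intro K. split; [apply B, in_upair; auto|]. exists D, p, a. auto.
Qed.

Ltac unpack := repeat match goal with
  | K : _ \/ _ |- _ => destruct K as [K|K]
  | K : exists x, _ |- _ => destruct K as [? K]
  | K : pEq _ _ = _ /\ _ |- _ => destruct K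
  | K : pAtom _ _ = _ /\ _ |- _ => destruct K
  | K : pNot _ = _ /\ _ |- _ => destruct K
  | K : pAnd _ _ = _ /\ _ |- _ => destruct K
  | K : pEx _ _ = _ /\ _ |- _ => destruct K
  end; codes.

Lemma verdict_eq D a t u : subset D omega -> maps a D (uni M) ->
  is_term L D t -> is_term L D u ->
  (T (pEq t u) a <-> tv L M D a t = tv L M D a u) /\
  (F (pEq t u) a <-> tv L M D a t <> tv L M D a u).
Proof.
  intros HD Ha Ht Hu.
  destruct (verdict_rules D (pEq t u) a) as [-> ->]; auto using formula_eq.
  split; split; intro K.
  - unfold verified in K. unpack. auto.
  - left. eauto.
  - unfold refuted in K. unpack. auto.
  - left. eauto.
Qed.

Lemma verdict_atom D a R n s : subset D omega -> maps a D (uni M) ->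
  rel_symbol L R n -> is_term_tuple L D n s ->
  (T (pAtom R s) a <-> rel_holds M R (lam n (fun k => tv L M D a (ap s k)))) /\
  (F (pAtom R s) a <-> ~ rel_holds M R (lam n (fun k => tv L M D a (ap s k)))).
Proof.
  intros HD Ha HR Hs.
  destruct (verdict_rules D (pAtom R s) a) as [-> ->]; auto.
  { now apply (formula_atom D R n s). }
  split; split; intro K.
  - unfold verified in K. unpack. match goal with E : rel_symbol _ _ _ /\ _ |- _ =>
      destruct E as [K1 K2] end.
    now rewrite (rel_symbol_unique hL _ _ _ HR K1).
  - right. left. exists R, n, s. auto.
  - unfold refuted in K. unpack. match goal with E : rel_symbol _ _ _ /\ _ |- _ =>
      destruct E as [K1 K2] end.
    now rewrite (rel_symbol_unique hL _ _ _ HR K1).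
  - right. left. exists R, n, s. auto.
Qed.

Lemma verdict_not D a p : subset D omega -> maps a D (uni M) -> is_formula L D p ->
  (T (pNot p) a <-> F p a) /\ (F (pNot p) a <-> T p a).
Proof.
  intros HD Ha Hp.
  destruct (verdict_rules D (pNot p) a) as [-> ->]; auto using formula_not.
  split; split; intro K.
  - unfold verified in K. unpack. auto.
  - right. right. left. exists p. auto.
  - unfold refuted in K. unpack. auto.
  - right. right. left. exists p. auto.
Qed.

Lemma verdict_and D a p q : subset D omega -> maps a D (uni M) ->
  is_formula L D p -> is_formula L D q ->
  (T (pAnd p q) a <-> T p a /\ T q a) /\ (F (pAnd p q) a <-> F p a \/ F q a).
Proof.
  intros HD Ha Hp Hq.
  destruct (verdict_rules D (pAnd p q) a) as [-> ->]; auto using formula_and.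
  split; split; intro K.
  - unfold verified in K. unpack. auto.
  - right. right. right. left. exists p, q. auto.
  - unfold refuted in K. unpack; auto.
  - right. right. right. left. exists p, q. auto.
Qed.

Lemma verdict_ex D a k p : subset D omega -> maps a D (uni M) ->
  k ∈ omega -> is_formula L (adj D k) p ->
  (T (pEx k p) a <-> exists x, x ∈ uni M /\ T p (upd D a k x)) /\
  (F (pEx k p) a <-> forall x, x ∈ uni M -> F p (upd D a k x)).
Proof.
  intros HD Ha Hk Hp.
  destruct (verdict_rules D (pEx k p) a) as [-> ->]; auto using formula_ex.
  split; split; intro K.
  - unfold verified in K. unpack. eexists; eassumption.
  - right. right. right. right. exists k, p. auto.
  - unfold refuted in K. unpack. auto.
  - right. right. right. right. exists k, p. auto.
Qed.

(** Induction on formulas shows that each receives exactly one verdict. Refutation is then the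
    complement of verification, which is what the negation clause of [tarski] demands. *)
Lemma verdict_total D p : is_formula L D p ->
  forall a, maps a D (uni M) -> (F p a <-> ~ T p a).
Proof.
  revert D p.
  apply (formula_ind hL (fun D p => forall a, maps a D (uni M) -> (F p a <-> ~ T p a))).
  - unfold verdict. dfn.
  - intros D t u HD Ht Hu a Ha. destruct (verdict_eq D a t u) as [-> ->]; tauto.
  - intros D R n s HD HR Hs a Ha. destruct (verdict_atom D a R n s) as [-> ->]; tauto.
  - intros D p HD Hp IH a Ha. destruct (verdict_not D a p) as [-> ->]; auto.
    rewrite IH by auto. tauto.
  - intros D p q HD Hp Hq IHp IHq a Ha. destruct (verdict_and D a p q) as [-> ->]; auto.
    rewrite IHp, IHq by auto. tauto.
  - intros D k p HD Hk Hp IH a Ha. destruct (verdict_ex D a k p) as [-> ->]; auto.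
    split.
    + intros K (x & Hx & Kx). apply (IH (upd D a k x)) in Kx; auto using upd_maps.
    + intros K x Hx. apply (IH (upd D a k x)); [auto using upd_maps|]. eauto.
Qed.

Lemma verdict_tarski : tarski (fun p a => T p a).
Proof.
  intros D a HD Ha. split; [|split; [|split; [|split]]].
  - intros t u Ht Hu. now apply verdict_eq.
  - intros R n s HR Hs. now apply verdict_atom.
  - intros p Hp. destruct (verdict_not D a p) as [-> _]; auto.
    now apply (verdict_total D).
  - intros p q Hp Hq. now apply (verdict_and D).
  - intros k p Hk Hp. now apply (verdict_ex D).
Qed.
End Existence.

Lemma truth_set_exists : exists S, is_truth_set L M S.
Proof.
  destruct (syntax_bound_exists hL) as [H HH].
  (* Codes lie in [H] and assignments are subsets of [prod omega (uni M)], which bounds the fixed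
     point by a set. *)
  destruct (fixpoint (prod (upair (num 0) (num 1)) (prod H (pow (prod omega (uni M)))))
    verdict_rule) as [W HW].
  { unfold verdict_rule, verified, refuted. dfn. }
  { intros W W' w HWW (D & p & a & HD & Ha & K). exists D, p, a. split; auto.
    split; auto.
    destruct K as [[E K]|[E K]]; [left|right]; (split; [auto|]).
    - destruct K as [K|[K|[(q & E' & K)|[(q & q' & E' & K1 & K2)|(k & q & E' & x & Hx &
        K)]]]].
      + left. auto.
      + right. left. auto.
      + right. right. left. eauto.
      + right. right. right. left. exists q, q'. auto.
      + right. right. right. right. exists k, q. eauto.
    - destruct K as [K|[K|[(q & E' & K)|[(q & q' & E' & K)|(k & q & E' & K)]]]].
      + left. auto.
      + right. left. auto.
      + right. right. left. eauto.
      + right. right. right. left. exists q, q'. intuition auto.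
      + right. right. right. right. exists k, q. auto. }
  exists (sep (prod H (pow (prod omega (uni M)))) (fun w => opair (num 1) w ∈ W)).
  apply is_truth_setE.
  assert (E : forall p a, opair p a ∈ sep (prod H (pow (prod omega (uni M)))) (fun w =>
    opair (num 1) w ∈ W)
    <-> verdict W 1 p a).
  { intros p a. rewrite in_sep by dfn. unfold verdict. split; [tauto|]. intro K.
    split; auto.
    apply HW in K. destruct K as [K _]. apply opair_in_prod in K. apply K. }
  pose proof (verdict_tarski H HH W HW) as K.
  intros D a HD Ha. destruct (K D a HD Ha) as (K1 & K2 & K3 & K4 & K5).
  setoid_rewrite E. auto.
Qed.

(** All truth sets agree on formulas by [tarski_unique], so the existential quantifier in
    [satisfies] may be read with one fixed truth set. Later arguments about satisfaction use only
    these clauses. *)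
Lemma satisfies_tarski : tarski (satisfies L M).
Proof.
  destruct truth_set_exists as [S HS].
  assert (E : forall D p a, is_formula L D p -> maps a D (uni M) ->
    (satisfies L M p a <-> opair p a ∈ S)).
  { intros D p a Hp Ha. unfold satisfies. split.
    - intros (S' & HS' & K). apply opair_memE in K. apply is_truth_setE in HS, HS'.
      refine (proj1 (tarski_unique _ _ _ _ HS' HS D p Hp a Ha) K); dfn.
    - intro K. exists S. now rewrite opair_memE. }
  pose proof HS as HS'. apply is_truth_setE in HS'.
  intros D a HD Ha. destruct (HS' D a HD Ha) as (K1 & K2 & K3 & K4 & K5).
  split; [|split; [|split; [|split]]].
  - intros t u Ht Hu. rewrite (E D); auto using formula_eq.
  - intros R n s HR Hs. rewrite (E D); auto. now apply (formula_atom D R n s).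
  - intros p Hp. rewrite !(E D); auto using formula_not.
  - intros p q Hp Hq. rewrite !(E D); auto using formula_and.
  - intros k p Hk Hp. rewrite (E D) by auto using formula_ex. rewrite K5 by auto.
    split; intros (x & Hx & K); exists x; (split; [auto|]); apply (E (adj D k)); auto
      using upd_maps.
Qed.
End Truth.

(** * Ultraproducts and Łoś's theorem *)

Section DefinabilityOfUltraproducts.
Context {V : membership_structure} {hV : ZF V}.
Notation env := (nat -> V).

Definition cl : V -> V -> V -> V -> V :=
  proj1_sig (seal (fun (I U Ms f : V) => the (is_class I U Ms f))).

Lemma dfn_in_product f g h : dterm f -> dterm g -> dterm h ->
  dfn (fun r : env => in_product (f r) (g r) (h r)).
Proof. intros. unfold in_product. dfn. Qed.

Lemma dfn_large f g (P : V -> env -> Prop) : dterm f -> dterm g ->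
  dfn (fun r => P (r 0) (fun n => r (S n))) ->
  dfn (fun r : env => large (f r) (g r) (fun i => P i r)).
Proof.
  intros. unfold large. dfn.
  exact (dfn_ren (fun n => match n with 0 => 0 | S m => S (S m) end) _ H1).
Qed.

Lemma dfn_is_class f g h k l : dterm f -> dterm g -> dterm h -> dterm k -> dterm l ->
  dfn (fun r : env => is_class (f r) (g r) (h r) (k r) (l r)).
Proof.
  intros. unfold is_class. dfn. apply dfn_in_product; dfn.
  apply (dfn_large _ _ (fun i r => exists x, ⟨i, x⟩ ∈ k (fun n => r (S n)) /\ ⟨i, x⟩ ∈
    r 0)); dfn.
Qed.

Lemma dterm_cl f g h k : dterm f -> dterm g -> dterm h -> dterm k ->
  dterm (fun r : env => cl (f r) (g r) (h r) (k r)).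
Proof.
  intros. unseal cl. apply (dterm_the (fun y r => is_class (f r) (g r) (h r) (k r) y)).
  apply dfn_is_class; dfn.
Qed.
End DefinabilityOfUltraproducts.

Ltac dfn_hook_ultraproducts := first
  [ simple apply dfn_in_product
  | match goal with |- dfn (fun r => large _ _ (fun i => @?P r i)) =>
      apply (dfn_large _ _ (fun i r => P r i)) end
  | simple apply dfn_is_class | simple apply dterm_cl
  | match goal with |- dfn (fun r => is_product_tuple _ _ _ _) =>
      unfold is_product_tuple end ].
Ltac dfn_hook ::= first
  [ dfn_hook_the | dfn_hook_sets | dfn_hook_comprehension | dfn_hook_functions
  | dfn_hook_codes | dfn_hook_syntax | dfn_hook_semantics | dfn_hook_ultraproducts ].

(** * Calculus of large sets *)

Section Large.
Context {V : membership_structure} {hV : ZF V} {I U : V} (hU : is_ultrafilter I U).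
Notation env := (nat -> V).

Lemma large_sep (P : V -> Prop) : dfn (fun r : env => P (r 0)) ->
  (large I U P <-> sep I P ∈ U).
Proof.
  intro D. split.
  - intros (X & HX & H). replace (sep I P) with X; auto. apply ext. intro x.
    now rewrite H, in_sep.
  - intro H. exists (sep I P). split; auto. intro i. now apply in_sep.
Qed.

Lemma large_ext (P Q : V -> Prop) : (forall i, i ∈ I -> (P i <-> Q i)) ->
  (large I U P <-> large I U Q).
Proof.
  intro H. split; intros (X & HX & K); exists X; (split; [auto|]); intro i; rewrite K;
    specialize (H i); tauto.
Qed.

(** The set of indices satisfying [Q] is a new one and has to be formed by separation, hence the
    definability of [Q]; in [large_ext] the given set serves again. *)
Lemma large_mono (P Q : V -> Prop) : dfn (fun r : env => Q (r 0)) ->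
  large I U P -> (forall i, i ∈ I -> P i -> Q i) -> large I U Q.
Proof.
  intros D (X & HX & H) K. apply large_sep; auto. destruct hU as (_ & _ & _ & up & _).
  apply (up X); auto.
  - intros x Hx. rewrite in_sep by dfn. apply H in Hx. destruct Hx. auto.
  - intros x Hx. rewrite in_sep in Hx by dfn. apply Hx.
Qed.

Lemma large_and (P Q : V -> Prop) : large I U P -> large I U Q ->
  large I U (fun i => P i /\ Q i).
Proof.
  intros (X & HX & H) (Y & HY & K). exists (sep X (fun x => x ∈ Y)). split.
  - destruct hU as (_ & _ & _ & _ & int & _). apply (int X Y); auto.
    intro i. rewrite in_sep by dfn. tauto.
  - intro i. rewrite in_sep by dfn. rewrite H, K. tauto.
Qed.

Lemma large_all (P : V -> Prop) : (forall i, i ∈ I -> P i) -> large I U P.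
Proof.
  intro H. exists I. split; [apply hU|]. intro i. split; [auto|tauto].
Qed.

Lemma large_nonempty (P : V -> Prop) : large I U P -> exists i, i ∈ I /\ P i.
Proof.
  intros (X & HX & H). apply NNPP. intro N. destruct hU as (_ & _ & E & _).
  apply (E X); auto. intros x Hx. apply H in Hx. eauto.
Qed.

Lemma large_not (P : V -> Prop) : dfn (fun r : env => P (r 0)) ->
  (large I U (fun i => ~ P i) <-> ~ large I U P).
Proof.
  intro D. split.
  - intros H K. destruct (large_nonempty _ (large_and _ _ H K)) as (i & _ & []). tauto.
  - intro N. rewrite large_sep in N by dfn. apply large_sep; [dfn|].
    destruct hU as (_ & _ & _ & _ & _ & ult).
    destruct (ult (sep I P) (sep I (fun i => ~ P i))); auto; [| |tauto].
    + intros x Hx. rewrite in_sep in Hx by dfn. apply Hx.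
    + intro i. rewrite !in_sep by dfn. tauto.
Qed.

Lemma ultrafilter_index_nonempty : exists i, i ∈ I.
Proof.
  destruct (large_nonempty (fun _ => True)) as (i & Hi & _); [now apply
    large_all|eauto].
Qed.
End Large.

Section Ultraproducts.
Context {V : membership_structure} {hV : ZF V}.
Notation env := (nat -> V).
Context {I U : V} (hU : is_ultrafilter I U).

Section Products.
Context {Ms : V} (hMs : is_function Ms I)
  (hMs' : forall i, i ∈ I -> exists L, is_structure L (ap Ms i)).

Lemma in_productE f :
  in_product I Ms f <-> is_function f I /\ forall i, i ∈ I -> ap f i ∈ uni (ap Ms i).
Proof.
  unfold in_product. split; intros [H K]; (split; [exact H|]).
  - intros i Hi. destruct (hMs' i Hi) as [L hM]. apply (K i (ap Ms i)).
    + now apply (fn_pair_mem Ms I).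
    + now apply (universeE hM).
    + now apply (fn_pair_mem f I).
  - intros i M A x HM HA Hx. apply (fn_pair_mem Ms I) in HM; auto.
    destruct HM as [Hi ->].
    destruct (hMs' i Hi) as [L hM]. apply (universeE hM) in HA. subst A.
    apply (fn_pair_mem f I) in Hx; auto. destruct Hx as [_ ->]. auto.
Qed.

(** Lets separation form the classes [[f]], and later serves as a codomain for tuples of elements of
    the product. *)
Lemma product_set_exists : exists P, forall f, f ∈ P <-> in_product I Ms f.
Proof.
  exists (sep (pow (prod I (Un (rep I (fun i => uni (ap Ms i)))))) (in_product I Ms)).
  intro f. rewrite in_sep by dfn. split; [tauto|]. intro H. split; auto.
  apply in_pow. intros p Hp. apply in_productE in H. destruct H as [Hf Hv].
  apply (fn_elem f I) in Hp; auto. destruct Hp as (i & Hi & ->). apply opair_in_prod.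
  split; auto. apply in_Un. exists (uni (ap Ms i)). split; auto.
  rewrite in_rep by dfn. eauto.
Qed.

Lemma is_classE f c : is_class I U Ms f c <-> c = cl I U Ms f.
Proof.
  assert (K : is_class I U Ms f (cl I U Ms f)).
  { destruct product_set_exists as [P HP]. unseal cl.
    apply (the_spec (is_class I U Ms f)).
    exists (sep P (fun g => large I U (fun i => exists x, ⟨i, x⟩ ∈ f /\ ⟨i, x⟩ ∈ g))).
    split.
    - intro h. rewrite in_sep by dfn. now rewrite HP.
    - intros c' Hc. apply ext. intro h. rewrite in_sep by dfn. rewrite HP. symmetry.
      apply Hc. }
  split; [|now intros ->]. intro H. apply ext. intro g. now rewrite (H g), (K g).
Qed.

Lemma in_cl f g : in_product I Ms f ->
  (g ∈ cl I U Ms f <-> in_product I Ms g /\ large I U (fun i => ap f i = ap g i)).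
Proof.
  intro Hf. rewrite (proj2 (is_classE f _) eq_refl g).
  assert (E : in_product I Ms g ->
    (large I U (fun i => exists x, ⟨i, x⟩ ∈ f /\ ⟨i, x⟩ ∈ g) <->
     large I U (fun i => ap f i = ap g i))).
  { intros Hg. apply large_ext. intros i Hi. destruct Hf as [Hf _], Hg as [Hg _].
    setoid_rewrite (fn_pair_mem f I _ _ Hf). setoid_rewrite (fn_pair_mem g I _ _ Hg).
    split; [intros (x & [_ ->] & [_ K]); auto | intro K; exists (ap f i); auto]. }
  tauto.
Qed.

Lemma cl_eq f g : in_product I Ms f -> in_product I Ms g ->
  (cl I U Ms f = cl I U Ms g <-> large I U (fun i => ap f i = ap g i)).
Proof.
  intros Hf Hg. split.
  - intro E. assert (K : g ∈ cl I U Ms g).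
    { apply in_cl; auto. split; auto. now apply large_all. }
    rewrite <- E in K. now apply in_cl in K.
  - intro H. apply ext. intro h. rewrite !in_cl by auto.
    split; intros [Hh K]; (split; [auto|]);
    (eapply large_mono; [exact hU | dfn | exact (large_and hU _ _ H K) |]);
    intros i _ []; congruence.
Qed.

Lemma is_product_tupleE n s : is_product_tuple I Ms n s <->
  is_function s n /\ forall k, k ∈ n -> in_product I Ms (ap s k).
Proof.
  unfold is_product_tuple. split; intros [H K]; (split; [exact H|]).
  - intros k Hk. apply (K k). now apply (fn_pair_mem s n).
  - intros k f Hp. apply (fn_pair_mem s n) in Hp; auto. destruct Hp. subst. auto.
Qed.

Lemma is_class_tupleE n s q : is_product_tuple I Ms n s ->
  (is_class_tuple I U Ms n s q <-> q = lam n (fun k => cl I U Ms (ap s k))).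
Proof.
  intro H. apply is_product_tupleE in H. destruct H as [Hs Ks].
  apply (is_image_tupleE _ (fun k => cl I U Ms (ap s k)) n s); auto; [dfn|].
  intros k y Hk. apply is_classE.
Qed.

Lemma is_tuple_atE n s i r : is_product_tuple I Ms n s -> i ∈ I ->
  (is_tuple_at i n s r <-> r = lam n (fun k => ap (ap s k) i)).
Proof.
  intros H Hi. apply is_product_tupleE in H. destruct H as [Hs Ks].
  apply (is_image_tupleE _ (fun k => ap (ap s k) i) n s); auto; [dfn|].
  intros k y Hk. destruct (Ks k Hk) as [Hf _]. rewrite (fn_pair_mem _ I _ _ Hf). tauto.
Qed.

(** Brings the coordinatewise clauses for relations in [is_ultraproduct], and that of
    [Los_equivalence], into [lam] form. *)
Lemma large_tuple_at (Q : V -> V -> Prop) n s : is_product_tuple I Ms n s ->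
  (large I U (fun i => exists M r, ⟨i, M⟩ ∈ Ms /\ is_tuple_at i n s r /\ Q M r) <->
   large I U (fun i => Q (ap Ms i) (lam n (fun k => ap (ap s k) i)))).
Proof.
  intro Hs. apply large_ext. intros i Hi. split.
  - intros (M & r & HM & Hr & HQ). apply (fn_pair_mem Ms I) in HM; auto.
    destruct HM as [_ ->]. apply (is_tuple_atE n s i r Hs Hi) in Hr. now subst r.
  - intro HQ. exists (ap Ms i), (lam n (fun k => ap (ap s k) i)).
    split; [now apply (fn_pair_mem Ms I)|]. split; auto. now apply is_tuple_atE.
Qed.
End Products.

(** Updating a tuple commutes with a pointwise operation. In the existential case of Łoś's theorem
    [G] is once the passage to classes and once the evaluation at an index. *)
Lemma upd_lam D k s g (G : V -> V) : dterm (fun r : env => G (r 0)) ->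
  lam (adj D k) (fun j => G (ap (upd D s k g) j)) = upd D (lam D (fun j => G (ap s j)))
    k (G g).
Proof.
  intro DG. rewrite (upd_def D (lam D _)). apply lam_ext; [dfn|dfn|].
  intros j Hj. symmetry. destruct (classic (j = k)) as [->|N].
  - rewrite ap_upd_same. apply the_eq; [auto|]. intros z [[_ E]|[E _]]; tauto.
  - apply in_adj in Hj. destruct Hj as [Hj|]; [|tauto].
    rewrite ap_upd_other by auto. apply the_eq.
    + right. split; auto. rewrite ap_lam; [auto|dfn|auto].
    + intros z [[E _]|[_ ->]]; [tauto|]. rewrite ap_lam; [auto|dfn|auto].
Qed.

Context {L : V} (hL : is_language L) {Ms : V} (hMs : is_family L I Ms)
  {N : V} (hN : is_ultraproduct L I U Ms N).

Lemma family_function : is_function Ms I.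
Proof. apply hMs. Qed.

Lemma family_structure i : i ∈ I -> is_structure L (ap Ms i).
Proof. intro Hi. apply (proj2 hMs i). now apply (fn_pair_mem Ms I _ _ family_function).
Qed.

Lemma family_structures i : i ∈ I -> exists L, is_structure L (ap Ms i).
Proof. eauto using family_structure. Qed.

Notation fF := family_function.
Notation fS := family_structures.
Notation cl := (cl I U Ms).

Lemma ultraproduct_structure : is_structure L N.
Proof. apply hN. Qed.

Notation hN' := ultraproduct_structure.

Lemma in_ultraproduct c : c ∈ uni N <-> exists f, in_product I Ms f /\ c = cl f.
Proof.
  destruct hN as (_ & HA & _). rewrite (HA (uni N)) by now apply (universeE hN').
  split; intros (f & Hf & K); exists f; (split; [auto|]); now apply (is_classE fF fS).
Qed.

Lemma ultraproduct_tuple D s : is_product_tuple I Ms D s ->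
  maps (lam D (fun k => cl (ap s k))) D (uni N).
Proof.
  intro Hs. apply is_product_tupleE in Hs. destruct Hs as [Hs Ks].
  apply lam_maps; [dfn|]. intros k Hk. apply in_ultraproduct. eauto.
Qed.

Lemma tuple_at_maps D s i : is_product_tuple I Ms D s -> i ∈ I ->
  maps (lam D (fun k => ap (ap s k) i)) D (uni (ap Ms i)).
Proof.
  intros Hs Hi. apply is_product_tupleE in Hs. destruct Hs as [Hs Ks].
  apply lam_maps; [dfn|]. intros k Hk. specialize (Ks k Hk).
  apply (in_productE fF fS) in Ks. now apply Ks.
Qed.

Lemma ultraproduct_rel R n s : rel_symbol L R n -> is_product_tuple I Ms n s ->
  (rel_holds N R (lam n (fun k => cl (ap s k))) <->
   large I U (fun i => rel_holds (ap Ms i) R (lam n (fun k => ap (ap s k) i)))).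
Proof.
  intros HR Hs. destruct hN as (_ & _ & H & _).
  rewrite (H R n s) by (auto; now apply (is_class_tupleE fF fS)).
  apply (large_tuple_at fF (fun M r => rel_holds M R r) n s Hs).
Qed.

Lemma ultraproduct_fun F n s : fun_symbol L F n -> is_product_tuple I Ms n s ->
  in_product I Ms (lam I (fun i => fval (ap Ms i) F (lam n (fun k => ap (ap s k) i))))
    /\
  fval N F (lam n (fun k => cl (ap s k))) =
  cl (lam I (fun i => fval (ap Ms i) F (lam n (fun k => ap (ap s k) i)))).
Proof.
  intros HF Hs. set (g := lam I _).
  assert (Hv : forall i, i ∈ I -> ap g i = fval (ap Ms i) F (lam n (fun k => ap (ap s
    k) i))).
  { intros i Hi. unfold g. rewrite ap_lam; [auto|dfn|auto]. }
  assert (Hg : in_product I Ms g).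
  { apply (in_productE fF fS). split; [apply lam_fn; dfn|]. intros i Hi.
    rewrite Hv by auto.
    apply (fun_valueE (family_structure i Hi) F n); auto. now apply tuple_at_maps. }
  split; auto. symmetry.
  apply (fun_valueE hN' F n); auto using ultraproduct_tuple.
  destruct hN as (_ & _ & _ & H).
  apply (H F n s _ g); auto.
  - now apply (is_class_tupleE fF fS).
  - now apply (is_classE fF fS).
  - apply large_all; auto. intros i Hi.
    exists (ap Ms i), (lam n (fun k => ap (ap s k) i)), (ap g i).
    split; [apply (fn_pair_mem Ms I _ _ fF); auto|].
    split; [now apply (is_tuple_atE (Ms := Ms))|].
    split; [|destruct Hg as [Hg _]; apply (fn_pair_mem g I _ _ Hg); auto].
    apply (fun_valueE (family_structure i Hi) F n); auto. now apply tuple_at_maps.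
Qed.

Section TermLos.
Context {D s : V} (hD : subset D omega) (hs : is_product_tuple I Ms D s).

Let coord t := lam I (fun i => tv L (ap Ms i) D (lam D (fun k => ap (ap s k) i)) t).

Lemma coord_ap t i : i ∈ I ->
  ap (coord t) i = tv L (ap Ms i) D (lam D (fun k => ap (ap s k) i)) t.
Proof. intro Hi. unfold coord. rewrite ap_lam; [auto|dfn|auto]. Qed.

Lemma coord_in_product t : is_term L D t -> in_product I Ms (coord t).
Proof.
  intro Ht. apply (in_productE fF fS). split; [apply lam_fn; dfn|].
  intros i Hi. rewrite coord_ap by auto.
  apply (tv_in hL (family_structure i Hi)); auto. now apply tuple_at_maps.
Qed.

Lemma Los_term t : is_term L D t ->
  tv L N D (lam D (fun k => cl (ap s k))) t = cl (coord t).
Proof.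
  pose proof (ultraproduct_tuple D s hs) as Hq. revert t. apply term_ind; auto.
  - unfold coord. dfn.
  - intros k Hk. rewrite (tv_var hL hN') by auto. rewrite ap_lam; [|dfn|auto].
    f_equal. destruct (proj1 (is_product_tupleE D s) hs) as [Hs Ks].
    apply (fn_ext _ _ I).
    + apply Ks. auto.
    + apply (coord_in_product (tVar k)). now apply term_var.
    + intros i Hi. rewrite coord_ap by auto.
      rewrite (tv_var hL (family_structure i Hi)); auto using tuple_at_maps.
      rewrite ap_lam; [auto|dfn|auto].
  - intros F n u HF Hu IH. rewrite (tv_app hL hN' hD Hq F n u) by auto.
    pose proof Hu as Hu'. apply is_term_tupleE in Hu'. destruct Hu' as [Hu1 Hu2].
    set (v := lam n (fun k => coord (ap u k))).
    assert (Dv : dterm (fun r : env => coord (ap u (r 0)))) by (unfold coord; dfn).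
    assert (Hv : is_product_tuple I Ms n v).
    { apply is_product_tupleE. split; [now apply lam_fn|]. intros k Hk. unfold v.
      rewrite ap_lam by auto. apply coord_in_product. auto. }
    destruct (ultraproduct_fun F n v HF Hv) as [Hg E].
    transitivity (fval N F (lam n (fun k => cl (ap v k)))).
    { f_equal. apply lam_ext; [dfn|dfn|]. intros k Hk. rewrite IH by auto.
      unfold v. rewrite ap_lam by auto. auto. }
    rewrite E. f_equal. apply lam_ext; [dfn|dfn|]. intros i Hi.
    rewrite (tv_app hL (family_structure i Hi) hD (tuple_at_maps D s i hs Hi) F n u) by
      auto.
    f_equal. apply lam_ext; [dfn|dfn|]. intros k Hk.
    unfold v. rewrite ap_lam by auto. apply coord_ap. auto.
Qed.
End TermLos.
End Ultraproducts.

(** * Łoś's theorem from choice on large sets *)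

Section Los.
Context {V : membership_structure} {hV : ZF V}.
Notation env := (nat -> V).
Context {I U : V} (hU : is_ultrafilter I U).

(** Choosing on a set of [U] is enough for ultraproducts, since a class [[f]] depends only on the
    values of [f] on such a set. *)
Definition ultra_choice (I U : V) : Prop :=
  forall Fam, is_function Fam I -> (forall i, i ∈ I -> nonempty (ap Fam i)) ->
  exists X c, X ∈ U /\ is_function c X /\ forall i, i ∈ X -> ap c i ∈ ap Fam i.

Context {L : V} (hL : is_language L) {Ms : V} (hMs : is_family L I Ms)
  {N : V} (hN : is_ultraproduct L I U Ms N).
Notation fF := (family_function hMs).
Notation fS := (family_structures hMs).
Notation hN' := (ultraproduct_structure hN).
Notation cl := (cl I U Ms).

Lemma large_choice (hC : ultra_choice I U) f0 (Q : V -> V -> Prop) :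
  in_product I Ms f0 -> dfn (fun r : env => Q (r 0) (r 1)) ->
  (large I U (fun i => exists x, x ∈ uni (ap Ms i) /\ Q i x) <->
   exists g, in_product I Ms g /\ large I U (fun i => Q i (ap g i))).
Proof.
  intros H0 DQ. apply (in_productE fF fS) in H0. destruct H0 as [F0 V0]. split.
  - intro H.
    (* At an index without a witness the implication admits the whole universe, so every member of
       the family is nonempty, as [ultra_choice] requires. *)
    set (Fam := lam I (fun i => sep (uni (ap Ms i)) (fun x =>
      (exists y, y ∈ uni (ap Ms i) /\ Q i y) -> Q i x))).
    assert (EFam : forall i, i ∈ I -> ap Fam i = sep (uni (ap Ms i)) (fun x =>
      (exists y, y ∈ uni (ap Ms i) /\ Q i y) -> Q i x)).
    { intros i Hi. unfold Fam. rewrite ap_lam; [auto|dfn|auto]. }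
    destruct (hC Fam) as (X & c & HX & Hc & Kc).
    { unfold Fam. apply lam_fn. dfn. }
    { intros i Hi. rewrite EFam by auto.
      destruct (classic (exists y, y ∈ uni (ap Ms i) /\ Q i y)) as [(y & Hy & Ky)|N0].
      - exists y. rewrite in_sep by dfn. auto.
      - exists (ap f0 i). rewrite in_sep by dfn. split; [auto|tauto]. }
    assert (XI : forall i, i ∈ X -> i ∈ I) by (apply hU; auto).
    (* The choice function is defined on [X] only; [f0] extends it to an element of the full
       product. *)
    set (G := fun i => the (fun y => i ∈ X /\ y = ap c i \/ ~ i ∈ X /\ y = ap f0 i)).
    assert (DG : dterm (fun r : env => G (r 0))) by (unfold G; dfn).
    assert (G1 : forall i, i ∈ X -> G i = ap c i).
    { intros i Hi. apply the_eq; [auto|]. intros z [[_ E]|[E _]]; tauto. }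
    assert (G2 : forall i, ~ i ∈ X -> G i = ap f0 i).
    { intros i Hi. apply the_eq; [auto|]. intros z [[E _]|[_ E]]; tauto. }
    exists (lam I G). split.
    + apply (in_productE fF fS). split; [now apply lam_fn|]. intros i Hi.
      rewrite ap_lam by auto.
      destruct (classic (i ∈ X)) as [K|K]; [|rewrite G2; auto].
      rewrite G1 by auto. specialize (Kc i K). rewrite EFam in Kc by auto.
      rewrite in_sep in Kc by dfn. apply Kc.
    + eapply large_mono; [exact hU | dfn | |].
      * apply (large_and hU _ (fun i => i ∈ X) H). exists X. split; auto.
        intro i. split; [auto|tauto].
      * intros i Hi [K Ki]. rewrite ap_lam by auto. rewrite G1 by auto.
        specialize (Kc i Ki). rewrite EFam in Kc by auto. rewrite in_sep in Kc by dfn.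
        now apply Kc.
  - intros (g & Hg & H). apply (in_productE fF fS) in Hg. destruct Hg as [Hg Vg].
    eapply large_mono; [exact hU | dfn | exact H |].
    intros i Hi K. exists (ap g i). auto.
Qed.

(** Stated for tuples indexed by an arbitrary set [D] of variables and not only by a numeral,
    because the existential case passes from [D] to [adj D k]. *)
Lemma Los_formula (hC : ultra_choice I U) f0 (H0 : in_product I Ms f0) D p :
  is_formula L D p -> forall s, is_product_tuple I Ms D s ->
  (satisfies L N p (lam D (fun k => cl (ap s k))) <->
   large I U (fun i => satisfies L (ap Ms i) p (lam D (fun k => ap (ap s k) i)))).
Proof.
  revert D p. apply (formula_ind hL (fun D p => forall s, is_product_tuple I Ms D s ->
    (satisfies L N p (lam D (fun k => cl (ap s k))) <->
     large I U (fun i => satisfies L (ap Ms i) p (lam D (fun k => ap (ap s k) i)))))).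
  - dfn.
  - intros D t u HD Ht Hu s Hs.
    pose proof (ultraproduct_tuple hMs hN D s Hs) as Hq.
    destruct (satisfies_tarski hL hN' D _ HD Hq) as (-> & _); auto.
    rewrite !(Los_term hU hL hMs hN HD Hs) by auto.
    rewrite (cl_eq hU fF fS) by (apply (coord_in_product hL hMs HD Hs); auto).
    apply large_ext. intros i Hi.
    rewrite !(coord_ap (D := D) (s := s)) by auto. symmetry.
    apply (satisfies_tarski hL (family_structure hMs i Hi) D); auto.
    now apply (tuple_at_maps hMs).
  - intros D R n u HD HR Hu s Hs.
    pose proof (ultraproduct_tuple hMs hN D s Hs) as Hq.
    destruct (satisfies_tarski hL hN' D _ HD Hq) as (_ & H & _).
    rewrite (H R n) by auto. clear H.
    pose proof Hu as Hu'. apply is_term_tupleE in Hu'. destruct Hu' as [Hu1 Hu2].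
    set (coord := fun t => lam I (fun i => tv L (ap Ms i) D (lam D (fun k => ap (ap s
      k) i)) t)).
    set (v := lam n (fun k => coord (ap u k))).
    assert (Dv : dterm (fun r : env => coord (ap u (r 0)))) by (unfold coord; dfn).
    assert (Ev : forall k, k ∈ n -> ap v k = coord (ap u k)).
    { intros k Hk. unfold v. now rewrite ap_lam. }
    assert (Hv : is_product_tuple I Ms n v).
    { apply is_product_tupleE. split; [now apply lam_fn|]. intros k Hk.
      rewrite Ev by auto.
      apply (coord_in_product hL hMs HD Hs). auto. }
    assert (E : lam n (fun k => tv L N D (lam D (fun k => cl (ap s k))) (ap u k)) =
      lam n (fun k => cl (ap v k))).
    { apply lam_ext; [dfn|dfn|]. intros k Hk. rewrite Ev by auto.
      apply (Los_term hU hL hMs hN HD Hs). auto. }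
    rewrite E, (ultraproduct_rel hMs hN R n v) by auto.
    apply large_ext. intros i Hi.
    destruct (satisfies_tarski hL (family_structure hMs i Hi) D _ HD
      (tuple_at_maps hMs D s i Hs Hi)) as (_ & H & _).
    rewrite (H R n) by auto.
    assert (E' : lam n (fun k => ap (ap v k) i) =
      lam n (fun k => tv L (ap Ms i) D (lam D (fun k => ap (ap s k) i)) (ap u k))).
    { apply lam_ext; [dfn|dfn|]. intros k Hk. rewrite Ev by auto.
      apply (coord_ap (D := D) (s := s)). auto. }
    now rewrite E'.
  - intros D p HD Hp IH s Hs.
    pose proof (ultraproduct_tuple hMs hN D s Hs) as Hq.
    destruct (satisfies_tarski hL hN' D _ HD Hq) as (_ & _ & -> & _); auto.
    rewrite IH, <- (large_not hU) by (auto; dfn). apply large_ext. intros i Hi.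
    destruct (satisfies_tarski hL (family_structure hMs i Hi) D _ HD
      (tuple_at_maps hMs D s i Hs Hi)) as (_ & _ & -> & _); tauto.
  - intros D p p' HD Hp Hp' IH IH' s Hs.
    pose proof (ultraproduct_tuple hMs hN D s Hs) as Hq.
    destruct (satisfies_tarski hL hN' D _ HD Hq) as (_ & _ & _ & -> & _); auto.
    rewrite IH, IH' by auto.
    assert (K : forall i, i ∈ I -> (satisfies L (ap Ms i) (pAnd p p') (lam D (fun k =>
      ap (ap s k) i)) <->
      satisfies L (ap Ms i) p (lam D (fun k => ap (ap s k) i)) /\
      satisfies L (ap Ms i) p' (lam D (fun k => ap (ap s k) i)))).
    { intros i Hi. apply (satisfies_tarski hL (family_structure hMs i Hi) D _ HD
        (tuple_at_maps hMs D s i Hs Hi)); auto. }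
    rewrite (large_ext _ _ K). split.
    + intros [H1 H2]. now apply (large_and hU).
    + intro H. split; (eapply large_mono; [exact hU | dfn | exact H |]); cbv beta;
        tauto.
  - intros D k p HD Hk Hp IH s Hs.
    pose proof (ultraproduct_tuple hMs hN D s Hs) as Hq.
    destruct (satisfies_tarski hL hN' D _ HD Hq) as (_ & _ & _ & _ & ->); auto.
    pose proof Hs as Hs'. apply is_product_tupleE in Hs'. destruct Hs' as [Hs1 Hs2].
    assert (Hupd : forall g, in_product I Ms g -> is_product_tuple I Ms (adj D k) (upd
      D s k g)).
    (* With the product available as a set [P], a product tuple is a map into [P] and [upd_maps]
       applies. *)
    { intros g Hg. destruct (product_set_exists fF fS) as [P HP].
      assert (M : maps (upd D s k g) (adj D k) P).
      { apply upd_maps; [|now apply HP]. apply mapsE. split; auto. intros j Hj.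
        apply HP. auto. }
      apply mapsE in M. destruct M as [M1 M2]. apply is_product_tupleE. split; auto.
      intros j Hj. apply HP. auto. }
    assert (Eat : forall g i, lam (adj D k) (fun j => ap (ap (upd D s k g) j) i) =
      upd D (lam D (fun j => ap (ap s j) i)) k (ap g i)).
    { intros g i. apply (upd_lam D k s g (fun f => ap f i)). dfn. }
    assert (K : forall i, i ∈ I -> (satisfies L (ap Ms i) (pEx k p) (lam D (fun k => ap
      (ap s k) i)) <->
      exists x, x ∈ uni (ap Ms i) /\
        satisfies L (ap Ms i) p (upd D (lam D (fun k => ap (ap s k) i)) k x))).
    { intros i Hi. apply (satisfies_tarski hL (family_structure hMs i Hi) D _ HD
        (tuple_at_maps hMs D s i Hs Hi)); auto. }
    rewrite (large_ext _ _ K).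
    rewrite (large_choice hC f0 (fun i x =>
      satisfies L (ap Ms i) p (upd D (lam D (fun k => ap (ap s k) i)) k x))) by (auto;
        dfn).
    split.
    + intros (c & Hc & H). apply (in_ultraproduct hMs hN) in Hc.
      destruct Hc as (g & Hg & ->).
      rewrite <- (upd_lam D k s g (fun f => cl f)) in H by dfn.
      apply IH in H; auto. exists g. split; auto. revert H. apply large_ext.
      intros i Hi.
      now rewrite Eat.
    + intros (g & Hg & H). exists (cl g). split.
      * apply (in_ultraproduct hMs hN). eauto.
      * rewrite <- (upd_lam D k s g (fun f => cl f)) by dfn. apply IH; auto.
        revert H. apply large_ext. intros i Hi. now rewrite Eat.
Qed.

Lemma Los_equivalence_of_choice (hC : ultra_choice I U) f0 :
  in_product I Ms f0 -> Los_equivalence L I U Ms N.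
Proof.
  intros H0 w n m p s q Hw Hn Hm Hp Hs Hq.
  apply (is_class_tupleE fF fS) in Hq; auto. subst q.
  rewrite (Los_formula hC f0 H0 m p Hp s Hs). symmetry.
  apply (large_tuple_at fF (fun M r => satisfies L M p r) m s Hs).
Qed.
End Los.

(** * Back-and-forth for a binary relation *)

Section BinaryLanguage.
Context {V : membership_structure} {hV : ZF V}.
Notation env := (nat -> V).

(** Relations of a structure consist of tuples, that is, functions on [num 2], and not of the
    Kuratowski pairs [opair]. *)
Definition pr : V -> V -> V :=
  proj1_sig (seal (fun x y : V =>
    lam (num 2) (fun k => the (fun z => k = num 0 /\ z = x \/ k <> num 0 /\ z = y)))).

Lemma dterm_pr f g : dterm f -> dterm g -> dterm (fun r : env => pr (f r) (g r)).
Proof. unseal pr. dfn. Qed.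

Lemma in_num2 k : k ∈ num 2 <-> k = num 0 \/ k = num 1.
Proof.
  simpl. rewrite !in_succ. split; [intros [[H|H]|H]; auto; now apply in_emp in H |
    tauto].
Qed.

Lemma num_1_neq_0 : num 1 <> num 0 :> V.
Proof. intro E. now apply num_inj in E. Qed.

Lemma pr_fn x y : is_function (pr x y) (num 2).
Proof. unseal pr. apply lam_fn. dfn. Qed.

Lemma pr_0 x y : ap (pr x y) (num 0) = x.
Proof.
  unseal pr. rewrite ap_lam; [|dfn|apply in_num2; auto].
  apply the_eq; [auto|]. intros z [[_ E]|[E _]]; tauto.
Qed.

Lemma pr_1 x y : ap (pr x y) (num 1) = y.
Proof.
  pose proof num_1_neq_0. unseal pr. rewrite ap_lam; [|dfn|apply in_num2; auto].
  apply the_eq; [auto|]. intros z [[E _]|[_ E]]; tauto.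
Qed.

Lemma pr_eta s : is_function s (num 2) -> s = pr (ap s (num 0)) (ap s (num 1)).
Proof.
  intro Hs. apply (fn_ext _ _ (num 2)); auto using pr_fn.
  intros k Hk. apply in_num2 in Hk. destruct Hk as [->| ->]; now rewrite ?pr_0, ?pr_1.
Qed.

Lemma lam_pr F : dterm (fun r : env => F (r 0)) ->
  lam (num 2) F = pr (F (num 0)) (F (num 1)).
Proof.
  intro DF. rewrite (pr_eta (lam (num 2) F)) by now apply lam_fn.
  rewrite !ap_lam; auto; apply in_num2; auto.
Qed.

Lemma pr_maps x y A : x ∈ A -> y ∈ A -> maps (pr x y) (num 2) A.
Proof.
  intros Hx Hy. apply mapsE. split; [apply pr_fn|]. intros k Hk. apply in_num2 in Hk.
  destruct Hk as [->| ->]; now rewrite ?pr_0, ?pr_1.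
Qed.

(** One binary relation symbol, which is [∅]. *)
Definition L0 : V := opair (lam (upair emp emp) (fun _ => num 2)) emp.

Lemma emp_function : is_function emp (emp : V).
Proof. split; intros x Hx; now apply in_emp in Hx. Qed.

Lemma L0_rel R n : rel_symbol L0 R n <-> R = emp /\ n = num 2.
Proof.
  unfold rel_symbol, L0. setoid_rewrite is_opairE. split.
  - intros (a & b & E & H). apply opair_inj in E. destruct E. subst a b.
    apply (fn_pair_mem _ (upair emp emp)) in H; [|apply lam_fn; dfn].
    destruct H as [H ->].
    rewrite ap_lam by (dfn; auto). apply in_upair in H. tauto.
  - intros [-> ->]. eexists _, _. split; [reflexivity|].
    assert (K : emp ∈ upair emp emp :> Prop) by (apply in_upair; auto).
    apply (fn_pair_mem _ (upair emp emp)); [apply lam_fn; dfn|]. split; auto.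
    rewrite ap_lam; [auto|dfn|auto].
Qed.

Lemma L0_fun F n : ~ fun_symbol L0 F n.
Proof.
  intros (a & b & E & H). apply is_opairE in E. apply opair_inj in E. destruct E.
  subst a b.
  apply opair_memE in H. now apply in_emp in H.
Qed.

Lemma L0_language : is_language L0.
Proof.
  exists (lam (upair emp emp) (fun _ => num 2)), emp, (upair emp emp), emp, omega.
  split; [now apply is_omegaE|]. split; [now apply is_opairE|]. split; [|split].
  - apply lam_maps; [dfn|]. intros. apply omega_num.
  - apply mapsE. split; [apply emp_function|]. intros x Hx. now apply in_emp in Hx.
  - intros R n H. assert (K : rel_symbol L0 R n).
    { eexists _, _. split; [now apply is_opairE|eassumption]. }
    apply L0_rel in K. destruct K as [_ ->]. exists (num 0). apply in_num2. auto.
Qed.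

Definition binary_structure (A r : V) : V := opair A (opair (lam (upair emp emp) (fun _
  => r)) emp).

Lemma binary_structure_structure A r : nonempty A -> (forall s, s ∈ r -> maps s (num 2)
  A) ->
  is_structure L0 (binary_structure A r).
Proof.
  intros HA Hr.
  exists A, (lam (upair emp emp) (fun _ => r)), emp, (upair emp emp), emp.
  split; [now apply is_otripleE|]. split; [auto|]. setoid_rewrite L0_rel.
  split; [|split; [|split; [|split; [|split]]]].
  - intro R. rewrite in_upair. split; [intros [->| ->]; eauto | intros (n & -> & _);
      auto].
  - intro F. split; [intro H; now apply in_emp in H|]. intros (n & H).
    now apply L0_fun in H.
  - apply lam_fn. dfn.
  - apply emp_function.
  - intros R n q [-> ->] H. apply (fn_pair_mem _ (upair emp emp)) in H; [|apply lam_fn;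
      dfn].
    destruct H as [H ->]. rewrite ap_lam; [auto|dfn|auto].
  - intros F n f H. now apply L0_fun in H.
Qed.

Lemma binary_structure_rel A r s : rel_holds (binary_structure A r) emp s <-> s ∈ r.
Proof.
  unfold rel_holds, binary_structure. setoid_rewrite is_otripleE.
  assert (K : emp ∈ upair emp (emp : V)) by (apply in_upair; auto). split.
  - intros (A' & i & j & q & E & H & Hs). codes.
    apply (fn_pair_mem _ (upair emp emp)) in H; [|apply lam_fn; dfn].
    destruct H as [H ->]. rewrite ap_lam in Hs; [auto|dfn|auto].
  - intro H. eexists _, _, _, r. split; [reflexivity|]. split; auto.
    apply (fn_pair_mem _ (upair emp emp)); [apply lam_fn; dfn|]. split; auto.
    rewrite ap_lam; [auto|dfn|auto].
Qed.

Lemma binary_structure_uni A r : is_structure L0 (binary_structure A r) -> uni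
  (binary_structure A r) = A.
Proof.
  intro H. symmetry. apply (universeE H). eexists _, _. now apply is_otripleE.
Qed.

Lemma L0_term D t : subset D omega -> (is_term L0 D t <-> exists k, k ∈ D /\ t = tVar
  k).
Proof.
  intro HD. split.
  - revert t. apply (term_ind L0_language D HD); [dfn|eauto|].
    intros F n s H. now apply L0_fun in H.
  - intros (k & Hk & ->). now apply term_var.
Qed.

Definition Rel (M x y : V) : Prop := rel_holds M emp (pr x y).
End BinaryLanguage.

Ltac dfn_hook_binary :=
  match goal with
  | |- dterm (fun r => pr _ _) => simple apply dterm_pr
  | |- dfn (fun r => Rel _ _ _) => unfold Rel
  end.
Ltac dfn_hook ::= first
  [ dfn_hook_the | dfn_hook_sets | dfn_hook_comprehension | dfn_hook_functions
  | dfn_hook_codes | dfn_hook_syntax | dfn_hook_semantics | dfn_hook_ultraproducts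
  | dfn_hook_binary ].

(** * Rich structures and their elementary equivalence *)

Section BackAndForth.
Context {V : membership_structure} {hV : ZF V}.
Notation env := (nat -> V).

Section RichStructures.
Variable M : V.

(** [Rel M z x] is meant to say that [z] is marked and lies in the class of [x], so a common
    predecessor witnesses equality of classes. Reflexivity, required in [rich], then provides a
    marked point in every class. *)
Definition similar (x y : V) : Prop := exists z, z ∈ uni M /\ Rel M z x /\ Rel M z y.

Definition marked (x : V) : Prop := Rel M x x.

Definition full (x : V) : Prop := exists y, y ∈ uni M /\ similar x y /\ ~ marked y.

(** The type of a point is determined by whether it is [marked], and by whether
    its class for [similar] is [full], that is, has unmarked points.  Every
    class has infinitely many points of each type that occurs in it. *)
Record rich : Prop := {
  rich_refl : forall x, x ∈ uni M -> similar x x;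
  rich_trans : forall x y z, x ∈ uni M -> y ∈ uni M -> z ∈ uni M ->
    similar x y -> similar y z -> similar x z;
  rich_rel : forall x y, x ∈ uni M -> y ∈ uni M -> (Rel M x y <-> marked x /\ similar x
    y);
  rich_class : forall x, x ∈ uni M -> exists f, is_function f omega /\
    (forall n, n ∈ omega -> ap f n ∈ uni M /\ similar x (ap f n) /\
      (marked (ap f n) <-> marked x)) /\
    (forall n m, n ∈ omega -> m ∈ omega -> ap f n = ap f m -> n = m);
  rich_full : exists f, is_function f omega /\
    (forall n, n ∈ omega -> ap f n ∈ uni M /\ full (ap f n)) /\
    (forall n m, n ∈ omega -> m ∈ omega -> similar (ap f n) (ap f m) -> n = m);
  rich_empty : exists f, is_function f omega /\
    (forall n, n ∈ omega -> ap f n ∈ uni M /\ ~ full (ap f n)) /\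
    (forall n m, n ∈ omega -> m ∈ omega -> similar (ap f n) (ap f m) -> n = m)
}.

Lemma similar_sym x y : similar x y -> similar y x.
Proof. intros (z & Hz & H1 & H2). exists z. auto. Qed.

Hypothesis hM : rich.

Lemma full_similar x y : x ∈ uni M -> y ∈ uni M -> similar x y -> full x -> full y.
Proof.
  intros Hx Hy H (z & Hz & K & N). exists z. split; auto. split; auto.
  apply (rich_trans hM y x z); auto using similar_sym.
Qed.

(** Every class contains a marked point, by [rich_refl] and [rich_rel]; fullness is exactly what is
    needed for an unmarked one. *)
Lemma similar_with_mark x (P : Prop) : x ∈ uni M -> (~ P -> full x) ->
  exists y, y ∈ uni M /\ similar x y /\ (marked y <-> P).
Proof.
  intros Hx H. destruct (classic P) as [p|p].
  - destruct (rich_refl hM x Hx) as (z & Hz & K & _). apply (rich_rel hM) in K; auto.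
    destruct K. exists z. split; auto. split; [now apply similar_sym|tauto].
  - destruct (H p) as (y & Hy & K & N). exists y. tauto.
Qed.
End RichStructures.

(** Each [j] excludes at most one number, and [D] is bounded by an element of [omega], so all
    excluded numbers lie below some [b]. Then [b] itself is free. *)
Lemma fresh (Q : V -> V -> Prop) D m : dfn (fun r : env => Q (r 0) (r 1)) ->
  m ∈ omega -> subset D m ->
  (forall j n n', n ∈ omega -> n' ∈ omega -> Q j n -> Q j n' -> n = n') ->
  exists n, n ∈ omega /\ forall j, j ∈ D -> ~ Q j n.
Proof.
  intros DQ Hm HD H.
  destruct (omega_bound (fun j b => forall n, n ∈ omega -> Q j n -> n ∈ b) m) as (b &
    Hb & K).
  - dfn.
  - intros j b b' _ _ L K n Hn Kn. apply L. auto.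
  - auto.
  - intros j Hj. destruct (classic (exists n, n ∈ omega /\ Q j n)) as [(n & Hn & Kn)|N].
    + exists (succ n). split; [now apply omega_succ|]. intros n' Hn' Kn'.
      apply in_succ. right. eauto.
    + exists emp. split; [apply omega_emp|]. intros n Hn Kn. destruct N. eauto.
  - exists b. split; auto. intros j Hj Kj. apply (not_in_self b). apply (K j); auto.
Qed.

Definition alike (M N x y : V) : Prop :=
  (marked M x <-> marked N y) /\ (full M x <-> full N y).

Definition alike2 (M N x x' y y' : V) : Prop :=
  (x = x' <-> y = y') /\ (similar M x x' <-> similar N y y').

(** Preservation of [Rel] follows by [rich_rel] from that of marks and similarity. Fullness is not
    atomic, but the extension step must know whether an unmarked partner exists. *)
Definition partial_iso (M N D a b : V) : Prop :=
  (forall j, j ∈ D -> alike M N (ap a j) (ap b j)) /\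
  (forall j l, j ∈ D -> l ∈ D -> alike2 M N (ap a j) (ap a l) (ap b j) (ap b l)).

(** The new point is matched with a copy of itself over the class of a related
    point of [a], or else over a class that [b] does not meet; [fresh] avoids
    the points already used. *)
Lemma forth M N D m a b x : rich M -> rich N -> m ∈ omega -> subset D m ->
  maps a D (uni M) -> maps b D (uni N) -> partial_iso M N D a b -> x ∈ uni M ->
  exists y, y ∈ uni N /\ alike M N x y /\
    forall j, j ∈ D -> alike2 M N x (ap a j) y (ap b j).
Proof.
  intros hM hN Hm HD Ha Hb [S1 S2] Hx. apply mapsE in Ha, Hb.
  destruct Ha as [_ Ha], Hb as [_ Hb].
  destruct (classic (exists j, j ∈ D /\ x = ap a j)) as [(j & Hj & ->)|N1].
  { exists (ap b j). split; auto. }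
  destruct (classic (exists j, j ∈ D /\ similar M x (ap a j))) as [(j & Hj & Hsim)|N2].
  - destruct (similar_with_mark N hN (ap b j) (marked M x)) as (y0 & Hy0 & K1 & K2);
      auto.
    { intro Nx. apply (S1 j Hj). exists x. split; auto. split; auto.
      now apply similar_sym. }
    destruct (rich_class N hN y0 Hy0) as (f & Hf & Kf & If).
    destruct (fresh (fun j n => ap f n = ap b j) D m) as (n & Hn & Fn); auto.
    { dfn. } { intros l n n' Hn Hn' E E'. apply If; auto. congruence. }
    destruct (Kf n Hn) as (Y1 & Y2 & Y3).
    assert (Y4 : similar N (ap b j) (ap f n)) by (apply (rich_trans N hN _ y0); auto).
    exists (ap f n). split; auto. split; [split|].
    + rewrite Y3. symmetry. exact K2.
    + split; intro F.
      * apply (full_similar N hN (ap b j)); auto. apply (S1 j Hj).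
        apply (full_similar M hM x); auto.
      * apply (full_similar M hM (ap a j)); auto; [now apply similar_sym|].
        apply (S1 j Hj).
        apply (full_similar N hN (ap f n)); auto. now apply similar_sym.
    + intros l Hl. split.
      * split; intro E; [destruct N1; eauto | now destruct (Fn l Hl)].
      * destruct (S2 j l Hj Hl) as [_ E]. split; intro F.
        -- apply (rich_trans N hN _ (ap b j)); auto using similar_sym. apply E.
           apply (rich_trans M hM _ x); auto using similar_sym.
        -- apply (rich_trans M hM _ (ap a j)); auto. apply E.
           apply (rich_trans N hN _ (ap f n)); auto.
  - assert (C : exists c, c ∈ uni N /\ (full M x <-> full N c) /\
      forall j, j ∈ D -> ~ similar N c (ap b j)).
    { assert (C' : exists f, is_function f omega /\
        (forall n, n ∈ omega -> ap f n ∈ uni N /\ (full M x <-> full N (ap f n))) /\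
        (forall n m, n ∈ omega -> m ∈ omega -> similar N (ap f n) (ap f m) -> n = m)).
      { destruct (classic (full M x)) as [F|F].
        - destruct (rich_full N hN) as (f & Hf & Kf & If). exists f. split; auto.
          split; auto.
          intros n Hn. destruct (Kf n Hn). tauto.
        - destruct (rich_empty N hN) as (f & Hf & Kf & If). exists f. split; auto.
          split; auto.
          intros n Hn. destruct (Kf n Hn). tauto. }
      destruct C' as (f & Hf & Kf & If).
      (* [fresh] asks for uniqueness at every [j], and transitivity of similarity needs [ap b j] in
         the universe; hence [j ∈ D] is part of the relation. *)
      destruct (fresh (fun j n => j ∈ D /\ similar N (ap f n) (ap b j)) D m) as (n & Hn
        & Fn); auto.
      { unfold similar. dfn. }
      { intros l n n' Hn Hn' [Hl E] [_ E']. apply If; auto.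
        apply (rich_trans N hN _ (ap b l)); auto using similar_sym; now apply Kf. }
      exists (ap f n). destruct (Kf n Hn). split; auto. split; auto.
      intros j Hj E. apply (Fn j Hj). auto. }
    destruct C as (c & Hc & Fc & Sc).
    destruct (similar_with_mark N hN c (marked M x)) as (y & Hy & K1 & K2); auto.
    { intro Nx. apply Fc. exists x. split; auto. split; auto.
      now apply (rich_refl M hM). }
    exists y. split; auto. split; [split|].
    + symmetry. exact K2.
    + rewrite Fc. split; [apply (full_similar N hN c y)|apply (full_similar N hN y c)];
        auto using similar_sym.
    + intros j Hj.
      assert (NS : ~ similar N y (ap b j)).
      { intro E. apply (Sc j Hj). apply (rich_trans N hN _ y); auto. }
      split; split; intro E.
      * destruct N1. eauto.
      * destruct NS. rewrite E. apply (rich_refl N hN). auto.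
      * destruct N2. eauto.
      * tauto.
Qed.

Lemma alike_sym M N x y : alike M N x y -> alike N M y x.
Proof. unfold alike. tauto. Qed.

Lemma alike2_sym M N x x' y y' : alike2 M N x x' y y' -> alike2 N M y y' x x'.
Proof. unfold alike2. tauto. Qed.

Lemma partial_iso_sym M N D a b : partial_iso M N D a b -> partial_iso N M D b a.
Proof. intros [H K]. split; intros; [apply alike_sym|apply alike2_sym]; auto. Qed.

Lemma partial_iso_upd M N D a b k x y : rich M -> rich N -> x ∈ uni M -> y ∈ uni N ->
  partial_iso M N D a b -> alike M N x y ->
  (forall j, j ∈ D -> alike2 M N x (ap a j) y (ap b j)) ->
  partial_iso M N (adj D k) (upd D a k x) (upd D b k y).
Proof.
  intros hM hN Hx Hy [S1 S2] H1 H2. split.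
  - intros j Hj. destruct (classic (j = k)) as [->|Nk]; [now rewrite !ap_upd_same|].
    apply in_adj in Hj. destruct Hj as [Hj|]; [|tauto]. rewrite !ap_upd_other; auto.
  - intros j l Hj Hl. apply in_adj in Hj, Hl.
    destruct (classic (j = k)) as [->|Nj]; destruct (classic (l = k)) as [->|Nl];
      rewrite ?ap_upd_same.
    + split; [tauto|]. split; intros _; now apply rich_refl.
    + destruct Hl as [Hl|]; [|tauto]. rewrite !ap_upd_other; auto.
    + destruct Hj as [Hj|]; [|tauto]. rewrite !ap_upd_other; auto.
      destruct (H2 j Hj) as [E1 E2]. split.
      * split; intro E; symmetry; apply E1; auto.
      * split; intro E; apply similar_sym, E2, similar_sym, E.
    + destruct Hj as [Hj|]; [|tauto]. destruct Hl as [Hl|]; [|tauto].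
      rewrite !ap_upd_other; auto.
Qed.

(** Formula induction only provides [D ⊆ ω], and such a [D] may be infinite, whereas [forth] needs
    finitely many points in use. The bound [m] is therefore carried through the induction and
    raised, if necessary, at each quantifier. *)
Lemma rich_equivalent M N : is_structure L0 M -> is_structure L0 N -> rich M -> rich N
  ->
  forall D p, is_formula L0 D p -> forall m a b, m ∈ omega -> subset D m ->
  maps a D (uni M) -> maps b D (uni N) -> partial_iso M N D a b ->
  (satisfies L0 M p a <-> satisfies L0 N p b).
Proof.
  intros SM SN hM hN.
  pose proof (satisfies_tarski L0_language SM) as TM.
  pose proof (satisfies_tarski L0_language SN) as TN.
  apply (formula_ind L0_language (fun D p => forall m a b, m ∈ omega -> subset D m ->
    maps a D (uni M) -> maps b D (uni N) -> partial_iso M N D a b ->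
    (satisfies L0 M p a <-> satisfies L0 N p b))).
  - unfold partial_iso, alike, alike2, full, marked, similar. dfn.
  - intros D t u HD Ht Hu m a b Hm HDm Ha Hb S.
    destruct (TM D a HD Ha) as (-> & _); auto.
    destruct (TN D b HD Hb) as (-> & _); auto.
    apply L0_term in Ht, Hu; auto. destruct Ht as (j & Hj & ->), Hu as (l & Hl & ->).
    rewrite !(tv_var L0_language SM HD Ha), !(tv_var L0_language SN HD Hb) by auto.
    now apply S.
  - intros D R n s HD HR Hs m a b Hm HDm Ha Hb S.
    destruct (TM D a HD Ha) as (_ & K & _). rewrite (K R n) by auto. clear K.
    destruct (TN D b HD Hb) as (_ & K & _). rewrite (K R n) by auto. clear K.
    apply L0_rel in HR. destruct HR as [-> ->].
    apply is_term_tupleE in Hs. destruct Hs as [Hs Kt].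
    assert (T0 := Kt (num 0) (proj2 (in_num2 _) (or_introl eq_refl))).
    assert (T1 := Kt (num 1) (proj2 (in_num2 _) (or_intror eq_refl))).
    rewrite !lam_pr by dfn.
    apply L0_term in T0, T1; auto. destruct T0 as (j & Hj & ->), T1 as (l & Hl & ->).
    rewrite !(tv_var L0_language SM HD Ha), !(tv_var L0_language SN HD Hb) by auto.
    apply mapsE in Ha, Hb. destruct Ha as [_ Ha], Hb as [_ Hb].
    pose proof (rich_rel M hM (ap a j) (ap a l) (Ha j Hj) (Ha l Hl)) as E1.
    pose proof (rich_rel N hN (ap b j) (ap b l) (Hb j Hj) (Hb l Hl)) as E2.
    unfold Rel in E1, E2. rewrite E1, E2. destruct S as [S1 S2].
    destruct (S1 j Hj) as [K1 _], (S2 j l Hj Hl) as [_ K2]. now rewrite K1, K2.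
  - intros D p HD Hp IH m a b Hm HDm Ha Hb S.
    destruct (TM D a HD Ha) as (_ & _ & -> & _); auto.
    destruct (TN D b HD Hb) as (_ & _ & -> & _); auto. now rewrite (IH m a b).
  - intros D p q HD Hp Hq IHp IHq m a b Hm HDm Ha Hb S.
    destruct (TM D a HD Ha) as (_ & _ & _ & -> & _); auto.
    destruct (TN D b HD Hb) as (_ & _ & _ & -> & _); auto.
    now rewrite (IHp m a b), (IHq m a b).
  - intros D k p HD Hk Hp IH m a b Hm HDm Ha Hb S.
    destruct (TM D a HD Ha) as (_ & _ & _ & _ & ->); auto.
    destruct (TN D b HD Hb) as (_ & _ & _ & _ & ->); auto.
    assert (B : exists m', m' ∈ omega /\ subset (adj D k) m').
    { destruct (omega_total m (succ k)) as [K|K]; auto using omega_succ.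
      - exists (succ k). split; auto using omega_succ. intros j Hj. apply in_adj in Hj.
        destruct Hj as [Hj| ->]; auto. apply in_succ. auto.
      - exists m. split; auto. intros j Hj. apply in_adj in Hj.
        destruct Hj as [Hj| ->]; auto. apply K, in_succ. auto. }
    destruct B as (m' & Hm' & HB). split.
    + intros (x & Hx & K).
      destruct (forth M N D m a b x hM hN Hm HDm Ha Hb S Hx) as (y & Hy & A1 & A2).
      exists y. split; auto.
      apply (IH m' (upd D a k x) (upd D b k y)); auto using upd_maps, partial_iso_upd.
    + intros (y & Hy & K).
      destruct (forth N M D m b a y hN hM Hm HDm Hb Ha (partial_iso_sym _ _ _ _ _ S) Hy)
        as (x & Hx & A1 & A2).
      exists x. split; auto.
      apply (IH m' (upd D a k x) (upd D b k y)); auto using upd_maps.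
      apply partial_iso_upd; auto using alike_sym. intros j Hj. apply alike2_sym. auto.
Qed.

Lemma rich_elementarily_equivalent M N : is_structure L0 M -> is_structure L0 N ->
  rich M -> rich N -> elementarily_equivalent L0 M N.
Proof.
  intros SM SN hM hN p e (e' & He' & Hp) He. apply is_emptyE in He, He'. subst e e'.
  assert (K : forall A, maps emp (emp : V) A).
  { intro A. apply mapsE. split; [apply emp_function|]. intros x Hx.
    now apply in_emp in Hx. }
  apply (rich_equivalent M N SM SN hM hN emp p Hp emp); auto using omega_emp.
  - intros x Hx. auto.
  - split; intros; exfalso; eapply in_emp; eassumption.
Qed.
End BackAndForth.

(** * The structure attached to a family of nonempty sets *)

Section Projections.
Context {V : membership_structure} {hV : ZF V}.
Notation env := (nat -> V).

Definition pi1 : V -> V := proj1_sig (seal (fun p : V => the (fun x => exists y, p =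
  opair x y))).

Definition pi2 : V -> V := proj1_sig (seal (fun p : V => the (fun y => exists x, p =
  opair x y))).

Lemma pi1_opair x y : pi1 (opair x y) = x.
Proof.
  unseal pi1. apply the_eq; [eauto|]. intros z (u & E). apply opair_inj in E.
  now destruct E.
Qed.

Lemma pi2_opair x y : pi2 (opair x y) = y.
Proof.
  unseal pi2. apply the_eq; [eauto|]. intros z (u & E). apply opair_inj in E.
  now destruct E.
Qed.

Lemma dterm_pi1 f : dterm f -> dterm (fun r : env => pi1 (f r)).
Proof. unseal pi1. dfn. Qed.

Lemma dterm_pi2 f : dterm f -> dterm (fun r : env => pi2 (f r)).
Proof. unseal pi2. dfn. Qed.
End Projections.

Ltac dfn_hook_projections := first [simple apply dterm_pi1 | simple apply dterm_pi2].
Ltac dfn_hook ::= first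
  [ dfn_hook_the | dfn_hook_sets | dfn_hook_comprehension | dfn_hook_functions
  | dfn_hook_codes | dfn_hook_syntax | dfn_hook_semantics | dfn_hook_ultraproducts
  | dfn_hook_binary | dfn_hook_projections ].

(** * Constant families and ultrapowers in the language [L0] *)

Section Ultrapower.
Context {V : membership_structure} {hV : ZF V}.
Notation env := (nat -> V).
Context {I U : V} (hU : is_ultrafilter I U).

Section ConstantFamilies.
Context {L M Ms : V} (hM : is_structure L M) (hMs : is_constant_family I M Ms).

Lemma constant_ap i : i ∈ I -> ap Ms i = M.
Proof.
  destruct hMs as [F H]. intro Hi. apply (H i). now apply (fn_pair_mem Ms I).
Qed.

Lemma constant_family : is_family L I Ms.
Proof.
  destruct hMs as [F H]. split; auto. intros i N HN. now rewrite (H i N HN).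
Qed.

Lemma constant_product f : in_product I Ms f <-> maps f I (uni M).
Proof.
  rewrite (in_productE (family_function constant_family) (family_structures
    constant_family)).
  rewrite mapsE. split; intros [H K]; (split; [auto|]); intros i Hi; specialize (K i
    Hi);
    rewrite constant_ap in *; auto.
Qed.

Lemma constant_product_nonempty : exists f, in_product I Ms f.
Proof.
  destruct (uni_nonempty hM) as [x Hx]. exists (lam I (fun _ => x)).
  apply constant_product. apply lam_maps; [dfn|auto].
Qed.
End ConstantFamilies.

Lemma constant_family_exists M : exists Ms, is_constant_family I M Ms.
Proof.
  exists (lam I (fun _ => M)). assert (F : is_function (lam I (fun _ => M)) I) by
    (apply lam_fn; dfn).
  split; auto. intros i N H. apply (fn_pair_mem _ I) in H; auto. destruct H as [Hi ->].
  rewrite ap_lam; [auto|dfn|auto].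
Qed.

Section ExistenceOfUltrapower.
Context {M Ms : V} (hM : is_structure L0 M) (hMs : is_constant_family I M Ms).
Notation cl := (cl I U Ms).
Notation fF := (family_function (constant_family hM hMs)).
Notation fS := (family_structures (constant_family hM hMs)).

Lemma pr_product_tuple f g : in_product I Ms f -> in_product I Ms g ->
  is_product_tuple I Ms (num 2) (pr f g).
Proof.
  intros Hf Hg. apply is_product_tupleE. split; [apply pr_fn|]. intros k Hk.
  apply in_num2 in Hk. destruct Hk as [->| ->]; now rewrite ?pr_0, ?pr_1.
Qed.

(** [LT2] quantifies over all ultrapowers of the structure, so its refutation needs one to exist. *)
Lemma ultrapower_exists : exists N, is_ultraproduct L0 I U Ms N.
Proof.
  destruct (product_set_exists fF fS) as [P HP].
  set (A := rep P cl).
  assert (HA : forall c, c ∈ A <-> exists f, in_product I Ms f /\ c = cl f).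
  { intro c. unfold A. rewrite in_rep by dfn. setoid_rewrite HP. tauto. }
  set (r := sep (Exp (num 2) A) (fun q => exists f g, in_product I Ms f /\ in_product I
    Ms g /\
    q = pr (cl f) (cl g) /\ large I U (fun i => Rel M (ap f i) (ap g i)))).
  assert (Hr : forall f g, in_product I Ms f -> in_product I Ms g ->
    (pr (cl f) (cl g) ∈ r <-> large I U (fun i => Rel M (ap f i) (ap g i)))).
  { intros f g Hf Hg. unfold r. rewrite in_sep by dfn. split.
    - intros [_ (f' & g' & Hf' & Hg' & E & K)].
      assert (E0 : cl f = cl f') by (rewrite <- (pr_0 (cl f) (cl g)), E; apply pr_0).
      assert (E1 : cl g = cl g') by (rewrite <- (pr_1 (cl f) (cl g)), E; apply pr_1).
      apply (cl_eq hU fF fS) in E0, E1; auto.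
      eapply large_mono; [exact hU|dfn|exact (large_and hU _ _ E0 (large_and hU _ _ E1
        K))|].
      intros i _ (-> & -> & H). exact H.
    - intro K. split; [|exists f, g; auto]. apply in_Exp, pr_maps; apply HA; eauto. }
  assert (SN : is_structure L0 (binary_structure A r)).
  { apply binary_structure_structure.
    - destruct (constant_product_nonempty hM hMs) as [f Hf]. exists (cl f). apply HA.
      eauto.
    - intros s Hs. unfold r in Hs. rewrite in_sep in Hs by dfn. now apply in_Exp. }
  exists (binary_structure A r). split; auto. split; [|split].
  - intros B HB c. apply (universeE SN) in HB.
    rewrite binary_structure_uni in HB by auto. subst B.
    rewrite HA. split; intros (f & Hf & K); exists f; (split; [auto|]);
      now apply (is_classE fF fS).
  - intros R n s q HR Hs Hq. apply L0_rel in HR. destruct HR as [-> ->].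
    apply (is_class_tupleE fF fS) in Hq; auto. subst q. rewrite binary_structure_rel.
    rewrite (large_tuple_at fF (fun M r => rel_holds M emp r) (num 2) s Hs).
    rewrite lam_pr by dfn. apply is_product_tupleE in Hs. destruct Hs as [Hs Ks].
    rewrite Hr by (apply Ks, in_num2; auto). apply large_ext. intros i Hi.
    rewrite (constant_ap hMs), lam_pr by (auto; dfn). reflexivity.
  - intros F n s q g c H. now apply L0_fun in H.
Qed.
End ExistenceOfUltrapower.

Section UltrapowerRelation.
Context {M Ms N : V} (hM : is_structure L0 M) (hMs : is_constant_family I M Ms)
  (hN : is_ultraproduct L0 I U Ms N).
Notation cl := (cl I U Ms).

Lemma ultrapower_universe c : c ∈ uni N <-> exists f, maps f I (uni M) /\ c = cl f.
Proof.
  rewrite (in_ultraproduct (constant_family hM hMs) hN).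
  setoid_rewrite (constant_product hM hMs). tauto.
Qed.

Lemma ultrapower_eq f g : maps f I (uni M) -> maps g I (uni M) ->
  (cl f = cl g <-> large I U (fun i => ap f i = ap g i)).
Proof.
  intros Hf Hg. apply (cl_eq hU (family_function (constant_family hM hMs))
    (family_structures (constant_family hM hMs))); now apply (constant_product hM hMs).
Qed.

Lemma ultrapower_rel f g : maps f I (uni M) -> maps g I (uni M) ->
  (Rel N (cl f) (cl g) <-> large I U (fun i => Rel M (ap f i) (ap g i))).
Proof.
  intros Hf Hg.
  pose proof (ultraproduct_rel (constant_family hM hMs) hN emp (num 2) (pr f g)) as H.
  rewrite lam_pr, pr_0, pr_1 in H by dfn. unfold Rel at 1. rewrite H.
  - apply large_ext. intros i Hi. rewrite lam_pr, pr_0, pr_1, (constant_ap hMs) by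
      (auto; dfn).
    reflexivity.
  - now apply L0_rel.
  - apply pr_product_tuple; now apply (constant_product hM hMs).
Qed.
End UltrapowerRelation.
End Ultrapower.

Section Counterexample.
Context {V : membership_structure} {hV : ZF V}.
Notation env := (nat -> V).
Context {I Fam : V} (hI : nonempty I) (hF : is_function Fam I)
  (hne : forall i, i ∈ I -> nonempty (ap Fam i)).

(** A point is a tuple [⟨⟨c, m⟩, ⟨d, n⟩⟩], in the class [⟨c, m⟩], with [m] and
    [n] in [ω].  It is marked when [d = Mark], which by foundation is in no
    [Fam(c)]; the unmarked points are those with [c ∈ I] and [d ∈ Fam(c)].  As
    [I ∉ I], the classes with [c = I] have marked points only. *)
Definition Mark : V := Un (rep I (ap Fam)).

Definition label (x : V) : V := pi1 (pi2 x).

Definition points : V :=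
  sep (prod (prod (adj I I) omega) (prod (adj Mark Mark) omega))
    (fun x => label x = Mark \/ (pi1 (pi1 x) ∈ I /\ label x ∈ ap Fam (pi1 (pi1 x)))).

(** One binary relation codes both data: its diagonal gives the marks, and every marked point is
    related to its whole class. *)
Definition marks_class_of (x y : V) : Prop := label x = Mark /\ pi1 x = pi1 y.

Definition counterexample : V :=
  binary_structure points (sep (Exp (num 2) points)
    (fun s => marks_class_of (ap s (num 0)) (ap s (num 1)))).

Lemma in_Fam_Mark i d : i ∈ I -> d ∈ ap Fam i -> d ∈ Mark.
Proof.
  intros Hi Hd. unfold Mark. apply in_Un. exists (ap Fam i). split; auto.
  rewrite in_rep by dfn. eauto.
Qed.

Lemma in_points x : x ∈ points <-> exists c m d n, x = opair (opair c m) (opair d n) /\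
  m ∈ omega /\ n ∈ omega /\ (c ∈ I \/ c = I) /\ (d = Mark \/ c ∈ I /\ d ∈ ap Fam c).
Proof.
  unfold points, label. rewrite in_sep by dfn. rewrite in_prod. split.
  - intros [(u & v & Hu & Hv & ->) H]. apply in_prod in Hu, Hv.
    destruct Hu as (c & m & Hc & Hm & ->), Hv as (d & n & Hd & Hn & ->).
    rewrite !pi2_opair, !pi1_opair in H. apply in_adj in Hc. exists c, m, d, n. auto.
  - intros (c & m & d & n & -> & Hm & Hn & Hc & Hd). rewrite !pi2_opair, !pi1_opair.
    split; [|tauto]. exists (opair c m), (opair d n). rewrite !opair_in_prod, !in_adj.
    split; auto. split; auto. split; auto.
    destruct Hd as [->|[Hc' Hd]]; [auto|]. left. now apply (in_Fam_Mark c).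
Qed.

(** Moves a point within its class. Changing only [n] yields infinitely many points of the same
    type; the label [Mark] yields the common predecessor required by [similar]. *)
Definition relabel (x d n : V) : V := opair (pi1 x) (opair d n).

Lemma pi1_relabel x d n : pi1 (relabel x d n) = pi1 x.
Proof. apply pi1_opair. Qed.

Lemma label_relabel x d n : label (relabel x d n) = d.
Proof. unfold label, relabel. now rewrite pi2_opair, pi1_opair. Qed.

Lemma relabel_inj x d n n' : relabel x d n = relabel x d n' -> n = n'.
Proof. intro E. apply opair_inj in E. destruct E as [_ E]. apply opair_inj in E.
now destruct E. Qed.

Lemma relabel_points x n : x ∈ points -> n ∈ omega -> relabel x (label x) n ∈ points.
Proof.
  intros Hx Hn. apply in_points in Hx. destruct Hx as (c & m & d & n' & -> & Hm & _ &
    Hc & Hd).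
  unfold relabel, label. rewrite pi1_opair, pi2_opair, pi1_opair. apply in_points.
  exists c, m, d, n. auto.
Qed.

Lemma mark_points x : x ∈ points -> relabel x Mark emp ∈ points.
Proof.
  intros Hx. apply in_points in Hx. destruct Hx as (c & m & d & n' & -> & Hm & _ & Hc &
    Hd).
  unfold relabel. rewrite pi1_opair. apply in_points.
  exists c, m, Mark, emp. auto 8 using omega_emp.
Qed.

Definition point (c m d : V) : V := opair (opair c m) (opair d emp).

Lemma point_points c m : c ∈ I \/ c = I -> m ∈ omega -> point c m Mark ∈ points.
Proof. intros Hc Hm. apply in_points. exists c, m, Mark, emp. auto 8 using omega_emp.
Qed.

Lemma unmarked_point_points c m d : c ∈ I -> m ∈ omega -> d ∈ ap Fam c -> point c m d ∈
  points.
Proof. intros Hc Hm Hd. apply in_points. exists c, m, d, emp. auto 8 using omega_emp.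
Qed.

Lemma pi1_point c m d : pi1 (point c m d) = opair c m.
Proof. apply pi1_opair. Qed.

Lemma label_point c m d : label (point c m d) = d.
Proof. unfold label, point. now rewrite pi2_opair, pi1_opair. Qed.

Lemma counterexample_structure : is_structure L0 counterexample.
Proof.
  apply binary_structure_structure.
  - destruct hI as [i Hi]. exists (point i emp Mark).
    apply point_points; auto using omega_emp.
  - intros s Hs. rewrite in_sep in Hs by (unfold marks_class_of, label; dfn).
    now apply in_Exp.
Qed.

Lemma counterexample_uni : uni counterexample = points.
Proof. apply binary_structure_uni, counterexample_structure. Qed.

Lemma counterexample_rel x y : x ∈ points -> y ∈ points -> (Rel counterexample x y <->
  marks_class_of x y).
Proof.
  intros Hx Hy. unfold Rel, counterexample.
  rewrite binary_structure_rel, in_sep by (unfold marks_class_of, label; dfn).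
  rewrite pr_0, pr_1. split; [tauto|]. split; auto. apply in_Exp. now apply pr_maps.
Qed.

Lemma counterexample_marked x : x ∈ points -> (marked counterexample x <-> label x =
  Mark).
Proof.
  intro Hx. unfold marked. rewrite counterexample_rel by auto. unfold marks_class_of. tauto.
Qed.

Lemma counterexample_similar x y : x ∈ points -> y ∈ points ->
  (similar counterexample x y <-> pi1 x = pi1 y).
Proof.
  intros Hx Hy. unfold similar. rewrite counterexample_uni. split.
  - intros (z & Hz & H1 & H2). apply counterexample_rel in H1, H2; auto.
    destruct H1, H2. congruence.
  - intro E. exists (relabel x Mark emp). pose proof (mark_points x Hx) as H.
    split; auto.
    rewrite !counterexample_rel by auto. unfold marks_class_of.
    rewrite label_relabel, pi1_relabel. auto.
Qed.

Lemma counterexample_full x : x ∈ points -> (full counterexample x <-> pi1 (pi1 x) ∈ I).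
Proof.
  intros Hx. unfold full. rewrite counterexample_uni. split.
  - intros (y & Hy & H & N). rewrite counterexample_similar in H by auto.
    rewrite counterexample_marked in N by auto. rewrite H. apply in_points in Hy.
    destruct Hy as (c & m & d & n & -> & _ & _ & _ & Hd). unfold label in N.
    rewrite !pi2_opair, ?pi1_opair in *. tauto.
  - intro Hc. apply in_points in Hx. destruct Hx as (c & m & d & n & -> & Hm & Hn & Hc'
      & Hd).
    rewrite !pi1_opair in Hc. destruct (hne c Hc) as [e He].
    assert (P : point c m e ∈ points) by now apply unmarked_point_points.
    exists (point c m e). split; auto.
    rewrite counterexample_similar, counterexample_marked; auto.
    + rewrite pi1_point, pi1_opair, label_point. split; auto. intros ->.
      apply (not_in_self Mark). now apply (in_Fam_Mark c).
    + apply in_points. exists c, m, d, n. auto.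
Qed.

(** A single index [i] suffices for infinitely many full classes, because classes carry a component
    in [omega]; with [I] in place of [i] the same component gives infinitely many classes that are
    not full. *)
Lemma counterexample_rich : rich counterexample.
Proof.
  split; rewrite counterexample_uni.
  - intros x Hx. now apply counterexample_similar.
  - intros x y z Hx Hy Hz. rewrite !counterexample_similar by auto. congruence.
  - intros x y Hx Hy. rewrite counterexample_rel, counterexample_marked,
      counterexample_similar by auto.
    unfold marks_class_of. tauto.
  - intros x Hx.
    assert (D : dterm (fun r : env => relabel x (label x) (r 0))) by (unfold relabel,
      label; dfn).
    exists (lam omega (fun n => relabel x (label x) n)). split; [now apply lam_fn|].
    split.
    + intros n Hn. rewrite ap_lam by auto. pose proof (relabel_points x n Hx Hn) as P.
      rewrite counterexample_similar, !counterexample_marked, pi1_relabel,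
        label_relabel by auto. tauto.
    + intros n m Hn Hm. rewrite !ap_lam by auto. apply relabel_inj.
  - destruct hI as [i Hi].
    assert (D : dterm (fun r : env => point i (r 0) Mark)) by (unfold point; dfn).
    exists (lam omega (fun n => point i n Mark)). split; [now apply lam_fn|]. split.
    + intros n Hn. rewrite ap_lam by auto.
      assert (P : point i n Mark ∈ points) by (apply point_points; auto).
      rewrite counterexample_full, pi1_point, pi1_opair by auto. auto.
    + intros n m Hn Hm. rewrite !ap_lam by auto.
      rewrite counterexample_similar, !pi1_point by (apply point_points; auto).
      intro E. apply opair_inj in E. now destruct E.
  - assert (D : dterm (fun r : env => point I (r 0) Mark)) by (unfold point; dfn).
    exists (lam omega (fun n => point I n Mark)). split; [now apply lam_fn|]. split.
    + intros n Hn. rewrite ap_lam by auto.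
      assert (P : point I n Mark ∈ points) by (apply point_points; auto).
      rewrite counterexample_full, pi1_point, pi1_opair by auto. split; auto.
      apply not_in_self.
    + intros n m Hn Hm. rewrite !ap_lam by auto.
      rewrite counterexample_similar, !pi1_point by (apply point_points; auto).
      intro E. apply opair_inj in E. now destruct E.
Qed.

Context {U : V} (hU : is_ultrafilter I U).

(** * The ultrapower of the counterexample is rich *)

Section UltrapowerOfStructure.
Context {Ms N : V} (hMs : is_constant_family I counterexample Ms)
  (hN : is_ultraproduct L0 I U Ms N).
Notation cl := (cl I U Ms).
Notation fun_points f := (maps f I points).

Lemma power_universe c : c ∈ uni N <-> exists f, fun_points f /\ c = cl f.
Proof. rewrite <- counterexample_uni. apply (ultrapower_universe
  counterexample_structure hMs hN). Qed.

Lemma power_in f : fun_points f -> cl f ∈ uni N.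
Proof. intro Hf. apply power_universe. eauto. Qed.

Lemma power_rel f g : fun_points f -> fun_points g ->
  (Rel N (cl f) (cl g) <-> large I U (fun i => marks_class_of (ap f i) (ap g i))).
Proof.
  intros Hf Hg.
  rewrite (ultrapower_rel counterexample_structure hMs hN) by now rewrite
    counterexample_uni.
  apply mapsE in Hf, Hg. destruct Hf as [_ Hf], Hg as [_ Hg].
  apply large_ext. intros i Hi. apply counterexample_rel; auto.
Qed.

Lemma power_marked f : fun_points f ->
  (marked N (cl f) <-> large I U (fun i => label (ap f i) = Mark)).
Proof.
  intro Hf. unfold marked. rewrite power_rel by auto. apply large_ext.
  intros i Hi. unfold marks_class_of. tauto.
Qed.

Lemma power_similar f g : fun_points f -> fun_points g ->
  (similar N (cl f) (cl g) <-> large I U (fun i => pi1 (ap f i) = pi1 (ap g i))).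
Proof.
  intros Hf Hg. split.
  - intros (z & Hz & H1 & H2). apply power_universe in Hz. destruct Hz as (h & Hh & ->).
    rewrite power_rel in H1, H2 by auto.
    eapply large_mono; [exact hU|dfn|exact (large_and hU _ _ H1 H2)|].
    intros i _ [[_ E1] [_ E2]]. congruence.
  (* The common predecessor is obtained by an explicit operation at each index, so no choice
     enters. *)
  - intro H. set (h := lam I (fun i => relabel (ap f i) Mark emp)).
    assert (D : dterm (fun r : env => relabel (ap f (r 0)) Mark emp)) by (unfold
      relabel; dfn).
    assert (Hh : fun_points h).
    { apply lam_maps; auto. intros i Hi. apply mark_points. apply mapsE in Hf.
      now apply Hf. }
    assert (Eh : forall i, i ∈ I -> ap h i = relabel (ap f i) Mark emp).
    { intros i Hi. unfold h. now rewrite ap_lam. }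
    exists (cl h). split; [now apply power_in|]. rewrite !power_rel by auto. split.
    + apply large_all; auto. intros i Hi. unfold marks_class_of.
      now rewrite Eh, label_relabel, pi1_relabel.
    + eapply large_mono; [exact hU|unfold marks_class_of, label; dfn|exact H|].
      intros i Hi E. unfold marks_class_of. now rewrite Eh, label_relabel, pi1_relabel.
Qed.

Lemma const_points x : x ∈ points -> fun_points (lam I (fun _ => x)).
Proof. intro Hx. apply lam_maps; [dfn|auto]. Qed.

Lemma ap_const (x i : V) : i ∈ I -> ap (lam I (fun _ => x)) i = x.
Proof. intro Hi. apply (ap_lam I (fun _ => x)); [dfn|auto]. Qed.

Lemma power_similar_const x y : x ∈ points -> y ∈ points ->
  similar N (cl (lam I (fun _ => x))) (cl (lam I (fun _ => y))) -> pi1 x = pi1 y.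
Proof.
  intros Hx Hy H. rewrite power_similar in H by auto using const_points.
  apply (large_nonempty hU) in H. destruct H as (i & Hi & E).
  now rewrite !ap_const in E.
Qed.

Lemma dfn_label_Mark f : dterm f -> dfn (fun r : env => label (f r) = Mark).
Proof. intro. unfold label. dfn. Qed.

(** Every witness is explicit: a constant sequence, or a given sequence relabelled coordinatewise.
    Which classes of sequences are full is not determined in general, as this may depend on choice;
    [rich] only asks for infinitely many classes of each kind, and constant sequences provide
    them. *)
Lemma power_rich : rich N.
Proof.
  split.
  - intros c Hc. apply power_universe in Hc. destruct Hc as (f & Hf & ->).
    apply power_similar; auto. now apply large_all.
  - intros x y z Hx Hy Hz. apply power_universe in Hx, Hy, Hz.
    destruct Hx as (f & Hf & ->), Hy as (g & Hg & ->), Hz as (h & Hh & ->).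
    rewrite !power_similar by auto. intros H K.
    eapply large_mono; [exact hU|dfn|exact (large_and hU _ _ H K)|].
    intros i _ []. congruence.
  - intros x y Hx Hy. apply power_universe in Hx, Hy.
    destruct Hx as (f & Hf & ->), Hy as (g & Hg & ->).
    rewrite power_rel, power_marked, power_similar by auto. split.
    + intro H. split; (eapply large_mono; [exact hU|unfold label; dfn|exact H|]);
        intros i _ []; auto.
    + intros [H K]. exact (large_and hU _ _ H K).
  - intros c Hc. apply power_universe in Hc. destruct Hc as (f & Hf & ->).
    pose proof Hf as Hf'. apply mapsE in Hf'. destruct Hf' as [_ Vf].
    set (s := fun n => lam I (fun i => relabel (ap f i) (label (ap f i)) n)).
    assert (D : forall n, dterm (fun r : env => relabel (ap f (r 0)) (label (ap f (r
      0))) n)).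
    { intro n. unfold relabel, label. dfn. }
    assert (D' : dterm (fun r : env => cl (s (r 0)))).
    { unfold s, relabel, label. dfn. }
    assert (Hs : forall n, n ∈ omega -> fun_points (s n)).
    { intros n Hn. apply lam_maps; auto. intros i Hi. now apply relabel_points; auto. }
    assert (Es : forall n i, i ∈ I -> ap (s n) i = relabel (ap f i) (label (ap f i)) n).
    { intros n i Hi. unfold s. now rewrite ap_lam. }
    exists (lam omega (fun n => cl (s n))). split; [now apply lam_fn|]. split.
    + intros n Hn. rewrite (ap_lam omega (fun n => cl (s n))) by auto.
      split; [now apply power_in, Hs|].
      rewrite power_similar, !power_marked by auto. split.
      * apply large_all; auto. intros i Hi. now rewrite Es, pi1_relabel.
      * apply large_ext. intros i Hi. now rewrite Es, label_relabel.
    + intros n m Hn Hm. rewrite !(ap_lam omega (fun n => cl (s n))) by auto.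
      rewrite (ultrapower_eq hU counterexample_structure hMs) by (rewrite
        counterexample_uni; auto).
      intro H. apply (large_nonempty hU) in H. destruct H as (i & Hi & E).
      rewrite !Es in E by auto. now apply relabel_inj in E.
  - destruct hI as [i0 Hi0].
    set (s := fun n => lam I (fun _ => point i0 n Mark)).
    assert (D' : dterm (fun r : env => cl (s (r 0)))) by (unfold s, point; dfn).
    assert (P : forall n, n ∈ omega -> point i0 n Mark ∈ points) by (intros; apply
      point_points; auto).
    exists (lam omega (fun n => cl (s n))). split; [now apply lam_fn|]. split.
    + intros n Hn. rewrite (ap_lam omega (fun n => cl (s n))) by auto. unfold s.
      split; [apply power_in; auto using const_points|].
      (* One element of the single set [Fam(i0)] gives the unmarked witness, as a constant
         sequence. *)
      destruct (hne i0 Hi0) as [e He].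
      assert (Q : point i0 n e ∈ points) by now apply unmarked_point_points.
      exists (cl (lam I (fun _ => point i0 n e))).
      split; [apply power_in; auto using const_points|].
      rewrite power_similar, power_marked by auto using const_points. split.
      * apply large_all; auto. intros i Hi. now rewrite !ap_const, !pi1_point.
      * intro H. apply (large_nonempty hU) in H. destruct H as (i & Hi & E).
        rewrite ap_const, label_point in E by auto. subst e.
        apply (not_in_self Mark). now apply (in_Fam_Mark i0).
    + intros n m Hn Hm. rewrite !(ap_lam omega (fun n => cl (s n))) by auto.
      intro H. apply power_similar_const in H; auto. rewrite !pi1_point in H.
      apply opair_inj in H. now destruct H.
  - set (s := fun n => lam I (fun _ => point I n Mark)).
    assert (D' : dterm (fun r : env => cl (s (r 0)))) by (unfold s, point; dfn).
    assert (P : forall n, n ∈ omega -> point I n Mark ∈ points) by (intros; apply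
      point_points; auto).
    exists (lam omega (fun n => cl (s n))). split; [now apply lam_fn|]. split.
    + intros n Hn. rewrite (ap_lam omega (fun n => cl (s n))) by auto. unfold s.
      split; [apply power_in; auto using const_points|].
      intros (c & Hc & H & K). apply power_universe in Hc. destruct Hc as (g & Hg & ->).
      rewrite power_similar in H by auto using const_points. apply K.
      apply power_marked; auto.
      eapply large_mono; [exact hU|now apply dfn_label_Mark; dfn|exact H|].
      intros i Hi E. cbv beta in E. rewrite ap_const, pi1_point in E by auto.
      apply mapsE in Hg. destruct Hg as [_ Hg]. specialize (Hg i Hi).
      apply in_points in Hg.
      destruct Hg as (c' & m' & d & n' & Eg & _ & _ & _ & Hd). rewrite Eg in *.
      rewrite pi1_opair in E. apply opair_inj in E. destruct E as [<- _].
      unfold label. rewrite pi2_opair, pi1_opair. destruct Hd as [|[Hd _]]; auto.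
      now apply not_in_self in Hd.
    + intros n m Hn Hm. rewrite !(ap_lam omega (fun n => cl (s n))) by auto.
      intro H. apply power_similar_const in H; auto. rewrite !pi1_point in H.
      apply opair_inj in H. now destruct H.
Qed.
End UltrapowerOfStructure.

Lemma counterexample_LT1 : LT1 L0 counterexample I U.
Proof.
  intros N (Ms & hMs & hN). apply rich_elementarily_equivalent.
  - apply counterexample_structure.
  - apply hN.
  - apply counterexample_rich.
  - now apply (power_rich (Ms := Ms)).
Qed.

(** [∃ v_1, R(v_0, v_1) ∧ ¬ R(v_1, v_1)] *)
Definition has_unmarked : V :=
  pEx (num 1) (pAnd (pAtom emp (pr (tVar (num 0)) (tVar (num 1))))
    (pNot (pAtom emp (pr (tVar (num 1)) (tVar (num 1)))))).

Lemma num_subset k : subset (num k) omega.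
Proof. intros x Hx. eapply omega_elem; eauto using omega_num. Qed.

Lemma adj_num1 : adj (num 1) (num 1) = num 2 :> V.
Proof. apply ext. intro x. rewrite in_adj. simpl. rewrite !in_succ. tauto. Qed.

Lemma in_num1 (x : V) : x ∈ num 1 <-> x = num 0.
Proof.
  simpl. rewrite in_succ. split; [intros [H|H]; auto; now apply in_emp in H | auto].
Qed.

Lemma pair_terms j k : j ∈ num 2 -> k ∈ num 2 ->
  is_term_tuple L0 (num 2) (num 2) (pr (tVar j) (tVar k)).
Proof.
  intros Hj Hk. apply is_term_tupleE. split; [apply pr_fn|]. intros l Hl.
  apply in_num2 in Hl.
  destruct Hl as [->| ->]; rewrite ?pr_0, ?pr_1; now apply term_var.
Qed.

Lemma has_unmarked_formula : is_formula L0 (num 1) has_unmarked.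
Proof.
  pose proof (L0_rel emp (num 2)) as HR.
  apply formula_ex; auto using num_subset, omega_num. rewrite adj_num1.
  apply formula_and; auto using num_subset; [|apply formula_not; auto using num_subset];
    apply (formula_atom _ _ (num 2)); auto using num_subset; try tauto;
    apply pair_terms; apply in_num2; auto.
Qed.

(** At a marked point of a rich structure the right-hand side says that its class is full. This is
    why the sequence tested against [LT2] consists of marked points. *)
Lemma satisfies_has_unmarked M x : is_structure L0 M -> x ∈ uni M ->
  (satisfies L0 M has_unmarked (lam (num 1) (fun _ => x)) <->
   exists y, y ∈ uni M /\ Rel M x y /\ ~ Rel M y y).
Proof.
  intros SM Hx. pose proof (satisfies_tarski L0_language SM) as T.
  assert (Ha : maps (lam (num 1) (fun _ => x)) (num 1) (uni M)) by (apply lam_maps;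
    [dfn|auto]).
  assert (E : emp = (emp : V) /\ num 2 = (num 2 : V)) by auto.
  apply L0_rel in E.
  assert (i0 : num 0 ∈ num 2 :> Prop) by (apply in_num2; auto).
  assert (i1 : (num 1 : V) ∈ num 2) by (apply in_num2; auto).
  assert (i00 : (num 0 : V) ∈ num 1) by (apply in_num1; auto).
  pose proof (pair_terms _ _ i0 i1) as P01. pose proof (pair_terms _ _ i1 i1) as P11.
  pose proof (num_subset 2) as S2.
  pose proof (formula_atom _ _ _ _ S2 E P01) as F01.
  pose proof (formula_atom _ _ _ _ S2 E P11) as F11.
  destruct (T (num 1) _ (num_subset 1) Ha) as (_ & _ & _ & _ & K).
  unfold has_unmarked. rewrite K; auto using omega_num.
  2:{ rewrite adj_num1. apply formula_and; auto using formula_not. }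
  assert (Q : forall y, y ∈ uni M ->
    (satisfies L0 M (pAnd (pAtom emp (pr (tVar (num 0)) (tVar (num 1))))
      (pNot (pAtom emp (pr (tVar (num 1)) (tVar (num 1))))))
      (upd (num 1) (lam (num 1) (fun _ => x)) (num 1) y) <-> Rel M x y /\ ~ Rel M y y)).
  { intros y Hy. pose proof (upd_maps _ _ (num 1) y _ Ha Hy) as Hu.
    rewrite adj_num1 in Hu.
    destruct (T (num 2) _ S2 Hu) as (_ & T2 & T3 & T4 & _).
    rewrite T4, T3 by auto using formula_not. rewrite !(T2 emp (num 2)) by auto.
    rewrite !lam_pr, !pr_0, !pr_1 by dfn.
    rewrite !(tv_var L0_language SM S2 Hu) by auto.
    rewrite ap_upd_same, ap_upd_other; auto.
    - rewrite (ap_lam (num 1) (fun _ => x)); [|dfn|auto]. reflexivity.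
    - intro C. symmetry in C. now apply num_1_neq_0 in C. }
  split; intros (y & Hy & H); exists y; (split; [auto|]); now apply Q.
Qed.

Lemma counterexample_not_LT2 :
  (forall X c, X ∈ U -> is_function c X -> ~ forall i, i ∈ X -> ap c i ∈ ap Fam i) ->
  ~ LT2 L0 counterexample I U.
Proof.
  intros noc H.
  destruct (constant_family_exists (I := I) counterexample) as [Ms hMs].
  destruct (ultrapower_exists hU counterexample_structure hMs) as [N hN].
  specialize (H Ms N hMs hN).
  (* The diagonal sequence: its value at [i] is a marked point in a class attached to [i], which has
     unmarked points because [Fam(i)] is nonempty. *)
  set (f := lam I (fun i => point i emp Mark)).
  assert (D : dterm (fun r : env => point (r 0) emp Mark)) by (unfold point; dfn).
  assert (Hf : maps f I points).
  { apply lam_maps; auto. intros i Hi. apply point_points; auto using omega_emp. }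
  assert (Ef : forall i, i ∈ I -> ap f i = point i emp Mark) by (intros; unfold f; now
    rewrite ap_lam).
  set (s := lam (num 1) (fun _ => f)).
  pose proof (constant_family counterexample_structure hMs) as Hfam.
  assert (Hs : is_product_tuple I Ms (num 1) s).
  { apply is_product_tupleE. split; [apply lam_fn; dfn|]. intros k Hk. unfold s.
    rewrite (ap_lam (num 1) (fun _ => f)); [|dfn|auto].
    apply (constant_product counterexample_structure hMs).
    now rewrite counterexample_uni. }
  assert (K : satisfies L0 N has_unmarked (lam (num 1) (fun k => cl I U Ms (ap s k)))).
  { apply (H omega (num 0) (num 1) has_unmarked s).
    - now apply is_omegaE.
    - apply omega_num.
    - now apply is_succE.
    - apply has_unmarked_formula.
    - exact Hs.
    - now apply (is_class_tupleE (family_function Hfam) (family_structures Hfam)).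
    - apply (large_tuple_at (family_function Hfam) (fun M r => satisfies L0 M
        has_unmarked r)
        (num 1) s Hs).
      apply large_all; auto. intros i Hi. rewrite (constant_ap hMs) by auto.
      replace (lam (num 1) (fun k => ap (ap s k) i)) with (lam (num 1) (fun _ => point
        i emp Mark)).
      + assert (P : point i emp Mark ∈ points) by (apply point_points; auto using
          omega_emp).
        destruct (hne i Hi) as [e He].
        assert (Q : point i emp e ∈ points) by (apply unmarked_point_points; auto using
          omega_emp).
        apply satisfies_has_unmarked; rewrite ?counterexample_uni; auto using
          counterexample_structure.
        exists (point i emp e). split; auto. rewrite !counterexample_rel by auto.
        unfold marks_class_of. rewrite !label_point, !pi1_point. split; auto. intros [E _].
        subst e.
        apply (not_in_self Mark). now apply (in_Fam_Mark i).
      + apply lam_ext; [dfn|dfn|]. intros k Hk. unfold s.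
        rewrite (ap_lam (num 1) (fun _ => f)); [|dfn|auto]. now rewrite Ef. }
  replace (lam (num 1) (fun k => cl I U Ms (ap s k))) with (lam (num 1) (fun _ => cl I
    U Ms f)) in K.
  2:{ apply lam_ext; [dfn|dfn|]. intros k Hk. unfold s.
      rewrite (ap_lam (num 1) (fun _ => f)); [auto|dfn|auto]. }
  apply satisfies_has_unmarked in K; [|apply hN|].
  2:{ apply (power_in hMs hN). exact Hf. }
  destruct K as (c & Hc & K1 & K2). apply (power_universe hMs hN) in Hc.
  destruct Hc as (g & Hg & ->). rewrite (power_rel hMs hN) in K1, K2 by auto.
  rewrite <- (large_not hU) in K2 by (unfold marks_class_of, label; dfn).
  destruct (large_and hU _ _ K1 K2) as (X & HX & EX).
  (* For [i] in [X] the point [g(i)] is unmarked and in the class of [f(i)], so its label is an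
     element of [Fam(i)]. *)
  apply (noc X (lam X (fun i => label (ap g i))) HX).
  { apply lam_fn. unfold label. dfn. }
  intros i HiX. rewrite ap_lam; [|unfold label; dfn|auto]. apply EX in HiX.
  destruct HiX as [Hi [[_ E] Nm]]. rewrite Ef, pi1_point in E by auto.
  apply mapsE in Hg. destruct Hg as [_ Hg]. specialize (Hg i Hi). apply in_points in Hg.
  destruct Hg as (c' & m' & d & n' & Eg & _ & _ & _ & Hd). rewrite Eg in *.
  unfold marks_class_of, label in *. rewrite !pi2_opair, ?pi1_opair in *.
  apply opair_inj in E. destruct E as [<- _]. tauto.
Qed.
End Counterexample.

(** * Countable choice and the theorem *)

Section Main.
Context {V : membership_structure} {hV : ZF V}.
Notation env := (nat -> V).

(** The hypothesis concerns one ultrafilter only, so the lemma serves (1), where [U] is given, as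
    well as (2). *)
Lemma ultra_choice_of_LT1_LT2 I U : is_ultrafilter I U ->
  (forall L M : V, is_language L -> is_structure L M -> LT1 L M I U -> LT2 L M I U) ->
  ultra_choice I U.
Proof.
  intros hU H Fam hF hne. pose proof (ultrafilter_index_nonempty hU) as hI.
  apply NNPP. intro N. apply (counterexample_not_LT2 hI hne hU).
  - intros X c HX Hc K. apply N. exists X, c. auto.
  - apply H.
    + apply L0_language.
    + now apply counterexample_structure.
    + now apply counterexample_LT1.
Qed.

(** A von Neumann numeral is the set of smaller numbers, so [n ∈ U] says that an initial segment is
    large. Of a large [succ n], either [n] is still large, or its complement is and meets [succ n]
    in the singleton of [n] alone. *)
Lemma principal_of_finite U n : is_ultrafilter omega U -> n ∈ omega -> n ∈ U ->
  is_principal omega U.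
Proof.
  intros hU Hn. pose proof hU as (U1 & U2 & U3 & U4 & U5 & U6). revert n Hn.
  apply (omega_ind (fun n => n ∈ U -> is_principal omega U)).
  - unfold is_principal. dfn.
  - intro K. destruct (U3 emp); auto. intros x Hx. now apply in_emp in Hx.
  - intros n Hn IH K.
    destruct (U6 n (sep omega (fun i => ~ i ∈ n))) as [L|L].
    + intros k Hk. eapply omega_elem; eauto.
    + intro i. rewrite in_sep by dfn. tauto.
    + auto.
    + assert (S : upair n n ∈ U).
      { apply (U5 (succ n) (sep omega (fun i => ~ i ∈ n))); auto.
        intro i. rewrite in_upair, in_succ, in_sep by dfn. split.
        - intro E. assert (i = n) by tauto. subst i. pose proof (not_in_self n). tauto.
        - intros [[|] []]; tauto. }
      exists n. split; auto. intro X. split.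
      * intro HX. split; auto. apply NNPP. intro N.
        apply (U3 (sep X (fun x => x ∈ upair n n))).
        -- intros x Hx. rewrite in_sep, in_upair in Hx by dfn.
           destruct Hx as [Hx [E|E]]; subst x; auto.
        -- apply (U5 X (upair n n)); auto. intro x. rewrite in_sep by dfn. tauto.
      * intros [HX Hx]. apply (U4 (upair n n)); auto. intros x Hx'.
        apply in_upair in Hx'. destruct Hx' as [->| ->]; auto.
Qed.

(** Otherwise [X] is contained in [succ k], which is then large. *)
Lemma unbounded_of_nonprincipal U X k : is_ultrafilter omega U -> ~ is_principal omega
  U ->
  X ∈ U -> k ∈ omega -> exists m, m ∈ X /\ k ∈ m.
Proof.
  intros hU N HX Hk. apply NNPP. intro M. apply N.
  apply (principal_of_finite U (succ k)); auto using omega_succ.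
  destruct hU as (U1 & _ & _ & U4 & _). apply (U4 X); auto.
  - intros m Hm. apply in_succ. specialize (U1 X HX m Hm).
    destruct (omega_trichotomy m k) as [K|[K|K]]; auto. destruct M. eauto.
  - intros m Hm. apply (omega_elem (succ k)); auto using omega_succ.
Qed.

(** A choice function for the sets [Π_(k < n) A_k], [n ∈ X], yields one for the
    [A_k] as soon as [X] is unbounded. *)
Lemma AC_omega_of_ultra_choice U : is_ultrafilter omega U -> ~ is_principal omega U ->
  ultra_choice omega U -> AC_omega V.
Proof.
  intros hU N hC w A Hw HA HAne. apply is_omegaE in Hw. subst w.
  assert (Ane : forall k, k ∈ omega -> nonempty (ap A k)).
  { intros k Hk. apply (HAne k). now apply (fn_pair_mem A omega). }
  set (Z := Un (rep omega (ap A))).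
  assert (HZ : forall k x, k ∈ omega -> x ∈ ap A k -> x ∈ Z).
  { intros k x Hk Hx. unfold Z. apply in_Un. exists (ap A k). split; auto.
    rewrite in_rep by dfn. eauto. }
  set (B := fun n => sep (Exp n Z) (fun c => forall k, k ∈ n -> ap c k ∈ ap A k)).
  assert (DB : dterm (fun r : env => B (r 0))).
  { unfold B. apply (dterm_sep (fun r => Exp (r 0) Z)
      (fun c r => forall k, k ∈ r 0 -> ap c k ∈ ap A k)); [|dfn].
    unseal Exp. dfn. }
  assert (inB : forall n c, c ∈ B n <-> maps c n Z /\ forall k, k ∈ n -> ap c k ∈ ap A
    k).
  { intros n c. unfold B. rewrite in_sep by dfn. now rewrite in_Exp. }
  (* Finite choice is provable in [ZF]: the induction on [n] extends one tuple by one element at a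
     time. *)
  assert (Bne : forall n, n ∈ omega -> exists c, c ∈ B n).
  { apply omega_ind; [dfn| |].
    - exists emp. apply inB. split.
      + apply mapsE. split; [apply emp_function|]. intros x Hx. now apply in_emp in Hx.
      + intros k Hk. now apply in_emp in Hk.
    - intros n Hn (c & Hc). apply inB in Hc. destruct Hc as [Hc Kc].
      destruct (Ane n Hn) as [x Hx]. exists (upd n c n x). apply inB. split.
      + change (maps (upd n c n x) (succ n) Z).
        replace (succ n) with (adj n n) by now unseal succ. apply upd_maps; eauto.
      + intros k Hk. apply in_succ in Hk. destruct Hk as [Hk| ->].
        * rewrite ap_upd_other; auto. intros ->. now apply not_in_self in Hk.
        * now rewrite ap_upd_same. }
  destruct (hC (lam omega B)) as (X & c & HX & Hc & Kc).
  { now apply lam_fn. }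
  { intros n Hn. rewrite ap_lam by auto. now apply Bne. }
  pose proof (proj1 hU X HX) as HXo.
  (* The least element of [X] above [k]: foundation provides it, and minimality makes it unique, so
     no further choice is made. *)
  set (mu := fun k => the (fun m => m ∈ X /\ k ∈ m /\ forall m', m' ∈ X -> k ∈ m' -> ~
    m' ∈ m)).
  assert (Dmu : dterm (fun r : env => mu (r 0))) by (unfold mu; dfn).
  assert (Hmu : forall k, k ∈ omega -> mu k ∈ X /\ k ∈ mu k).
  { intros k Hk.
    destruct (ZF_foundation V hV (sep X (fun m => k ∈ m))) as (m & Hm & Lm).
    { destruct (unbounded_of_nonprincipal U X k) as (m & Hm & Km); auto.
      exists m. rewrite in_sep by dfn. auto. }
    rewrite in_sep in Hm by dfn. destruct Hm as [Hm Km].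
    assert (L : forall m', m' ∈ X -> k ∈ m' -> ~ m' ∈ m).
    { intros m' H1 H2 H3. apply (Lm m' H3). rewrite in_sep by dfn. auto. }
    replace (mu k) with m; auto. symmetry. apply the_eq; auto.
    intros z (H1 & H2 & H3). destruct (omega_trichotomy z m) as [E|[E|E]]; auto.
    - now destruct (L z).
    - now destruct (H3 m). }
  (* The tuple chosen at [mu k] has length greater than [k], so it has a component in [A_k]. *)
  exists (lam omega (fun k => ap (ap c (mu k)) k)). split; [apply lam_fn; dfn|].
  intros k a x Ha Hx. apply (fn_pair_mem A omega) in Ha; auto. destruct Ha as [Hk ->].
  apply (fn_pair_mem _ omega) in Hx; [|apply lam_fn; dfn]. destruct Hx as [_ ->].
  rewrite ap_lam; [|dfn|auto]. destruct (Hmu k Hk) as [M1 M2].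
  specialize (Kc (mu k) M1). rewrite ap_lam in Kc by auto. apply inB in Kc.
  now apply Kc.
Qed.
End Main.

Theorem theorem1p4 (V : membership_structure) (hV : ZF V) :
  (forall w U : V,
     is_omega w -> is_ultrafilter w U -> ~ is_principal w U -> ~ AC_omega V ->
     exists L M : V,
       is_language L /\ is_structure L M /\ LT1 L M w U /\ ~ LT2 L M w U)
  /\
  (LT V <->
   forall L M I U : V,
     is_language L -> is_structure L M -> is_ultrafilter I U ->
     LT1 L M I U -> LT2 L M I U).
Proof.
  split; [|split].
  (* If (1) fails for this [U], then [LT1] implies [LT2] at [U] for every structure, and countable
     choice follows. *)
  - intros w U Hw hU N nAC. apply is_omegaE in Hw. subst w. apply NNPP. intro E.
    apply nAC, (AC_omega_of_ultra_choice U hU N), (ultra_choice_of_LT1_LT2 _ _ hU).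
    intros L M hL hM H1. apply NNPP. intro H2. apply E. exists L, M. auto.
  - intros H L M I U hL hM hU _ Ms N hMs hN. apply (H L I U Ms N hL hU).
    + now apply (constant_family hM).
    + now apply (constant_product_nonempty hM).
    + exact hN.
  (* The hypothesis is about single structures; the passage to arbitrary families goes through
     [ultra_choice], in which no structure occurs. *)
  - intros H L I U Ms N hL hU hMs (f0 & H0) hN.
    apply (Los_equivalence_of_choice hU hL hMs hN) with f0; auto.
    apply ultra_choice_of_LT1_LT2; auto.
Qed.
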